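(* Let $\Gamma=(\mathbb{Z}_2)^n$ with $n\ge 1$, let $A$ be a $\Gamma$-commutative algebra, let $M$ be a free graded $A$-module of rank $\mathbf{r}=(r_1,\dots,r_N)$ with $N=2^n$, of total rank $r=\sum_i r_i$, and put $r'=\sum_{i=1}^{q}r_i$ with $q=2^{n-1}$. Let $\pi\in\Gamma$ be an odd element with associated parity functor $\Pi$, let $\mathcal{K}=S_A^{\bullet}(\Pi M\oplus M^* )$ with differential $d$ = left multiplication by $\sum_i \Pi e_i\,\varepsilon^i$, and let $H(\mathcal{K}^\bullet)=\ker d/\operatorname{im} d$. Then the map $$\psi:\ \Gamma\mathrm{Ber}(M)\longrightarrow H(\mathcal{K}^{\bullet}),\qquad \mathrm{B}(\{e_i\})\longmapsto [\xi_1\cdots\xi_r],$$ where $\xi_1,\dots,\xi_r$ are the odd variables associated with the standard basis $\{e_i\}$ of $M$, is an isomorphism of $A$-modules of degree $r'\pi$.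
   Context: Grading: $\Gamma=(\mathbb{Z}_2)^n$ with $\langle x,y\rangle=\sum_i x_iy_i\in\mathbb{Z}_2$. An element $\gamma$ is even if $\langle\gamma,\gamma\rangle=0$ and odd if $\langle\gamma,\gamma\rangle=1$. The $N=2^n$ elements are enumerated $\gamma_1,\dots,\gamma_N$ in the standard order: first the $q=2^{n-1}$ even ones in lexicographic order, then the odd ones in lexicographic order. The degree of a homogeneous element $a$ is written $\tilde a$. A $\Gamma$-commutative algebra $A=\bigoplus_{\gamma}A^\gamma$ is an associative unital $\Gamma$-graded algebra over a field of characteristic $0$ with $ab=(-1)^{\langle\tilde a,\tilde b\rangle}ba$ for homogeneous $a,b$. Graded left $A$-modules are also right modules via $ma=(-1)^{\langle\tilde a,\tilde m\rangle}am$. A map $\ell:M\to N$ is $A$-linear of degree $\gamma$ if it is additive, $\ell(M^\alpha)\subset N^{\alpha+\gamma}$ and $\ell(ma)=\ell(m)a$ (equivalently $\ell(am)=(-1)^{\langle\gamma,\tilde a\rangle}a\,\ell(m)$). A free graded module of rank $\mathbf{r}=(r_1,\dots,r_N)$ has a homogeneous basis with $r_i$ elements of degree $\gamma_i$; a standard basis $\{e_i\}_{i=1,\dots,r}$ is such a basis ordered so that the first $r_1$ elements have degree $\gamma_1$, the next $r_2$ degree $\gamma_2$, etc. The dual $M^*$ is the graded module of all $A$-linear maps $M\to A$ (direct sum over degrees), with module structure $(\ell\cdot a)(m)=\ell(am)$, and dual basis $\varepsilon^i(e_j)=\delta^i_j$, $\tilde{\varepsilon^i}=\tilde e_i$. Parity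 functor: for an odd $\pi\in\Gamma$, $(\Pi M)^\alpha=M^{\alpha+\pi}$, with $\Pi(m+m')=\Pi m+\Pi m'$ and $\Pi(am)=(-1)^{\langle\pi,\tilde a\rangle}a\,\Pi m$; so $\Pi m$ has degree $\tilde m+\pi$. $S_A^\bullet(P)$ is the graded symmetric algebra of a graded $A$-module $P$: the quotient of the tensor algebra over $A$ by the ideal generated by $m\otimes m'-(-1)^{\langle\tilde m,\tilde m'\rangle}m'\otimes m$; it is $\Gamma$-commutative. The element $\sum_i\Pi e_i\,\varepsilon^i$ of $S_A^\bullet(\Pi M\oplus M^* )$ does not depend on the standard basis and its square is $0$. For a standard basis $\{e_i\}$: $\xi_i=\Pi e_i$ for $1\le i\le r'$ and $\xi_i=-(-1)^{\langle\tilde e_i,\pi\rangle}\varepsilon^i$ for $r'<i\le r$. $\mathsf{GL}^0(\mathbf{r};A)$ is the group of invertible degree-$0$ graded matrices, i.e. matrices of degree-preserving automorphisms of a free module of rank $\mathbf{r}$ in a standard basis (elements being column vectors of right coordinates, matrix acting by left multiplication); such a matrix is divided into blocks $X_{uv}$ of size $r_u\times r_v$ whose entries lie in $A^{\gamma_u+\gamma_v}$. The graded Berezinian $\Gamma\mathrm{Ber}:\mathsf{GL}^0(\mathbf{r};A)\to(A^0)^\times$ is (by a known theorem) the unique group homomorphism such that $\Gamma\mathrm{Ber}(X)=\prod_{u=1}^{q}\det(X_{uu})\cdot\prod_{u=q+1}^{N}\det(X_{uu})^{-1}$ for block-diagonal $X$, and $\Gamma\mathrm{Ber}(X)=1$ for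 every lower or upper block-unitriangular $X$. Graded Berezinian module $\Gamma\mathrm{Ber}(M)$: the free graded $A$-module of total rank $1$ built from formal basis elements $\mathrm{B}(\{e_i\})$, one for each standard basis $\{e_i\}$ of $M$ (of rank $\mathbf{r}$), subject to $\mathrm{B}(\{e'_i\})=\mathrm{B}(\{e_i\})\,\Gamma\mathrm{Ber}(T)$ whenever $e'_i=\sum_j e_j\,t^j_{\ i}$ with $T=(t^j_{\ i})\in\mathsf{GL}^0(\mathbf{r};A)$. The element $\mathrm{B}(\{e_i\})$ has degree $\sum_{i=1}^N r_i\gamma_i$. *)

(* Defs.v *)
From HB Require Import structures.
From mathcomp Require Import all_boot all_order all_algebra.
From mathcomp Require Import boolp.

Set Implicit Arguments.
Unset Strict Implicit.
Unset Printing Implicit Defensive.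

Import GRing.Theory.
Local Open Scope ring_scope.
Local Open Scope quotient_scope.

Notation Gam n := ('rV['F_2]_n).

Section Pairing.
Variable n : nat.
Implicit Types x y z : Gam n.

Definition gpair x y : 'F_2 := \sum_i x 0 i * y 0 i.

Definition godd x : bool := gpair x x == 1.

Definition gsgn (R : pzRingType) x y : R := (-1) ^+ gpair x y.

Lemma gpairC x y : gpair x y = gpair y x.
Proof. by apply: eq_bigr => i _; rewrite mulrC. Qed.

Lemma gpairDl x y z : gpair (x + y) z = gpair x z + gpair y z.
Proof. by rewrite -big_split; apply: eq_bigr => i _; rewrite mxE mulrDl. Qed.

Lemma gsgnC R x y : gsgn R x y = gsgn R y x.
Proof. by rewrite /gsgn gpairC. Qed.

Lemma gsgnDl R x y z : gsgn R (x + y) z = gsgn R x z * gsgn R y z.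
Proof.
rewrite /gsgn gpairDl -exprD -signr_odd -[RHS]signr_odd; congr (_ ^+ _).
by rewrite /= modn2 oddb.
Qed.

Lemma gsgnDr R x y z : gsgn R z (x + y) = gsgn R z x * gsgn R z y.
Proof. by rewrite ![gsgn R z _]gsgnC gsgnDl. Qed.

Lemma gsgn0 R x : gsgn R 0 x = 1.
Proof.
by rewrite /gsgn /gpair big1 ?expr0 // => i _; rewrite mxE mul0r.
Qed.

Lemma gsgn_comm (R : pzRingType) x y (a : R) : gsgn R x y * a = a * gsgn R x y.
Proof. exact/commr_sym/commr_sign. Qed.

Lemma gsgnK (R : pzRingType) x y : gsgn R x y * gsgn R x y = 1.
Proof. by rewrite /gsgn -expr2 sqrr_sign. Qed.

Lemma gamDD x : x + x = 0.
Proof.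
by apply/rowP => i; rewrite !mxE -mulr2n -mulr_natl pchar_Fp_0 ?mul0r.
Qed.

Lemma gamN x : - x = x.
Proof. by apply/eqP; rewrite eq_sym -addr_eq0 gamDD. Qed.

(* Lexicographic order on rows of bits, the first coordinate being the most
   significant. *)
Definition lexle x y : bool :=
  (x == y) || [exists i : 'I_n, [forall (j : 'I_n | (j < i)%N), x 0 j == y 0 j]
                         && (x 0 i == 0) && (y 0 i == 1)].

Definition std_enum : seq (Gam n) :=
  sort lexle [seq x <- enum {: Gam n} | ~~ godd x]
  ++ sort lexle [seq x <- enum {: Gam n} | godd x].

(* The degrees are numbered from 0: [std_deg u] is the (u+1)-st element. *)
Definition std_deg (u : 'I_(2 ^ n)) : Gam n := nth 0 std_enum u.

End Pairing.

(* A decomposition V = \bigoplus_g V^g, given by the family of its projections;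
   V^g is the set of fixed points of the projection of index g. *)
Record gradation (n : nat) (V : zmodType) := Gradation {
  gpr :> Gam n -> V -> V;
  gprD : forall g, {morph gpr g : x y / x + y};
  gprK : forall g h x, gpr g (gpr h x) = if g == h then gpr h x else 0;
  gpr_sum : forall x, \sum_g gpr g x = x
}.

Definition homog n V (G : gradation n V) (g : Gam n) (x : V) : Prop :=
  G g x = x.

Section GradationTheory.
Variables (n : nat) (V : zmodType) (G : gradation n V).

Lemma gpr0 g : G g 0 = 0.
Proof. by apply: (addrI (G g 0)); rewrite -gprD !addr0. Qed.

Lemma gprN g x : G g (- x) = - G g x.
Proof. by apply/eqP; rewrite -addr_eq0 -gprD addNr gpr0. Qed.

Lemma gprB g x y : G g (x - y) = G g x - G g y.
Proof. by rewrite gprD gprN. Qed.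

Lemma gpr_bigsum g (I : Type) (s : seq I) P (F : I -> V) :
  G g (\sum_(i <- s | P i) F i) = \sum_(i <- s | P i) G g (F i).
Proof. exact: (big_morph (G g) (gprD G g) (gpr0 g)). Qed.

Lemma homog_gpr g x : homog G g (G g x).
Proof. by rewrite /homog gprK eqxx. Qed.

Lemma homogE g h x : homog G h x -> G g x = if g == h then x else 0.
Proof. by move=> <-; rewrite gprK. Qed.

Lemma homog0 g : homog G g 0. Proof. exact: gpr0. Qed.

Lemma homogD g x y : homog G g x -> homog G g y -> homog G g (x + y).
Proof. by move=> hx hy; rewrite /homog gprD hx hy. Qed.

Lemma homogN g x : homog G g x -> homog G g (- x).
Proof. by move=> hx; rewrite /homog gprN hx. Qed.

End GradationTheory.

Lemma gpr_biadd n (U V W : zmodType) (GU : gradation n U) (GV : gradation n V)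
    (GW : gradation n W) (B : U -> V -> W) :
    (forall v, {morph B^~ v : x y / x + y}) ->
    (forall u, {morph B u : x y / x + y}) ->
    (forall g h u v, homog GU g u -> homog GV h v -> homog GW (g + h) (B u v)) ->
  forall g u v, GW g (B u v) = \sum_h B (GU h u) (GV (g - h) v).
Proof.
move=> Dl Dr Bh g u v.
have B0l x : B 0 x = 0 by apply: (addrI (B 0 x)); rewrite -Dl !addr0.
have B0r x : B x 0 = 0 by apply: (addrI (B x 0)); rewrite -Dr !addr0.
rewrite -{1}(gpr_sum GU u) (big_morph (B^~ v) (Dl v) (B0l v)) gpr_bigsum.
apply: eq_bigr => h _.
rewrite -{1}(gpr_sum GV v) (big_morph (B _) (Dr _) (B0r _)) gpr_bigsum.
rewrite (bigD1 (g - h)) //= big1 ?addr0 => [|i hi].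
  by rewrite (homogE _ (Bh h (g - h) _ _ (homog_gpr _ _ _) (homog_gpr _ _ _)))
             addrC subrK eqxx.
rewrite (homogE _ (Bh h i _ _ (homog_gpr _ _ _) (homog_gpr _ _ _))).
by case: eqP => // E; move: hi; rewrite E addrC addKr eqxx.
Qed.

Record gcAlg (k : fieldType) (n : nat) := GCAlg {
  ga_sort :> algType k;
  ga_gr : gradation n ga_sort;
  ga_scale : forall g (c : k) a, homog ga_gr g a -> homog ga_gr g (c *: a);
  ga_one : homog ga_gr 0 1;
  ga_mul : forall g h a b,
    homog ga_gr g a -> homog ga_gr h b -> homog ga_gr (g + h) (a * b);
  ga_comm : forall g h a b,
    homog ga_gr g a -> homog ga_gr h b -> a * b = gsgn ga_sort g h * (b * a)
}.

Record gmod (k : fieldType) (n : nat) (A : gcAlg k n) := GMod {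
  gm_sort :> lmodType A;
  gm_gr : gradation n gm_sort;
  gm_act : forall g h (a : A) (m : gm_sort),
    homog (ga_gr A) g a -> homog gm_gr h m -> homog gm_gr (g + h) (a *: m)
}.

Section Twist.
Variables (k : fieldType) (n : nat) (A : gcAlg k n).
Implicit Types (a b : A) (g h d : Gam n).

(* The automorphism of A equal to (-1)^<g, d> on A^g. *)
Definition twist d a : A := \sum_g gsgn A g d * ga_gr A g a.

Lemma twist_homog d g a : homog (ga_gr A) g a -> twist d a = gsgn A g d * a.
Proof.
move=> ha; rewrite /twist (bigD1 g) //= big1 ?addr0 ?ha // => h /negPf hg.
by rewrite (homogE _ ha) hg mulr0.
Qed.

Lemma twistD d : {morph twist d : a b / a + b}.
Proof.
by move=> a b; rewrite -big_split; apply: eq_bigr => g _; rewrite gprD mulrDr.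
Qed.

Lemma twist0 d : twist d 0 = 0.
Proof. by rewrite /twist big1 // => g _; rewrite gpr0 mulr0. Qed.

Lemma twist_sum d (I : Type) (s : seq I) P (F : I -> A) :
  twist d (\sum_(i <- s | P i) F i) = \sum_(i <- s | P i) twist d (F i).
Proof. exact: (big_morph (twist d) (twistD d) (twist0 d)). Qed.

Lemma twist1 d : twist d 1 = 1.
Proof. by rewrite (twist_homog d (ga_one A)) gsgn0 mulr1. Qed.

Lemma gsgnMsgn g h d (x y : A) :
  gsgn A (g + h) d * (x * y) = (gsgn A g d * x) * (gsgn A h d * y).
Proof.
by rewrite gsgnDl -!mulrA; congr (_ * _); rewrite !mulrA gsgn_comm.
Qed.

Lemma ga_prM g a b :
  ga_gr A g (a * b) = \sum_h ga_gr A h a * ga_gr A (g - h) b.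
Proof.
apply: (gpr_biadd (B := fun x y : A => x * y)) => [v x y|u x y|]; last exact: ga_mul.
  by rewrite mulrDl.
by rewrite mulrDr.
Qed.

Lemma gpr_twist d g a : ga_gr A g (twist d a) = gsgn A g d * ga_gr A g a.
Proof.
have sh h x : ga_gr A g (gsgn A h d * x) = gsgn A h d * ga_gr A g x.
  rewrite /gsgn -signr_odd; case: odd; first by rewrite expr1 !mulN1r gprN.
  by rewrite expr0 !mul1r.
rewrite gpr_bigsum (bigD1 g) //= big1 ?addr0 => [|h hg].
  by rewrite sh gprK eqxx.
by rewrite sh gprK eq_sym (negPf hg) mulr0.
Qed.

Lemma twistM d : {morph twist d : a b / a * b}.
Proof.
move=> a b; rewrite /twist.
under eq_bigr do rewrite ga_prM mulr_sumr.
rewrite exchange_big mulr_suml; apply: eq_bigr => h _.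
rewrite mulr_sumr (reindex_inj (addIr h)); apply: eq_bigr => g _ /=.
by rewrite addrK addrC gsgnMsgn.
Qed.

Lemma twist_twist d h a : twist d (twist h a) = twist (d + h) a.
Proof.
by apply: eq_bigr => g _; rewrite gpr_twist gsgnDr mulrA.
Qed.

Lemma twist_0 a : twist 0 a = a.
Proof.
by rewrite -[RHS](gpr_sum (ga_gr A)); apply: eq_bigr => g _; rewrite gsgnC gsgn0 mul1r.
Qed.

Lemma twistK d : involutive (twist d).
Proof. by move=> a; rewrite twist_twist gamDD twist_0. Qed.

Lemma homog_twist d g a : homog (ga_gr A) g a -> homog (ga_gr A) g (twist d a).
Proof. by move=> ha; rewrite /homog gpr_twist ha (twist_homog d ha). Qed.

End Twist.

Section RightAction.
Variables (k : fieldType) (n : nat) (A : gcAlg k n).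

(* The right action, m a = (-1)^<|a|, |m|> a m for homogeneous a and m. *)
Definition ract (M : gmod A) (m : M) (a : A) : M :=
  \sum_h twist h a *: gm_gr M h m.

Variable M : gmod A.
Implicit Types (m : M) (a b : A) (g h : Gam n).

Lemma ract_homog h m a : homog (gm_gr M) h m -> ract m a = twist h a *: m.
Proof.
move=> hm; rewrite /ract (bigD1 h) //= big1 ?addr0 ?hm // => g /negPf hg.
by rewrite (homogE _ hm) hg scaler0.
Qed.

Lemma ractDl a : {morph (fun m => ract m a) : x y / x + y}.
Proof.
by move=> x y; rewrite -big_split; apply: eq_bigr => h _; rewrite gprD scalerDr.
Qed.

Lemma ractDr m : {morph ract m : x y / x + y}.
Proof.
by move=> x y; rewrite -big_split; apply: eq_bigr => h _; rewrite twistD scalerDl.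
Qed.

Lemma ract0l a : ract (0 : M) a = 0.
Proof. by rewrite /ract big1 // => h _; rewrite gpr0 scaler0. Qed.

Lemma ract0r m : ract m 0 = 0.
Proof. by rewrite /ract big1 // => h _; rewrite twist0 scale0r. Qed.

Lemma ract1 m : ract m 1 = m.
Proof.
by rewrite -[RHS](gpr_sum (gm_gr M)); apply: eq_bigr => h _; rewrite twist1 scale1r.
Qed.

Lemma ract_suml (I : Type) (s : seq I) P (F : I -> M) a :
  ract (\sum_(i <- s | P i) F i) a = \sum_(i <- s | P i) ract (F i) a.
Proof. exact: (big_morph (fun m => ract m a) (ractDl a) (ract0l a)). Qed.

Lemma gm_prZ g a m :
  gm_gr M g (a *: m) = \sum_h ga_gr A h a *: gm_gr M (g - h) m.
Proof.
apply: (gpr_biadd (B := fun (x : A) (y : M) => x *: y)) => [v x y|u x y|];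
  last exact: gm_act.
  by rewrite scalerDl.
by rewrite scalerDr.
Qed.

Lemma homog_ract g h m a :
  homog (gm_gr M) h m -> homog (ga_gr A) g a -> homog (gm_gr M) (h + g) (ract m a).
Proof.
move=> hm ha; rewrite (ract_homog a hm) addrC; apply: gm_act => //.
exact: homog_twist.
Qed.

Lemma gpr_ract g m a :
  gm_gr M g (ract m a) = \sum_h ract (gm_gr M h m) (ga_gr A (g - h) a).
Proof.
apply: (gpr_biadd (B := fun (x : M) (y : A) => ract x y)) => [v|u|].
- exact: ractDl.
- exact: ractDr.
by move=> *; apply: homog_ract.
Qed.

Lemma ractA m a b : ract (ract m a) b = ract m (a * b).
Proof.
rewrite -(gpr_sum (gm_gr M) m).
rewrite (ract_suml _ _ _ a) (ract_suml _ _ _ b) (ract_suml _ _ _ (a * b)); apply: eq_bigr => h _.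
set x := gm_gr M h m; have hx : homog (gm_gr M) h x by exact: homog_gpr.
rewrite -{1}(gpr_sum (ga_gr A) a) -[in RHS](gpr_sum (ga_gr A) a).
rewrite (big_morph _ (ractDr x) (ract0r x)) ract_suml mulr_suml.
rewrite (big_morph _ (ractDr x) (ract0r x)); apply: eq_bigr => g _.
set c := ga_gr A g a; have hc : homog (ga_gr A) g c by exact: homog_gpr.
rewrite (ract_homog b (homog_ract hx hc)) !(ract_homog _ hx) scalerA twistM.
congr (_ *: _); rewrite (twist_homog h hc).
rewrite -(gpr_sum (ga_gr A) b) !twist_sum mulr_suml mulr_sumr.
apply: eq_bigr => f _.
set y := ga_gr A f b; have hy : homog (ga_gr A) f y by exact: homog_gpr.
rewrite !(twist_homog _ hy) gsgnDr.
transitivity (gsgn A f h * gsgn A g h * (gsgn A f g * (y * c))).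
  by rewrite -!mulrA; congr (_ * _); rewrite [y * (_ * _)]mulrA -gsgn_comm -!mulrA
             ![gsgn A g h * (_ * _)]mulrA (gsgn_comm g h (gsgn A f g)) -!mulrA.
rewrite (ga_comm hy hc) [gsgn A f g * _]mulrA gsgnK mul1r (gsgn_comm f h (gsgn A g h)).
by rewrite -!mulrA; congr (_ * _); rewrite mulrA gsgn_comm -mulrA.
Qed.

End RightAction.

Section LinearMaps.
Variables (k : fieldType) (n : nat) (A : gcAlg k n).

(* A-linear means right A-linear; for the left action, see glinZ. *)
Definition is_glinear (M N : gmod A) (g : Gam n) (f : M -> N) : Prop :=
  [/\ {morph f : x y / x + y},
      forall h x, homog (gm_gr M) h x -> homog (gm_gr N) (h + g) (f x)
    & forall x a, f (ract x a) = ract (f x) a].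

Record glin (M N : gmod A) (g : Gam n) := GLin {
  glin_fun :> M -> N;
  glinP : is_glinear g glin_fun
}.

Lemma glin0 M N g (f : glin M N g) : f 0 = 0.
Proof.
by case: (glinP f) => fD _ _; apply: (addrI (f 0)); rewrite -fD !addr0.
Qed.

Lemma glinN M N g (f : glin M N g) x : f (- x) = - f x.
Proof.
by case: (glinP f) => fD _ _; apply/eqP; rewrite -addr_eq0 -fD addNr glin0.
Qed.

Lemma glin_sum M N g (f : glin M N g) (I : Type) (s : seq I) P (F : I -> M) :
  f (\sum_(i <- s | P i) F i) = \sum_(i <- s | P i) f (F i).
Proof. by case: (glinP f) => fD _ _; exact: (big_morph f fD (glin0 f)). Qed.

Lemma glin_gpr M N g (f : glin M N g) h x :
  f (gm_gr M h x) = gm_gr N (h + g) (f x).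
Proof.
case: (glinP f) => fD fh _; rewrite -[in RHS](gpr_sum (gm_gr M) x) glin_sum.
rewrite gpr_bigsum (bigD1 h) //= big1 ?addr0 => [|i /negPf hi].
  by apply/esym/fh/homog_gpr.
rewrite (homogE _ (fh i _ (homog_gpr _ _ _))).
by rewrite (inj_eq (addIr g)) eq_sym hi.
Qed.

Lemma glinZ M N g (f : glin M N g) a x : f (a *: x) = twist g a *: f x.
Proof.
case: (glinP f) => fD fh fr.
rewrite -(gpr_sum (gm_gr M) x) scaler_sumr !glin_sum scaler_sumr.
apply: eq_bigr => h _; set y := gm_gr M h x.
have hy : homog (gm_gr M) h y by exact: homog_gpr.
rewrite -{1}(twistK h a) -(ract_homog (twist h a) hy) fr.
by rewrite (ract_homog _ (fh _ _ hy)) twist_twist addrAC gamDD add0r.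
Qed.

End LinearMaps.

Section Dual.
Variables (k : fieldType) (n : nat) (A : gcAlg k n) (M : gmod A).

(* All right A-linear maps M -> A: since Gam n is finite, each of them is the
   sum of its homogeneous components, so that this is the direct sum over g of
   the spaces of A-linear maps of degree g. *)
Record dual := Dual {
  dual_fun :> M -> A;
  dual_add : {morph dual_fun : x y / x + y};
  dual_lin : forall x a, dual_fun (ract x a) = dual_fun x * a
}.

Lemma dualP (f g : dual) : f =1 g -> f = g.
Proof.
case: f g => [f fD fr] [g gD gr] /= /funext fg; case: _ / fg in gD gr *.
by congr Dual; apply: Prop_irrelevance.
Qed.

HB.instance Definition _ := gen_eqMixin dual.
HB.instance Definition _ := gen_choiceMixin dual.

Lemma dual_sum (f : dual) (I : Type) (s : seq I) P (F : I -> M) :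
  f (\sum_(i <- s | P i) F i) = \sum_(i <- s | P i) f (F i).
Proof.
have f0 : f 0 = 0 by apply: (addrI (f 0)); rewrite -dual_add !addr0.
exact: (big_morph f (dual_add f) f0).
Qed.

#[local] Obligation Tactic := idtac.

Program Definition dual_zero := @Dual (fun=> 0) _ _.
Next Obligation. by move=> x y /=; rewrite addr0. Qed.
Next Obligation. by move=> x a /=; rewrite mul0r. Qed.

Program Definition dual_opp (f : dual) := @Dual (fun x => - f x) _ _.
Next Obligation. by move=> f x y /=; rewrite dual_add opprD. Qed.
Next Obligation. by move=> f x a /=; rewrite dual_lin mulNr. Qed.

Program Definition dual_plus (f g : dual) := @Dual (fun x => f x + g x) _ _.
Next Obligation. by move=> f g x y /=; rewrite !dual_add addrACA. Qed.
Next Obligation. by move=> f g x a /=; rewrite !dual_lin mulrDl. Qed.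

Fact dual_addA : associative dual_plus.
Proof. by move=> f g h; apply: dualP => x /=; rewrite addrA. Qed.
Fact dual_addC : commutative dual_plus.
Proof. by move=> f g; apply: dualP => x /=; rewrite addrC. Qed.
Fact dual_add0 : left_id dual_zero dual_plus.
Proof. by move=> f; apply: dualP => x /=; rewrite add0r. Qed.
Fact dual_addN : left_inverse dual_zero dual_opp dual_plus.
Proof. by move=> f; apply: dualP => x /=; rewrite addNr. Qed.

HB.instance Definition _ :=
  GRing.isZmodule.Build dual dual_addA dual_addC dual_add0 dual_addN.

(* The left structure corresponding to (f a)(x) = f (a x), see dual_ract. *)
Program Definition dual_scale (a : A) (f : dual) := @Dual (fun x => a * f x) _ _.
Next Obligation. by move=> a f x y /=; rewrite dual_add mulrDr. Qed.
Next Obligation. by move=> a f x b /=; rewrite dual_lin mulrA. Qed.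

Fact dual_scaleA a b f : dual_scale a (dual_scale b f) = dual_scale (a * b) f.
Proof. by apply: dualP => x /=; rewrite mulrA. Qed.
Fact dual_scale1 : left_id 1 dual_scale.
Proof. by move=> f; apply: dualP => x /=; rewrite mul1r. Qed.
Fact dual_scaleDr : right_distributive dual_scale +%R.
Proof. by move=> a f g; apply: dualP => x /=; rewrite mulrDr. Qed.
Fact dual_scaleDl f : {morph dual_scale^~ f : a b / a + b}.
Proof. by move=> a b; apply: dualP => x /=; rewrite mulrDl. Qed.

HB.instance Definition _ := GRing.Zmodule_isLmodule.Build A dual
  dual_scaleA dual_scale1 dual_scaleDr dual_scaleDl.

Lemma dual_addE (f g : dual) x : (f + g) x = f x + g x. Proof. by []. Qed.
Lemma dual_scaleE a (f : dual) x : (a *: f) x = a * f x. Proof. by []. Qed.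
Lemma dual_sumE (I : Type) (s : seq I) P (F : I -> dual) x :
  (\sum_(i <- s | P i) F i) x = \sum_(i <- s | P i) F i x.
Proof. by elim/big_rec2: _ => // i y f _ <-. Qed.

Definition dual_gpr_fun (g : Gam n) (f : dual) (x : M) : A :=
  \sum_h ga_gr A (h + g) (f (gm_gr M h x)).

Lemma ga_prM_homog g h a b : homog (ga_gr A) h b ->
  ga_gr A g (a * b) = ga_gr A (g - h) a * b.
Proof.
move=> hb; rewrite ga_prM (bigD1 (g - h)) //= big1 ?addr0 => [|i hi].
  by rewrite subKr hb.
rewrite (homogE _ hb); case: eqP => [E|]; last by rewrite mulr0.
by rewrite -E subKr eqxx in hi.
Qed.

Program Definition dual_gpr g f := @Dual (dual_gpr_fun g f) _ _.
Next Obligation.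
move=> g f x y; rewrite -big_split; apply: eq_bigr => h _.
by rewrite gprD dual_add gprD.
Qed.
Next Obligation.
move=> g f x a; rewrite /dual_gpr_fun.
under eq_bigr do rewrite gpr_ract dual_sum gpr_bigsum.
rewrite exchange_big mulr_suml; apply: eq_bigr => h _ /=.
rewrite -[in RHS](gpr_sum (ga_gr A) a) mulr_sumr (reindex_inj (addIr h)).
apply: eq_bigr => i _ /=; rewrite dual_lin addrK.
by rewrite (ga_prM_homog _ _ (homog_gpr _ i a)) -[i + h + g]addrA [i + _]addrC addrK.
Qed.

Fact dual_gprD g : {morph dual_gpr g : x y / x + y}.
Proof.
move=> f1 f2; apply: dualP => x /=; rewrite -big_split.
by apply: eq_bigr => h _; rewrite gprD.
Qed.
Fact dual_gprK g h f :
  dual_gpr g (dual_gpr h f) = if g == h then dual_gpr h f else 0.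
Proof.
apply: dualP => x; transitivity
  (\sum_i if g == h then ga_gr A (i + h) (f (gm_gr M i x)) else 0); last first.
  by case: eqP => // _; rewrite big1.
apply: eq_bigr => i _ /=; rewrite gpr_bigsum (bigD1 i) //= big1 ?addr0.
  by rewrite !gprK eqxx (inj_eq (addrI i)).
move=> j /negPf ji; rewrite gprK (gprK (gm_gr M)) ji.
have -> : f 0 = 0 by apply: (addrI (f 0)); rewrite -dual_add !addr0.
by rewrite gpr0 if_same.
Qed.
Fact dual_gpr_sum f : \sum_g dual_gpr g f = f.
Proof.
apply: dualP => x; rewrite dual_sumE exchange_big /=.
rewrite -[in RHS](gpr_sum (gm_gr M) x) dual_sum; apply: eq_bigr => h _.
rewrite (reindex_inj (addrI h)) -[RHS](gpr_sum (ga_gr A)); apply: eq_bigr => g _ /=.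
by rewrite addrA gamDD add0r.
Qed.

Definition dual_gr := Gradation dual_gprD dual_gprK dual_gpr_sum.

Lemma dual_homogP g (f : dual) :
  homog dual_gr g f <->
  forall h x, homog (gm_gr M) h x -> homog (ga_gr A) (h + g) (f x).
Proof.
split=> [<- h x hx|fh].
  rewrite /homog /= /dual_gpr_fun gpr_bigsum; apply: eq_bigr => i _.
  rewrite (homogE _ hx) gprK; case: (altP (i =P h)) => [->|_].
    by rewrite eqxx.
  have -> : f 0 = 0 by apply: (addrI (f 0)); rewrite -dual_add !addr0.
  by rewrite gpr0 if_same.
apply: dualP => x; rewrite -[in RHS](gpr_sum (gm_gr M) x) dual_sum.
by apply: eq_bigr => h _; apply/fh/homog_gpr.
Qed.

Fact dual_act g h (a : A) (f : dual) :
  homog (ga_gr A) g a -> homog dual_gr h f -> homog dual_gr (g + h) (a *: f).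
Proof.
move=> ha /dual_homogP fh; apply/dual_homogP => i x hx /=.
by rewrite addrCA; apply: ga_mul => //; apply: fh.
Qed.

Definition dual_gmod : gmod A := GMod dual_act.

Lemma dual_ract (f : dual_gmod) (a : A) (x : M) : ract f a x = f (a *: x).
Proof.
rewrite -(gpr_sum (gm_gr dual_gmod) f) ract_suml !dual_sumE; apply: eq_bigr => g _.
set l := gm_gr _ g f; have hl : homog (gm_gr dual_gmod) g l by exact: homog_gpr.
rewrite (ract_homog _ hl) dual_scaleE.
rewrite -(gpr_sum (gm_gr M) x) scaler_sumr !dual_sum mulr_sumr; apply: eq_bigr => h _.
set y := gm_gr M h x; have hy : homog (gm_gr M) h y by exact: homog_gpr.
rewrite -{2}(twistK h a) -(ract_homog (twist h a) hy) dual_lin.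
have hb := (dual_homogP g l).1 hl h y hy.
rewrite -(gpr_sum (ga_gr A) a) !twist_sum mulr_suml mulr_sumr; apply: eq_bigr => i _.
set c := ga_gr A i a; have hc : homog (ga_gr A) i c by exact: homog_gpr.
rewrite !(twist_homog _ hc) -mulrA (ga_comm hc hb) gsgnDr mulrA.
rewrite [gsgn A i h * _]gsgn_comm [gsgn A i g * _]mulrA gsgnK mul1r.
by rewrite mulrA gsgn_comm mulrA.
Qed.

End Dual.

Definition parity_sort k n (A : gcAlg k n) (p : Gam n) (M : gmod A) : Type := M.

Section Parity.
Variables (k : fieldType) (n : nat) (A : gcAlg k n) (p : Gam n) (M : gmod A).

Local Notation parity := (parity_sort p M).

HB.instance Definition _ := GRing.Zmodule.on parity.

Definition parity_elt (x : M) : parity := x.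

(* a * Pi x = Pi ((-1)^<p, |a|> a x) *)
Definition parity_scale (a : A) (x : parity) : parity := twist p a *: (x : M).

Fact parity_scaleA a b x :
  parity_scale a (parity_scale b x) = parity_scale (a * b) x.
Proof. by rewrite /parity_scale scalerA twistM. Qed.
Fact parity_scale1 : left_id 1 parity_scale.
Proof. by move=> x; rewrite /parity_scale twist1 scale1r. Qed.
Fact parity_scaleDr : right_distributive parity_scale +%R.
Proof. by move=> a x y; rewrite /parity_scale scalerDr. Qed.
Fact parity_scaleDl x : {morph parity_scale^~ x : a b / a + b}.
Proof. by move=> a b; rewrite /parity_scale twistD scalerDl. Qed.

HB.instance Definition _ := GRing.Zmodule_isLmodule.Build A parity
  parity_scaleA parity_scale1 parity_scaleDr parity_scaleDl.

Definition parity_gpr (g : Gam n) (x : parity) : parity := gm_gr M (g + p) x.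

Fact parity_gprD g : {morph parity_gpr g : x y / x + y}.
Proof. exact: gprD. Qed.
Fact parity_gprK g h x :
  parity_gpr g (parity_gpr h x) = if g == h then parity_gpr h x else 0.
Proof. by rewrite /parity_gpr gprK (inj_eq (addIr p)). Qed.
Fact parity_gpr_sum x : \sum_g parity_gpr g x = x.
Proof. by rewrite -[RHS](gpr_sum (gm_gr M)) [RHS](reindex_inj (addIr p)). Qed.

Definition parity_gr := Gradation parity_gprD parity_gprK parity_gpr_sum.

Fact parity_act g h (a : A) (x : parity) :
  homog (ga_gr A) g a -> homog parity_gr h x -> homog parity_gr (g + h) (a *: x).
Proof.
move=> ha hx; rewrite /homog /= /parity_gpr -addrA.
by apply: (gm_act (homog_twist p ha)).
Qed.

Definition parity_gmod : gmod A := GMod parity_act.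

End Parity.

Arguments parity_elt {k n A} p {M} x.

Section DirectSum.
Variables (k : fieldType) (n : nat) (A : gcAlg k n) (M N : gmod A).

Definition dsum_gpr (g : Gam n) (x : M * N) : M * N :=
  (gm_gr M g x.1, gm_gr N g x.2).

Fact dsum_gprD g : {morph dsum_gpr g : x y / x + y}.
Proof. by move=> x y; rewrite /dsum_gpr !gprD. Qed.
Fact dsum_gprK g h x :
  dsum_gpr g (dsum_gpr h x) = if g == h then dsum_gpr h x else 0.
Proof. by rewrite /dsum_gpr !gprK; case: eqP. Qed.
Fact dsum_gpr_sum x : \sum_g dsum_gpr g x = x.
Proof.
case: x => x y; rewrite -[in RHS](gpr_sum (gm_gr M) x) -[in RHS](gpr_sum (gm_gr N) y).
by elim/big_rec3: _ => // g a b c _ ->.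
Qed.

Definition dsum_gr := Gradation dsum_gprD dsum_gprK dsum_gpr_sum.

Fact dsum_act g h (a : A) (x : M * N) :
  homog (ga_gr A) g a -> homog dsum_gr h x -> homog dsum_gr (g + h) (a *: x).
Proof.
case: x => x y ha [hx hy]; rewrite /homog /= /dsum_gpr /=.
by congr (_, _); apply: gm_act.
Qed.

Definition dsum_gmod : gmod A := GMod dsum_act.

End DirectSum.

Section SubQuotient.
Variables (k : fieldType) (n : nat) (A : gcAlg k n) (M : gmod A).

Record gsub := GSub {
  gs_mem :> M -> Prop;
  gs_0 : gs_mem 0;
  gs_D : forall x y, gs_mem x -> gs_mem y -> gs_mem (x + y);
  gs_Z : forall a x, gs_mem x -> gs_mem (a *: x);
  gs_gpr : forall g x, gs_mem x -> gs_mem (gm_gr M g x)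
}.

Variable S : gsub.

Definition gs_pred : {pred M} := fun x => `[< S x >].

Fact gs_pred_closed : submod_closed gs_pred.
Proof.
split; first exact/asboolP/gs_0.
by move=> a x y /asboolP xS /asboolP yS; apply/asboolP/gs_D/yS/gs_Z.
Qed.
HB.instance Definition _ := GRing.isSubmodClosed.Build A M gs_pred gs_pred_closed.

Record sub_sort := SubElt { sub_val :> M; sub_valP : sub_val \in gs_pred }.
HB.instance Definition _ := [isSub for sub_val].
HB.instance Definition _ := [Choice of sub_sort by <:].
HB.instance Definition _ := [SubChoice_isSubLmodule of sub_sort by <:].


Definition sub_gpr (g : Gam n) (x : sub_sort) : sub_sort :=
  SubElt (asboolT (gs_gpr g (asboolW (sub_valP x)))).

Fact sub_gprD g : {morph sub_gpr g : x y / x + y}.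
Proof. by move=> x y; apply: val_inj; rewrite /= gprD. Qed.
Fact sub_gprK g h x :
  sub_gpr g (sub_gpr h x) = if g == h then sub_gpr h x else 0.
Proof. by apply: val_inj; rewrite /= gprK; case: eqP. Qed.
Fact sub_gpr_sum x : \sum_g sub_gpr g x = x.
Proof.
apply: val_inj; rewrite -[RHS](gpr_sum (gm_gr M)).
exact: (big_morph (fun y : sub_sort => y : M) (fun _ _ => erefl) erefl).
Qed.

Definition sub_gr := Gradation sub_gprD sub_gprK sub_gpr_sum.

Fact sub_act g h (a : A) (x : sub_sort) :
  homog (ga_gr A) g a -> homog sub_gr h x -> homog sub_gr (g + h) (a *: x).
Proof.
move=> ha hx; apply: val_inj; apply: gm_act => //.
exact: (congr1 val hx).
Qed.

Definition sub_gmod : gmod A := GMod sub_act.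

Definition quot_sort : Type := Quotient.quot gs_pred.
HB.instance Definition _ := GRing.Zmodule.on quot_sort.

Definition quot_pi (x : M) : quot_sort := \pi_(Quotient.quot gs_pred) x.

Lemma quot_piP x y : quot_pi x = quot_pi y <-> S (x - y).
Proof.
split=> [/eqP|xy]; first by rewrite -Quotient.idealrBE => /asboolP.
by apply/eqP; rewrite -Quotient.idealrBE; apply/asboolP.
Qed.

Lemma quot_piD : {morph quot_pi : x y / x + y}.
Proof. by move=> x y; rewrite /quot_pi raddfD. Qed.

Lemma quot_pi0 : quot_pi 0 = 0.
Proof. exact: raddf0. Qed.

Lemma quot_pi_sum (I : Type) (s : seq I) P (F : I -> M) :
  quot_pi (\sum_(i <- s | P i) F i) = \sum_(i <- s | P i) quot_pi (F i).
Proof. exact: (big_morph quot_pi quot_piD quot_pi0). Qed.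

Definition quot_repr (x : quot_sort) : M := repr (x : Quotient.quot gs_pred).

Lemma quot_reprK : cancel quot_repr quot_pi.
Proof. by move=> x; apply: reprK. Qed.

Lemma quot_piW (P : quot_sort -> Prop) : (forall x, P (quot_pi x)) -> forall x, P x.
Proof. by move=> Ppi x; rewrite -[x]quot_reprK. Qed.

Lemma quot_reprP x : S (quot_repr (quot_pi x) - x).
Proof. by apply/quot_piP; rewrite quot_reprK. Qed.

Definition quot_scale (a : A) (x : quot_sort) : quot_sort :=
  quot_pi (a *: quot_repr x).

Lemma quot_scale_pi a x : quot_scale a (quot_pi x) = quot_pi (a *: x).
Proof. by apply/quot_piP; rewrite -scalerBr; apply/gs_Z/quot_reprP. Qed.

Fact quot_scaleA a b x : quot_scale a (quot_scale b x) = quot_scale (a * b) x.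
Proof. by elim/quot_piW: x => x; rewrite !quot_scale_pi scalerA. Qed.
Fact quot_scale1 : left_id 1 quot_scale.
Proof. by elim/quot_piW=> x; rewrite quot_scale_pi scale1r. Qed.
Fact quot_scaleDr : right_distributive quot_scale +%R.
Proof.
move=> a; elim/quot_piW=> x; elim/quot_piW=> y.
by rewrite -quot_piD !quot_scale_pi scalerDr quot_piD.
Qed.
Fact quot_scaleDl x : {morph quot_scale^~ x : a b / a + b}.
Proof.
by elim/quot_piW: x => x a b; rewrite !quot_scale_pi scalerDl quot_piD.
Qed.

HB.instance Definition _ := GRing.Zmodule_isLmodule.Build A quot_sort
  quot_scaleA quot_scale1 quot_scaleDr quot_scaleDl.

Lemma quot_piZ a x : quot_pi (a *: x) = a *: quot_pi x.
Proof. exact/esym/quot_scale_pi. Qed.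

Definition quot_gpr (g : Gam n) (x : quot_sort) : quot_sort :=
  quot_pi (gm_gr M g (quot_repr x)).

Lemma quot_gpr_pi g x : quot_gpr g (quot_pi x) = quot_pi (gm_gr M g x).
Proof. by apply/quot_piP; rewrite -gprB; apply/gs_gpr/quot_reprP. Qed.

Fact quot_gprD g : {morph quot_gpr g : x y / x + y}.
Proof.
elim/quot_piW=> x; elim/quot_piW=> y.
by rewrite -quot_piD !quot_gpr_pi gprD quot_piD.
Qed.
Fact quot_gprK g h x :
  quot_gpr g (quot_gpr h x) = if g == h then quot_gpr h x else 0.
Proof.
elim/quot_piW: x => x; rewrite !quot_gpr_pi gprK.
by case: eqP; rewrite ?quot_pi0.
Qed.
Fact quot_gpr_sum x : \sum_g quot_gpr g x = x.
Proof.
elim/quot_piW: x => x; under eq_bigr do rewrite quot_gpr_pi.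
by rewrite -quot_pi_sum gpr_sum.
Qed.

Definition quot_gr := Gradation quot_gprD quot_gprK quot_gpr_sum.

Fact quot_act g h (a : A) (x : quot_sort) :
  homog (ga_gr A) g a -> homog quot_gr h x -> homog quot_gr (g + h) (a *: x).
Proof.
move=> ha <-; elim/quot_piW: x => x.
rewrite /= quot_gpr_pi -quot_piZ /homog /= quot_gpr_pi.
by congr quot_pi; apply: gm_act => //; apply: homog_gpr.
Qed.

Definition quot_gmod : gmod A := GMod quot_act.

Lemma quot_ract (x : M) a : ract (quot_pi x : quot_gmod) a = quot_pi (ract x a).
Proof.
rewrite /ract quot_pi_sum; apply: eq_bigr => h _.
by rewrite quot_piZ -quot_gpr_pi.
Qed.

End SubQuotient.

Section TensorAlgebra.
Variables (k : fieldType) (n : nat) (A : gcAlg k n) (P : gmod A).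

(* The tensor algebra T_A(P) of the A-bimodule P, presented as the ring
   generated by A and P in which A is a subring and P a sub-bimodule: ring
   expressions over A and P, modulo the congruence [tcong]. *)
Inductive texp :=
| Tsc of A
| Tgen of P
| Tadd of texp & texp
| Tmul of texp & texp.

Inductive tcong : texp -> texp -> Prop :=
| tc_refl s : tcong s s
| tc_sym s t : tcong s t -> tcong t s
| tc_trans s t u : tcong s t -> tcong t u -> tcong s u
| tc_add s s' t t' : tcong s s' -> tcong t t' -> tcong (Tadd s t) (Tadd s' t')
| tc_mul s s' t t' : tcong s s' -> tcong t t' -> tcong (Tmul s t) (Tmul s' t')
| tc_addA s t u : tcong (Tadd s (Tadd t u)) (Tadd (Tadd s t) u)
| tc_addC s t : tcong (Tadd s t) (Tadd t s)
| tc_add0 s : tcong (Tadd (Tsc 0) s) s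
| tc_addN s : tcong (Tadd (Tmul (Tsc (- 1)) s) s) (Tsc 0)
| tc_mulA s t u : tcong (Tmul s (Tmul t u)) (Tmul (Tmul s t) u)
| tc_mul1l s : tcong (Tmul (Tsc 1) s) s
| tc_mul1r s : tcong (Tmul s (Tsc 1)) s
| tc_mulDl s t u : tcong (Tmul (Tadd s t) u) (Tadd (Tmul s u) (Tmul t u))
| tc_mulDr s t u : tcong (Tmul s (Tadd t u)) (Tadd (Tmul s t) (Tmul s u))
| tc_scD a b : tcong (Tsc (a + b)) (Tadd (Tsc a) (Tsc b))
| tc_scM a b : tcong (Tsc (a * b)) (Tmul (Tsc a) (Tsc b))
| tc_genD x y : tcong (Tgen (x + y)) (Tadd (Tgen x) (Tgen y))
| tc_genZ a x : tcong (Tgen (a *: x)) (Tmul (Tsc a) (Tgen x))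
| tc_genR a x : tcong (Tgen (ract x a)) (Tmul (Tgen x) (Tsc a)).

HB.instance Definition _ := gen_eqMixin texp.
HB.instance Definition _ := gen_choiceMixin texp.

Definition tcongb : rel texp := fun s t => `[< tcong s t >].

Fact tcongb_refl : reflexive tcongb.
Proof. by move=> s; apply/asboolP/tc_refl. Qed.
Fact tcongb_sym : symmetric tcongb.
Proof. by move=> s t; apply/asboolP/asboolP => /tc_sym. Qed.
Fact tcongb_trans : transitive tcongb.
Proof.
by move=> t s u /asboolP st /asboolP tu; apply/asboolP; apply: tc_trans tu.
Qed.

Canonical tcong_equiv := EquivRel tcongb tcongb_refl tcongb_sym tcongb_trans.

Definition talg : Type := {eq_quot tcong_equiv}.
HB.instance Definition _ := Choice.on talg.

Definition tpi (s : texp) : talg := \pi_({eq_quot tcong_equiv}) s.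
Definition trepr (x : talg) : texp := repr (x : {eq_quot tcong_equiv}).

Lemma tpiP s t : tpi s = tpi t <-> tcong s t.
Proof.
by split=> [/eqmodP/asboolP|st] //; apply/eqmodP/asboolP.
Qed.

Lemma treprK : cancel trepr tpi. Proof. by move=> x; apply: reprK. Qed.

Lemma trepr_pi s : tcong (trepr (tpi s)) s.
Proof. by apply/tpiP; rewrite treprK. Qed.

Lemma tpiW (Q : talg -> Prop) : (forall s, Q (tpi s)) -> forall x, Q x.
Proof. by move=> Qpi x; rewrite -[x]treprK. Qed.

Definition t_add (x y : talg) := tpi (Tadd (trepr x) (trepr y)).
Definition t_mul (x y : talg) := tpi (Tmul (trepr x) (trepr y)).
Definition t_opp (x : talg) := t_mul (tpi (Tsc (- 1))) x.

Lemma t_addE s t : t_add (tpi s) (tpi t) = tpi (Tadd s t).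
Proof. by apply/tpiP/tc_add; apply: trepr_pi. Qed.
Lemma t_mulE s t : t_mul (tpi s) (tpi t) = tpi (Tmul s t).
Proof. by apply/tpiP/tc_mul; apply: trepr_pi. Qed.

Fact t_addA : associative t_add.
Proof.
elim/tpiW=> s; elim/tpiW=> t; elim/tpiW=> u; rewrite !t_addE.
exact/tpiP/tc_addA.
Qed.
Fact t_addC : commutative t_add.
Proof. by elim/tpiW=> s; elim/tpiW=> t; rewrite !t_addE; apply/tpiP/tc_addC. Qed.
Fact t_add0 : left_id (tpi (Tsc 0)) t_add.
Proof. by elim/tpiW=> s; rewrite t_addE; apply/tpiP/tc_add0. Qed.
Fact t_addN : left_inverse (tpi (Tsc 0)) t_opp t_add.
Proof. by elim/tpiW=> s; rewrite /t_opp t_mulE t_addE; apply/tpiP/tc_addN. Qed.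
HB.instance Definition _ := GRing.isZmodule.Build talg t_addA t_addC t_add0 t_addN.

Lemma tpiD s t : tpi (Tadd s t) = tpi s + tpi t. Proof. exact/esym/t_addE. Qed.

Fact t_mulA : associative t_mul.
Proof.
elim/tpiW=> s; elim/tpiW=> t; elim/tpiW=> u; rewrite !t_mulE.
exact/tpiP/tc_mulA.
Qed.
Fact t_mul1l : left_id (tpi (Tsc 1)) t_mul.
Proof. by elim/tpiW=> s; rewrite t_mulE; apply/tpiP/tc_mul1l. Qed.
Fact t_mul1r : right_id (tpi (Tsc 1)) t_mul.
Proof. by elim/tpiW=> s; rewrite t_mulE; apply/tpiP/tc_mul1r. Qed.
Fact t_mulDl : left_distributive t_mul +%R.
Proof.
elim/tpiW=> s; elim/tpiW=> t; elim/tpiW=> u.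
rewrite -tpiD !t_mulE -tpiD; exact/tpiP/tc_mulDl.
Qed.
Fact t_mulDr : right_distributive t_mul +%R.
Proof.
elim/tpiW=> s; elim/tpiW=> t; elim/tpiW=> u.
rewrite -tpiD !t_mulE -tpiD; exact/tpiP/tc_mulDr.
Qed.
HB.instance Definition _ := GRing.Zmodule_isPzRing.Build talg
  t_mulA t_mul1l t_mul1r t_mulDl t_mulDr.

Definition tsc (a : A) : talg := tpi (Tsc a).
Definition tgen (x : P) : talg := tpi (Tgen x).

Lemma tpiM s t : tpi (Tmul s t) = tpi s * tpi t. Proof. exact/esym/t_mulE. Qed.
Lemma tsc0 : tsc 0 = 0. Proof. by []. Qed.
Lemma tsc1 : tsc 1 = 1. Proof. by []. Qed.
Lemma tscD : {morph tsc : a b / a + b}.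
Proof. by move=> a b; rewrite -tpiD; apply/tpiP/tc_scD. Qed.
Lemma tscM : {morph tsc : a b / a * b}.
Proof. by move=> a b; rewrite -tpiM; apply/tpiP/tc_scM. Qed.
Lemma tgenD : {morph tgen : x y / x + y}.
Proof. by move=> x y; rewrite -tpiD; apply/tpiP/tc_genD. Qed.
Lemma tgenZ a x : tgen (a *: x) = tsc a * tgen x.
Proof. by rewrite -tpiM; apply/tpiP/tc_genZ. Qed.
Lemma tgenR a x : tgen (ract x a) = tgen x * tsc a.
Proof. by rewrite -tpiM; apply/tpiP/tc_genR. Qed.
Lemma tgen0 : tgen 0 = 0.
Proof. by rewrite -[0 in LHS](scale0r 0) tgenZ tsc0 mul0r. Qed.

Definition t_scale (a : A) (x : talg) : talg := tsc a * x.
Fact t_scaleA a b x : t_scale a (t_scale b x) = t_scale (a * b) x.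
Proof. by rewrite /t_scale tscM mulrA. Qed.
Fact t_scale1 : left_id 1 t_scale.
Proof. exact: mul1r. Qed.
Fact t_scaleDr : right_distributive t_scale +%R.
Proof. by move=> a x y; apply: mulrDr. Qed.
Fact t_scaleDl x : {morph t_scale^~ x : a b / a + b}.
Proof. by move=> a b; rewrite /t_scale tscD mulrDl. Qed.
HB.instance Definition _ := GRing.Zmodule_isLmodule.Build A talg
  t_scaleA t_scale1 t_scaleDr t_scaleDl.

Lemma talg_scaleE a (x : talg) : a *: x = tsc a * x. Proof. by []. Qed.

Fixpoint tcomp (s : texp) (g : Gam n) : talg :=
  match s with
  | Tsc a => tsc (ga_gr A g a)
  | Tgen x => tgen (gm_gr P g x)
  | Tadd t u => tcomp t g + tcomp u g
  | Tmul t u => \sum_h tcomp t h * tcomp u (g - h)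
  end.

Lemma tcomp_sc_mul a s g :
  tcomp (Tmul (Tsc a) s) g = \sum_h tsc (ga_gr A h a) * tcomp s (g - h).
Proof. by []. Qed.

Lemma tsc_sum (I : Type) (r : seq I) Q (F : I -> A) :
  tsc (\sum_(i <- r | Q i) F i) = \sum_(i <- r | Q i) tsc (F i).
Proof. exact: (big_morph tsc tscD tsc0). Qed.
Lemma tgen_sum (I : Type) (r : seq I) Q (F : I -> P) :
  tgen (\sum_(i <- r | Q i) F i) = \sum_(i <- r | Q i) tgen (F i).
Proof. exact: (big_morph tgen tgenD tgen0). Qed.

Lemma tcomp_sc0 a s g : homog (ga_gr A) 0 a ->
  tcomp (Tmul (Tsc a) s) g = tsc a * tcomp s g.
Proof.
move=> ha /=; rewrite (bigD1 0) //= big1 ?addr0 ?subr0 ?ha // => h /negPf h0.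
by rewrite (homogE _ ha) h0 tsc0 mul0r.
Qed.

Lemma tcomp_cong s t : tcong s t -> tcomp s =1 tcomp t.
Proof.
elim=> {s t} /=.
- by [].
- by move=> s t _ IH g.
- by move=> s t u _ IH1 _ IH2 g; rewrite IH1.
- by move=> s s' t t' _ IH1 _ IH2 g; rewrite IH1 IH2.
- by move=> s s' t t' _ IH1 _ IH2 g; apply: eq_bigr => h _; rewrite IH1 IH2.
- by move=> s t u g; rewrite addrA.
- by move=> s t g; rewrite addrC.
- by move=> s g; rewrite gpr0 tsc0 add0r.
- move=> s g; rewrite -tcomp_sc_mul (tcomp_sc0 _ _ (homogN (ga_one A))).
  by rewrite gpr0 tsc0 -{2}[tcomp s g]mul1r -mulrDl -tsc1 -tscD addNr tsc0 mul0r.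
- move=> s t u g; under eq_bigr do rewrite mulr_sumr.
  under [RHS]eq_bigr do rewrite mulr_suml.
  rewrite [RHS]exchange_big; apply: eq_bigr => h _ /=.
  rewrite [RHS](reindex_inj (addIr h)); apply: eq_bigr => i _ /=.
  by rewrite addrK mulrA opprD addrA addrAC.
- by move=> s g; rewrite -tcomp_sc_mul (tcomp_sc0 _ _ (ga_one A)) tsc1 mul1r.
- move=> s g; rewrite (bigD1 g) //= big1 ?addr0 => [|h hg].
    by rewrite subrr (ga_one A) tsc1 mulr1.
  by rewrite (homogE _ (ga_one A)) subr_eq0 eq_sym (negPf hg) tsc0 mulr0.
- by move=> s t u g; rewrite -big_split; apply: eq_bigr => h _; rewrite mulrDl.
- by move=> s t u g; rewrite -big_split; apply: eq_bigr => h _; rewrite mulrDr.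
- by move=> a b g; rewrite gprD tscD.
- by move=> a b g; rewrite ga_prM tsc_sum; apply: eq_bigr => h _; rewrite tscM.
- by move=> x y g; rewrite gprD tgenD.
- by move=> a x g; rewrite gm_prZ tgen_sum; apply: eq_bigr => h _; rewrite tgenZ.
- by move=> a x g; rewrite gpr_ract tgen_sum; apply: eq_bigr => h _; rewrite tgenR.
Qed.

Definition t_gpr (g : Gam n) (x : talg) : talg := tcomp (trepr x) g.

Lemma t_gprE g s : t_gpr g (tpi s) = tcomp s g.
Proof. exact/tcomp_cong/trepr_pi. Qed.

Fact t_gprD g : {morph t_gpr g : x y / x + y}.
Proof. by elim/tpiW=> s; elim/tpiW=> t; rewrite -tpiD !t_gprE. Qed.

Lemma t_gprM g x y : t_gpr g (x * y) = \sum_h t_gpr h x * t_gpr (g - h) y.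
Proof.
elim/tpiW: x => s; elim/tpiW: y => t; rewrite -tpiM t_gprE /=.
by apply: eq_bigr => h _; rewrite !t_gprE.
Qed.

Lemma t_gpr_sc g a : t_gpr g (tsc a) = tsc (ga_gr A g a).
Proof. by rewrite t_gprE. Qed.
Lemma t_gpr_gen g x : t_gpr g (tgen x) = tgen (gm_gr P g x).
Proof. by rewrite t_gprE. Qed.

Lemma t_gpr0 g : t_gpr g 0 = 0.
Proof. by apply: (addrI (t_gpr g 0)); rewrite -t_gprD !addr0. Qed.

Fact t_gprK g h x : t_gpr g (t_gpr h x) = if g == h then t_gpr h x else 0.
Proof.
elim/tpiW: x => s; elim: s g h => [a|x|s IHs t IHt|s IHs t IHt] g h.
- by rewrite !t_gpr_sc gprK; case: eqP.
- by rewrite !t_gpr_gen gprK; case: eqP; rewrite ?tgen0.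
- by rewrite tpiD !t_gprD IHs IHt; case: eqP; rewrite ?addr0.
rewrite tpiM t_gprM (big_morph _ (t_gprD g) (t_gpr0 g)).
transitivity (\sum_i if g == h then t_gpr i (tpi s) * t_gpr (h - i) (tpi t) else 0);
  last by case: eqP => // _; rewrite big1.
apply: eq_bigr => i _; rewrite t_gprM (bigD1 i) //= big1 ?addr0 => [|j /negPf ji].
  by rewrite IHs IHt eqxx (inj_eq (addIr _)); case: eqP; rewrite ?mulr0.
by rewrite IHs ji mul0r.
Qed.

Fact t_gpr_sum x : \sum_g t_gpr g x = x.
Proof.
elim/tpiW: x; elim=> [a|x|s IHs t IHt|s IHs t IHt].
- under eq_bigr do rewrite t_gpr_sc.
  by rewrite -tsc_sum gpr_sum.
- under eq_bigr do rewrite t_gpr_gen.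
  by rewrite -tgen_sum gpr_sum.
- under eq_bigr do rewrite tpiD t_gprD.
  by rewrite big_split /= IHs IHt tpiD.
under eq_bigr do rewrite tpiM t_gprM.
rewrite exchange_big tpiM -{2}IHs mulr_suml; apply: eq_bigr => h _ /=.
rewrite -{2}IHt mulr_sumr (reindex_inj (addIr h)); apply: eq_bigr => g _ /=.
by rewrite addrK.
Qed.

Definition t_gr := Gradation t_gprD t_gprK t_gpr_sum.

Lemma homog_tmul g h x y :
  homog t_gr g x -> homog t_gr h y -> homog t_gr (g + h) (x * y).
Proof.
move=> hx hy; rewrite /homog /= t_gprM (bigD1 g) //= big1 ?addr0 => [|i /negPf ig].
  by rewrite addrC addKr; congr (_ * _); [exact: hx|exact: hy].
by rewrite [t_gpr i x](homogE (G := t_gr) _ hx) ig mul0r.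
Qed.

Lemma homog_tsc g a : homog (ga_gr A) g a -> homog t_gr g (tsc a).
Proof. by move=> ha; rewrite /homog /= t_gpr_sc ha. Qed.

Lemma homog_tgen g x : homog (gm_gr P) g x -> homog t_gr g (tgen x).
Proof. by move=> hx; rewrite /homog /= t_gpr_gen hx. Qed.

Fact t_act g h (a : A) (x : talg) :
  homog (ga_gr A) g a -> homog t_gr h x -> homog t_gr (g + h) (a *: x).
Proof. by move=> ha hx; apply: homog_tmul hx; apply: homog_tsc. Qed.

Definition talg_gmod : gmod A := GMod t_act.

Lemma talg_scC g h (a : A) (x : talg) :
  homog (ga_gr A) g a -> homog t_gr h x ->
  x * tsc a = tsc (gsgn A g h * a) * x.
Proof.
have sgM s t : tsc (gsgn A s t) = gsgn talg s t.
  rewrite /gsgn -signr_odd -[RHS]signr_odd; case: odd; rewrite ?expr0 ?expr1.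
    by apply/eqP; rewrite -addr_eq0 -tsc1 -tscD addNr.
  exact: tsc1.
move=> ha <-; rewrite tscM sgM /=; elim/tpiW: x h.
elim=> [b|x|s IHs t IHt|s IHs t IHt] h.
- rewrite t_gpr_sc -!tscM -sgM -!tscM; congr tsc.
  by rewrite (ga_comm (homog_gpr _ h b) ha) mulrA gsgnC.
- rewrite t_gpr_gen -tgenR -sgM -tscM -tgenZ.
  by rewrite (ract_homog a (homog_gpr _ h x)) (twist_homog h ha).
- by rewrite tpiD t_gprD mulrDl mulrDr IHs IHt.
rewrite tpiM t_gprM mulr_suml mulr_sumr; apply: eq_bigr => i _.
rewrite -mulrA IHt !mulrA -[_ * gsgn _ _ _]gsgn_comm -!mulrA [t_gpr i _ * (_ * _)]mulrA.
rewrite IHs !mulrA; congr (_ * _ * _ * _).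
by rewrite -gsgnDr subrK.
Qed.

Lemma talg_ractE (x : talg_gmod) (a : A) : ract x a = (x : talg) * tsc a.
Proof.
rewrite -[in RHS](gpr_sum t_gr x) mulr_suml; apply: eq_bigr => h _.
rewrite talg_scaleE -[in RHS](gpr_sum (ga_gr A) a).
rewrite /twist !tsc_sum mulr_sumr mulr_suml; apply: eq_bigr => g _.
by rewrite (talg_scC (homog_gpr _ g a) (homog_gpr _ h _)).
Qed.

Inductive sym_ideal : talg -> Prop :=
| si_gen g h x y : homog (gm_gr P) g x -> homog (gm_gr P) h y ->
    sym_ideal (tgen x * tgen y - gsgn talg g h * (tgen y * tgen x))
| si_0 : sym_ideal 0
| si_D x y : sym_ideal x -> sym_ideal y -> sym_ideal (x + y)
| si_Ml x y : sym_ideal y -> sym_ideal (x * y)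
| si_Mr x y : sym_ideal x -> sym_ideal (x * y).

Fact si_gpr g x : sym_ideal x -> sym_ideal (t_gpr g x).
Proof.
move=> Ix; elim: Ix g => {x}
  [i j x y hx hy|g|x y _ IHx _ IHy g|x y _ IHy g|x y _ IHx g].
- move=> g; set z := _ - _; have hz : homog t_gr (i + j) z.
    have hxy := homog_tmul (homog_tgen hx) (homog_tgen hy).
    have hyx := homog_tmul (homog_tgen hy) (homog_tgen hx).
    apply: homogD => //; apply: homogN; rewrite [i + j]addrC /gsgn -signr_odd.
    by case: odd; rewrite ?expr0 ?mul1r ?expr1 ?mulN1r //; apply: homogN.
  rewrite [t_gpr g z](homogE (G := t_gr) _ hz); case: eqP => _; last exact: si_0.
  exact: si_gen.
- by rewrite t_gpr0; apply: si_0.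
- by rewrite t_gprD; apply: si_D.
- rewrite t_gprM; elim/big_ind: _ => [|u v|h _]; [exact: si_0|exact: si_D|].
  exact: si_Ml.
rewrite t_gprM; elim/big_ind: _ => [|u v|h _]; [exact: si_0|exact: si_D|].
exact: si_Mr.
Qed.

Definition sym_gsub : gsub talg_gmod :=
  @GSub _ _ _ talg_gmod sym_ideal si_0 si_D (fun a => @si_Ml (tsc a)) si_gpr.

Definition symalg_gmod : gmod A := quot_gmod sym_gsub.
Definition symalg : Type := symalg_gmod.
HB.instance Definition _ := GRing.Zmodule.on symalg.

Definition spi (x : talg) : symalg := @quot_pi _ _ _ talg_gmod sym_gsub x.
Definition srepr (x : symalg) : talg := @quot_repr _ _ _ talg_gmod sym_gsub x.

Definition s_mul (x y : symalg) : symalg := spi (srepr x * srepr y).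

Lemma spiW (Q : symalg -> Prop) : (forall x, Q (spi x)) -> forall x, Q x.
Proof. exact: (@quot_piW _ _ _ talg_gmod sym_gsub Q). Qed.

Lemma spiP x y : spi x = spi y <-> sym_ideal (x - y).
Proof. exact: (@quot_piP _ _ _ talg_gmod sym_gsub). Qed.

Lemma spiD : {morph spi : x y / x + y}.
Proof. exact: (@quot_piD _ _ _ talg_gmod sym_gsub). Qed.

Lemma spiM x y : spi (x * y) = s_mul (spi x) (spi y).
Proof.
apply/esym/spiP; rewrite -(subrK (x * srepr (spi y)) (_ * _)) -addrA -mulrBl -mulrBr.
have sP z : sym_ideal (srepr (spi z) - z).
  exact: (@quot_reprP _ _ _ talg_gmod sym_gsub).
by apply: si_D; [apply/si_Mr/sP|apply/si_Ml/sP].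
Qed.

Fact s_mulA : associative s_mul.
Proof.
by elim/spiW=> x; elim/spiW=> y; elim/spiW=> z; rewrite -!spiM mulrA.
Qed.
Fact s_mul1l : left_id (spi 1) s_mul.
Proof. by elim/spiW=> x; rewrite -spiM mul1r. Qed.
Fact s_mul1r : right_id (spi 1) s_mul.
Proof. by elim/spiW=> x; rewrite -spiM mulr1. Qed.
Fact s_mulDl : left_distributive s_mul +%R.
Proof.
elim/spiW=> x; elim/spiW=> y; elim/spiW=> z.
by rewrite -spiD -!spiM -spiD mulrDl.
Qed.
Fact s_mulDr : right_distributive s_mul +%R.
Proof.
elim/spiW=> x; elim/spiW=> y; elim/spiW=> z.
by rewrite -spiD -!spiM -spiD mulrDr.
Qed.
HB.instance Definition _ := GRing.Zmodule_isPzRing.Build symalg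
  s_mulA s_mul1l s_mul1r s_mulDl s_mulDr.

Lemma symalg_piM (x y : talg) : spi (x * y) = spi x * spi y.
Proof. exact: spiM. Qed.

Definition sgen (x : P) : symalg := spi (tgen x).

Definition s_gr : gradation n symalg := gm_gr symalg_gmod.

Lemma s_gprE g x : s_gr g (spi x) = spi (t_gpr g x).
Proof. exact: (@quot_gpr_pi _ _ _ talg_gmod sym_gsub). Qed.

Lemma homog_spi g x : homog t_gr g x -> homog s_gr g (spi x).
Proof. by move=> hx; rewrite /homog s_gprE; congr spi. Qed.

Lemma homog_sgen g x : homog (gm_gr P) g x -> homog s_gr g (sgen x).
Proof. by move=> hx; apply/homog_spi/homog_tgen. Qed.

Lemma homog_smul g h x y :
  homog s_gr g x -> homog s_gr h y -> homog s_gr (g + h) (x * y).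
Proof.
move=> <- <-; elim/spiW: x => x; elim/spiW: y => y.
rewrite !s_gprE -symalg_piM; apply/homog_spi/homog_tmul; exact: homog_gpr t_gr _ _.
Qed.

Lemma symalg_ractE (x : symalg_gmod) (a : A) :
  ract x a = (x : symalg) * spi (tsc a).
Proof.
elim/spiW: x => x; rewrite -symalg_piM -talg_ractE.
exact: (@quot_ract _ _ _ talg_gmod sym_gsub).
Qed.

Lemma smull_glinear g (w : symalg) : homog s_gr g w ->
  @is_glinear _ _ _ symalg_gmod symalg_gmod g (fun x : symalg => w * x).
Proof.
move=> hw; split=> [x y|h x hx|x a].
- exact: (@mulrDr symalg w x y).
- by rewrite addrC; apply: (homog_smul hw).
by rewrite !symalg_ractE mulrA.
Qed.

End TensorAlgebra.

Section Cohomology.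
Variables (k : fieldType) (n : nat) (A : gcAlg k n) (M : gmod A) (g : Gam n).
Variable d : glin M M g.

Fact ker_0 : d 0 = 0. Proof. exact: glin0. Qed.
Fact ker_D x y : d x = 0 -> d y = 0 -> d (x + y) = 0.
Proof. by case: (glinP d) => dD _ _ dx dy; rewrite dD dx dy addr0. Qed.
Fact ker_Z a x : d x = 0 -> d (a *: x) = 0.
Proof. by move=> dx; rewrite glinZ dx scaler0. Qed.
Fact ker_gpr h x : d x = 0 -> d (gm_gr M h x) = 0.
Proof. by move=> dx; rewrite glin_gpr dx gpr0. Qed.

Definition ker_gsub : gsub M :=
  @GSub _ _ _ M (fun x => d x = 0) ker_0 ker_D ker_Z ker_gpr.

Definition cycles : gmod A := sub_gmod ker_gsub.

(* im d, inside ker d (which contains it when d \o d = 0) *)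
Definition is_boundary (z : cycles) : Prop := exists y : M, d y = sub_val z.

Fact im_0 : is_boundary 0.
Proof. by exists 0; rewrite glin0. Qed.
Fact im_D x y : is_boundary x -> is_boundary y -> is_boundary (x + y).
Proof.
move=> [x' dx] [y' dy]; exists (x' + y').
by case: (glinP d) => dD _ _; rewrite dD dx dy.
Qed.
Fact im_Z a x : is_boundary x -> is_boundary (a *: x).
Proof.
by move=> [x' dx]; exists (twist g a *: x'); rewrite glinZ twistK dx.
Qed.
Fact im_gpr h x : is_boundary x -> is_boundary (gm_gr cycles h x).
Proof.
by move=> [x' dx]; exists (gm_gr M (h - g) x'); rewrite glin_gpr subrK dx.
Qed.

Definition im_gsub : gsub cycles :=
  @GSub _ _ _ cycles is_boundary im_0 im_D im_Z im_gpr.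

Definition cohomology : gmod A := quot_gmod im_gsub.

Definition coh_class (z : cycles) : cohomology := quot_pi im_gsub z.

End Cohomology.

Section StandardBases.
Variables (k : fieldType) (n : nat) (A : gcAlg k n).
Variables (r : 'I_(2 ^ n) -> nat) (M : gmod A).

Definition total_rank := (\sum_u r u)%N.

(* The number of even elements of a standard basis. *)
Definition even_rank := (\sum_(u : 'I_(2 ^ n) | (u < 2 ^ n.-1)%N) r u)%N.

(* [tagnat.sig1] maps the index of a basis element to the index of its block. *)
Definition std_ideg (i : 'I_total_rank) : Gam n := std_deg (tagnat.sig1 i).

(* The coordinates of a vector are its right coordinates. *)
Record std_basis := StdBasis {
  sb_elt :> 'I_total_rank -> M;
  sb_homog : forall i, homog (gm_gr M) (std_ideg i) (sb_elt i);
  sb_basis : forall x, exists! c : 'cV[A]_total_rank, x = \sum_i ract (sb_elt i) (c i 0)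
}.

Variable e : std_basis.

Definition coord (x : M) : 'cV[A]_total_rank := projT1 (cid (sb_basis e x)).

Lemma coordP x : x = \sum_i ract (e i) (coord x i 0).
Proof. by rewrite /coord; case: cid => c []. Qed.

Lemma coord_uniq x (c : 'I_total_rank -> A) :
  x = \sum_i ract (e i) (c i) -> forall i, coord x i 0 = c i.
Proof.
move=> xc i; rewrite /coord; case: cid => c' [_ /= c'P].
rewrite (c'P (\col_i c i)) ?mxE // xc.
by apply: eq_bigr => j _; rewrite mxE.
Qed.

Fact dual_basis_add i : {morph (fun x => coord x i 0) : x y / x + y}.
Proof.
move=> x y; move: i; apply: coord_uniq.
rewrite {1}[x]coordP {1}[y]coordP -big_split.
by apply: eq_bigr => j _; rewrite ractDr.
Qed.

Fact dual_basis_lin i x a : coord (ract x a) i 0 = coord x i 0 * a.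
Proof.
move: i; apply: coord_uniq; rewrite {1}[x]coordP ract_suml.
by apply: eq_bigr => j _; rewrite ractA.
Qed.

Definition dual_basis (i : 'I_total_rank) : dual_gmod M :=
  Dual (dual_basis_add i) (dual_basis_lin i).

Lemma dual_basisE i j : dual_basis i (e j) = (i == j)%:R.
Proof.
move: i; apply: coord_uniq; rewrite (bigD1 j) //= eqxx ract1 big1 ?addr0 //.
by move=> i /negPf ->; rewrite ract0r.
Qed.

Lemma homog_dual_basis i : homog (gm_gr (dual_gmod M)) (std_ideg i) (dual_basis i).
Proof.
apply/dual_homogP => h x hx; apply/esym; move: i; apply: coord_uniq.
rewrite -{1}hx {1}[x]coordP gpr_bigsum; apply: eq_bigr => j _.
rewrite gpr_ract (bigD1 (std_ideg j)) //= big1 ?addr0 => [|i /negPf ij].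
  by rewrite (sb_homog e j) gamN.
by rewrite (homogE _ (sb_homog e j)) ij ract0l.
Qed.

End StandardBases.

Section Koszul.
Variables (k : fieldType) (n : nat) (A : gcAlg k n).
Variables (r : 'I_(2 ^ n) -> nat) (M : gmod A) (p : Gam n).

Definition koszul_gmod : gmod A :=
  symalg_gmod (dsum_gmod (parity_gmod p M) (dual_gmod M)).

Definition koszul : pzRingType :=
  symalg (dsum_gmod (parity_gmod p M) (dual_gmod M)).

Definition kparity (x : M) : koszul :=
  @sgen _ _ _ (dsum_gmod (parity_gmod p M) (dual_gmod M)) (parity_elt p x, 0).

Definition kdual (l : dual_gmod M) : koszul :=
  @sgen _ _ _ (dsum_gmod (parity_gmod p M) (dual_gmod M)) (0, l).

Definition koszul_elt (e : std_basis r M) : koszul :=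
  \sum_i kparity (e i) * kdual (dual_basis e i).

Fact homog_koszul_elt e : homog (gm_gr koszul_gmod) p (koszul_elt e).
Proof.
apply: (big_ind (homog (gm_gr koszul_gmod) p)).
- exact: (homog0 (gm_gr koszul_gmod)).
- exact: (@homogD _ _ (gm_gr koszul_gmod)).
move=> i _; rewrite (_ : p = std_ideg i + p + std_ideg i); last first.
  by rewrite addrAC gamDD add0r.
apply: homog_smul; apply: homog_sgen; congr (_, _); try exact: gpr0.
  by rewrite /= /parity_gpr -addrA gamDD addr0; apply: sb_homog.
exact: homog_dual_basis.
Qed.

Definition koszul_d (e : std_basis r M) : glin koszul_gmod koszul_gmod p :=
  GLin (smull_glinear (homog_koszul_elt e)).

Definition xi (e : std_basis r M) (i : 'I_(total_rank r)) : koszul :=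
  if (i < even_rank r)%N then kparity (e i)
  else - (gsgn koszul (std_ideg i) p * kdual (dual_basis e i)).

End Koszul.

Section Berezinian.
Variables (k : fieldType) (n : nat) (A : gcAlg k n) (r : 'I_(2 ^ n) -> nat).

Definition deg0_mx (X : 'M[A]_(total_rank r)) : Prop :=
  forall i j, homog (ga_gr A) (std_ideg i + std_ideg j) (X i j).

Definition inGL0 (X : 'M[A]_(total_rank r)) : Prop :=
  deg0_mx X /\ exists Y, [/\ deg0_mx Y, X *m Y = 1%:M & Y *m X = 1%:M].

Definition block_diag (X : 'M[A]_(total_rank r)) : Prop :=
  forall u v, u != v -> submxblock X u v = 0.

Definition block_upper1 (X : 'M[A]_(total_rank r)) : Prop :=
  (forall u, submxblock X u u = 1%:M) /\
  (forall u v : 'I_(2 ^ n), (v < u)%N -> submxblock X u v = 0).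

Definition block_lower1 (X : 'M[A]_(total_rank r)) : Prop :=
  (forall u, submxblock X u u = 1%:M) /\
  (forall u v : 'I_(2 ^ n), (u < v)%N -> submxblock X u v = 0).

(* A group morphism GL^0(r; A) -> (A^0)^* normalised on block diagonal and block
   unitriangular matrices; only its values on GL^0(r; A) are meaningful. In
   [gber_diag], c u is the inverse of the determinant of the u-th block. *)
Record gberezinian := GBerezinian {
  gber :> 'M[A]_(total_rank r) -> A;
  gber_deg0 : forall X, inGL0 X -> homog (ga_gr A) 0 (gber X);
  gber_unit : forall X, inGL0 X ->
    exists2 b, homog (ga_gr A) 0 b & gber X * b = 1;
  gber_mul : forall X Y, inGL0 X -> inGL0 Y -> gber (X *m Y) = gber X * gber Y;
  gber_diag : forall X (c : 'I_(2 ^ n) -> A), inGL0 X -> block_diag X ->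
    (forall u : 'I_(2 ^ n), (2 ^ n.-1 <= u)%N -> c u * \det (submxblock X u u) = 1) ->
    gber X = \prod_(u : 'I_(2 ^ n) | (u < 2 ^ n.-1)%N) \det (submxblock X u u)
             * \prod_(u : 'I_(2 ^ n) | (2 ^ n.-1 <= u)%N) c u;
  gber_upper : forall X, inGL0 X -> block_upper1 X -> gber X = 1;
  gber_lower : forall X, inGL0 X -> block_lower1 X -> gber X = 1
}.

Definition basis_change (M : gmod A) (e e' : std_basis r M) (T : 'M[A]_(total_rank r)) :=
  forall i, e' i = \sum_j ract (e j) (T j i).

Variables (M : gmod A) (B : gberezinian).

Definition ber_deg : Gam n := \sum_u std_deg u *+ r u.

(* The right A-module generated by the symbols B(e), subject to
   B(e') = B(e) gber(T): additive expressions in the elements B(e) a, written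
   [Bgen e a], modulo the congruence [bcong]. *)
Inductive bexp :=
| Bgen of std_basis r M & A
| Bzero
| Badd of bexp & bexp
| Bopp of bexp.

Inductive bcong : bexp -> bexp -> Prop :=
| bc_refl s : bcong s s
| bc_sym s t : bcong s t -> bcong t s
| bc_trans s t u : bcong s t -> bcong t u -> bcong s u
| bc_add s s' t t' : bcong s s' -> bcong t t' -> bcong (Badd s t) (Badd s' t')
| bc_opp s s' : bcong s s' -> bcong (Bopp s) (Bopp s')
| bc_addA s t u : bcong (Badd s (Badd t u)) (Badd (Badd s t) u)
| bc_addC s t : bcong (Badd s t) (Badd t s)
| bc_add0 s : bcong (Badd Bzero s) s
| bc_addN s : bcong (Badd (Bopp s) s) Bzero
| bc_genD e a b : bcong (Bgen e (a + b)) (Badd (Bgen e a) (Bgen e b))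
| bc_change e e' T a : inGL0 T -> basis_change e e' T ->
    bcong (Bgen e' a) (Bgen e (B T * a)).

HB.instance Definition _ := gen_eqMixin bexp.
HB.instance Definition _ := gen_choiceMixin bexp.

Definition bcongb : rel bexp := fun s t => `[< bcong s t >].

Fact bcongb_refl : reflexive bcongb.
Proof. by move=> s; apply/asboolP/bc_refl. Qed.
Fact bcongb_sym : symmetric bcongb.
Proof. by move=> s t; apply/asboolP/asboolP => /bc_sym. Qed.
Fact bcongb_trans : transitive bcongb.
Proof.
by move=> t s u /asboolP st /asboolP tu; apply/asboolP; apply: bc_trans tu.
Qed.

Canonical bcong_equiv := EquivRel bcongb bcongb_refl bcongb_sym bcongb_trans.

Definition ber_sort : Type := {eq_quot bcong_equiv}.
HB.instance Definition _ := Choice.on ber_sort.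

Definition bpi (s : bexp) : ber_sort := \pi_({eq_quot bcong_equiv}) s.
Definition brepr (x : ber_sort) : bexp := repr (x : {eq_quot bcong_equiv}).

Lemma bpiP s t : bpi s = bpi t <-> bcong s t.
Proof. by split=> [/eqmodP/asboolP|st] //; apply/eqmodP/asboolP. Qed.

Lemma breprK : cancel brepr bpi. Proof. by move=> x; apply: reprK. Qed.

Lemma brepr_pi s : bcong (brepr (bpi s)) s.
Proof. by apply/bpiP; rewrite breprK. Qed.

Lemma bpiW (Q : ber_sort -> Prop) : (forall s, Q (bpi s)) -> forall x, Q x.
Proof. by move=> Qpi x; rewrite -[x]breprK. Qed.

Definition b_add (x y : ber_sort) := bpi (Badd (brepr x) (brepr y)).
Definition b_opp (x : ber_sort) := bpi (Bopp (brepr x)).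

Lemma b_addE s t : b_add (bpi s) (bpi t) = bpi (Badd s t).
Proof. by apply/bpiP/bc_add; apply: brepr_pi. Qed.
Lemma b_oppE s : b_opp (bpi s) = bpi (Bopp s).
Proof. by apply/bpiP/bc_opp; apply: brepr_pi. Qed.

Fact b_addA : associative b_add.
Proof.
elim/bpiW=> s; elim/bpiW=> t; elim/bpiW=> u; rewrite !b_addE.
exact/bpiP/bc_addA.
Qed.
Fact b_addC : commutative b_add.
Proof. by elim/bpiW=> s; elim/bpiW=> t; rewrite !b_addE; apply/bpiP/bc_addC. Qed.
Fact b_add0 : left_id (bpi Bzero) b_add.
Proof. by elim/bpiW=> s; rewrite b_addE; apply/bpiP/bc_add0. Qed.
Fact b_addN : left_inverse (bpi Bzero) b_opp b_add.
Proof. by elim/bpiW=> s; rewrite b_oppE b_addE; apply/bpiP/bc_addN. Qed.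
HB.instance Definition _ := GRing.isZmodule.Build ber_sort b_addA b_addC b_add0 b_addN.

Lemma bpiD s t : bpi (Badd s t) = bpi s + bpi t. Proof. exact/esym/b_addE. Qed.
Lemma bpiN s : bpi (Bopp s) = - bpi s. Proof. exact/esym/b_oppE. Qed.

Definition bmul (e : std_basis r M) (a : A) : ber_sort := bpi (Bgen e a).

Lemma bmulD e : {morph bmul e : a b / a + b}.
Proof. by move=> a b; rewrite -bpiD; apply/bpiP/bc_genD. Qed.
Lemma bmul0 e : bmul e 0 = 0.
Proof. by apply: (addrI (bmul e 0)); rewrite -bmulD !addr0. Qed.
Lemma bmul_sum e (I : Type) (s : seq I) P (F : I -> A) :
  bmul e (\sum_(i <- s | P i) F i) = \sum_(i <- s | P i) bmul e (F i).
Proof. exact: (big_morph (bmul e) (bmulD e) (bmul0 e)). Qed.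
Lemma bmul_change e e' T a : inGL0 T -> basis_change e e' T ->
  bmul e' a = bmul e (B T * a).
Proof. by move=> hT eT; apply/bpiP/bc_change. Qed.

Lemma homog0_central (a b : A) : homog (ga_gr A) 0 a -> a * b = b * a.
Proof.
move=> ha; rewrite -(gpr_sum (ga_gr A) b) mulr_sumr mulr_suml; apply: eq_bigr => g _.
by rewrite (ga_comm ha (homog_gpr _ g b)) gsgn0 mul1r.
Qed.

(* Additive maps given on the generators, by compatible maps A -> A. *)
Fixpoint bmap (f : A -> A) (s : bexp) : ber_sort :=
  match s with
  | Bgen e a => bmul e (f a)
  | Bzero => 0
  | Badd t u => bmap f t + bmap f u
  | Bopp t => - bmap f t
  end.

Lemma bmap_cong (f : A -> A) : {morph f : x y / x + y} ->
    (forall c a, homog (ga_gr A) 0 c -> f (c * a) = c * f a) ->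
  forall s t, bcong s t -> bmap f s = bmap f t.
Proof.
move=> fD fM s t; elim=> {s t} //=.
- by move=> s t u _ -> _ ->.
- by move=> s s' t t' _ -> _ ->.
- by move=> s s' _ ->.
- by move=> s t u; rewrite addrA.
- by move=> s t; rewrite addrC.
- by move=> s; rewrite add0r.
- by move=> s; rewrite addNr.
- by move=> e a b; rewrite fD bmulD.
by move=> e e' T a hT eT; rewrite (bmul_change _ hT eT) fM //; apply: gber_deg0.
Qed.

Definition b_scale (a : A) (x : ber_sort) : ber_sort :=
  bmap (fun b => twist ber_deg a * b) (brepr x).

Lemma b_scaleE a s : b_scale a (bpi s) = bmap (fun b => twist ber_deg a * b) s.
Proof.
apply: bmap_cong (brepr_pi s) => [x y|c b hc]; first exact: mulrDr.
by rewrite !mulrA (homog0_central _ hc).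
Qed.

Fact b_scaleDr : right_distributive b_scale +%R.
Proof. by move=> a; elim/bpiW=> s; elim/bpiW=> t; rewrite -bpiD !b_scaleE. Qed.
Lemma b_scaleN a x : b_scale a (- x) = - b_scale a x.
Proof. by elim/bpiW: x => s; rewrite -bpiN !b_scaleE. Qed.
Lemma b_scale0 a : b_scale a 0 = 0.
Proof. exact: (b_scaleE a Bzero). Qed.
Lemma b_scale_mul a e b : b_scale a (bmul e b) = bmul e (twist ber_deg a * b).
Proof. exact: b_scaleE. Qed.

Lemma ber_ind (Q : ber_sort -> Prop) :
    (forall e a, Q (bmul e a)) -> Q 0 -> (forall x y, Q x -> Q y -> Q (x + y)) ->
    (forall x, Q x -> Q (- x)) -> forall x, Q x.
Proof.
move=> Qg Q0 QD QN; elim/bpiW; elim=> [e a||s IHs t IHt|s IHs] //.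
- exact: Qg.
- by rewrite bpiD; apply: QD.
by rewrite bpiN; apply: QN.
Qed.

Fact b_scaleA a b x : b_scale a (b_scale b x) = b_scale (a * b) x.
Proof.
elim/ber_ind: x => [e c||x y IHx IHy|x IHx].
- by rewrite !b_scale_mul twistM mulrA.
- by rewrite !b_scale0.
- by rewrite !b_scaleDr IHx IHy.
by rewrite !b_scaleN IHx.
Qed.
Fact b_scale1 : left_id 1 b_scale.
Proof.
elim/ber_ind=> [e c||x y IHx IHy|x IHx].
- by rewrite b_scale_mul twist1 mul1r.
- by rewrite b_scale0.
- by rewrite b_scaleDr IHx IHy.
by rewrite b_scaleN IHx.
Qed.
Fact b_scaleDl x : {morph b_scale^~ x : a b / a + b}.
Proof.
move=> a b; elim/ber_ind: x => [e c||x y IHx IHy|x IHx].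
- by rewrite !b_scale_mul twistD mulrDl bmulD.
- by rewrite !b_scale0 addr0.
- by rewrite !b_scaleDr IHx IHy addrACA.
by rewrite !b_scaleN IHx opprD.
Qed.
HB.instance Definition _ := GRing.Zmodule_isLmodule.Build A ber_sort
  b_scaleA b_scale1 b_scaleDr b_scaleDl.

Definition b_gpr (g : Gam n) (x : ber_sort) : ber_sort :=
  bmap (ga_gr A (g - ber_deg)) (brepr x).

Lemma b_gprE g s : b_gpr g (bpi s) = bmap (ga_gr A (g - ber_deg)) s.
Proof.
apply: bmap_cong (brepr_pi s) => [|c b hc]; first exact: gprD.
rewrite ga_prM (bigD1 0) //= big1 ?addr0 ?subr0 ?hc // => h /negPf h0.
by rewrite (homogE _ hc) h0 mul0r.
Qed.

Fact b_gprD g : {morph b_gpr g : x y / x + y}.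
Proof. by elim/bpiW=> s; elim/bpiW=> t; rewrite -bpiD !b_gprE. Qed.
Lemma b_gprN g x : b_gpr g (- x) = - b_gpr g x.
Proof. by elim/bpiW: x => s; rewrite -bpiN !b_gprE. Qed.
Lemma b_gpr0 g : b_gpr g 0 = 0.
Proof. exact: (b_gprE g Bzero). Qed.
Lemma b_gpr_mul g e a : b_gpr g (bmul e a) = bmul e (ga_gr A (g - ber_deg) a).
Proof. exact: b_gprE. Qed.

Fact b_gprK g h x : b_gpr g (b_gpr h x) = if g == h then b_gpr h x else 0.
Proof.
elim/ber_ind: x => [e c||x y IHx IHy|x IHx].
- rewrite !b_gpr_mul gprK (inj_eq (addIr _)).
  by case: eqP => // _; rewrite bmul0.
- by rewrite !b_gpr0 if_same.
- by rewrite !b_gprD IHx IHy; case: eqP; rewrite ?addr0.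
by rewrite !b_gprN IHx; case: eqP; rewrite ?oppr0.
Qed.
Fact b_gpr_sum x : \sum_g b_gpr g x = x.
Proof.
elim/ber_ind: x => [e c||x y IHx IHy|x IHx].
- rewrite (reindex_inj (addIr ber_deg)) -[in RHS](gpr_sum (ga_gr A) c) bmul_sum.
  by apply: eq_bigr => g _; rewrite b_gpr_mul addrK.
- by rewrite big1 // => g _; rewrite b_gpr0.
- by rewrite -{2}IHx -{2}IHy -big_split; apply: eq_bigr => g _; rewrite b_gprD.
by rewrite -{2}IHx -sumrN; apply: eq_bigr => g _; rewrite b_gprN.
Qed.

Definition ber_gr := Gradation b_gprD b_gprK b_gpr_sum.

Fact ber_act g h (a : A) (x : ber_sort) :
  homog (ga_gr A) g a -> homog ber_gr h x -> homog ber_gr (g + h) (a *: x).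
Proof.
move=> ha <-; rewrite /=; elim/ber_ind: x => [e c||x y IHx IHy|x IHx].
- rewrite b_gpr_mul [_ *: _]b_scale_mul /homog /= b_gpr_mul; congr bmul.
  by rewrite -addrA; apply: ga_mul; [apply: homog_twist|apply: homog_gpr].
- by rewrite b_gpr0 scaler0; apply: homog0.
- by rewrite b_gprD scalerDr; apply: homogD.
by rewrite b_gprN scalerN; apply: homogN.
Qed.

Definition ber_gmod : gmod A := GMod ber_act.

Definition ber_gen (e : std_basis r M) : ber_gmod := bmul e 1.

Lemma homog_ber_gen e : homog (gm_gr ber_gmod) ber_deg (ber_gen e).
Proof.
by rewrite /homog /= b_gpr_mul subrr; congr bmul; apply: ga_one.
Qed.

Lemma ber_ract e a : ract (ber_gen e) a = bmul e a.
Proof.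
rewrite (ract_homog _ (homog_ber_gen e)) [_ *: _]b_scale_mul twistK mulr1 //.
Qed.

Lemma ber_gen_change e e' T : inGL0 T -> basis_change e e' T ->
  ber_gen e' = ract (ber_gen e) (B T).
Proof. by move=> hT eT; rewrite ber_ract /ber_gen (bmul_change _ hT eT) mulr1. Qed.

End Berezinian.

(* Main.v *)
(* Let x_i = Pi e_i and y_i = eps^i.  Exactly one of x_i, y_i is odd; call the odd
   ones odd letters, so that xi_1 ... xi_r is, up to a sign depending only on r
   and p, the product w(e) of the odd letters.  The operator
   h = sum_i d/dy_i d/dx_i satisfies
     d h + h d = sum_i (1 + N(even letter i) - N(odd letter i)),
   where N counts occurrences of a letter.  On a nonzero monomial this is a
   natural number which vanishes only for +-w(e); in characteristic 0 every
   cycle is therefore homologous to w(e) a with a in A.  The coefficient of w(e)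
   modulo the even letters vanishes on boundaries, so a is unique, and w(e)
   generates the homology freely.
   For another basis e' = e X one gets w(e') ~ w(e) Phi(X).  Phi is multiplicative
   by functoriality, and modulo the even letters its values on block diagonal and
   block unitriangular matrices are computed directly, the blocks of X on even
   degrees and of X^-1 on odd degrees acting on anticommuting letters.  Thus Phi
   satisfies the axioms of the graded Berezinian and equals it by uniqueness,
   which is the well-definedness of psi. *)
Require Import Defs.
From mathcomp Require Import all_boot all_order all_algebra.
From HB Require Import structures.
From mathcomp Require Import fingroup perm boolp.

Set Implicit Arguments.
Unset Strict Implicit.
Unset Printing Implicit Defensive.

Import GRing.Theory.
Local Open Scope ring_scope.

(** * Signs and ring homomorphisms *)

Lemma gsgn_signr (R : pzRingType) n (x y : Gam n) :
  gsgn R x y = (-1) ^+ (gpair x y == 1).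
Proof.
by rewrite /gsgn; case: (gpair x y) => -[|[|m]].
Qed.

Lemma gsgnxx (R : pzRingType) n (x : Gam n) : gsgn R x x = (-1) ^+ godd x.
Proof. exact: gsgn_signr. Qed.

Section RingMaps.
Variables (R S : pzRingType) (f : R -> S).

(* Ring homomorphisms as plain functions, which need no packed structure on
   quotients such as [symalg P]. *)
Definition is_rmorph : Prop :=
  [/\ {morph f : x y / x + y}, {morph f : x y / x * y} & f 1 = 1].

Hypothesis fR : is_rmorph.

Lemma rmD x y : f (x + y) = f x + f y. Proof. by case: fR. Qed.
Lemma rmM x y : f (x * y) = f x * f y. Proof. by case: fR. Qed.
Lemma rm1 : f 1 = 1. Proof. by case: fR. Qed.
Lemma rm0 : f 0 = 0.
Proof. by apply: (addrI (f 0)); rewrite -rmD !addr0. Qed.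
Lemma rmN x : f (- x) = - f x.
Proof. by apply/eqP; rewrite -addr_eq0 -rmD addNr rm0. Qed.
Lemma rm_sum (I : Type) (s : seq I) P (F : I -> R) :
  f (\sum_(i <- s | P i) F i) = \sum_(i <- s | P i) f (F i).
Proof. exact: (big_morph f rmD rm0). Qed.
Lemma rm_prod (I : Type) (s : seq I) P (F : I -> R) :
  f (\prod_(i <- s | P i) F i) = \prod_(i <- s | P i) f (F i).
Proof. exact: (big_morph f rmM rm1). Qed.
Lemma rm_sgn n (g h : Gam n) : f (gsgn R g h) = gsgn S g h.
Proof. by rewrite !gsgn_signr; case: eqP; rewrite ?rmN rm1. Qed.

End RingMaps.

(** * Universal property of the graded symmetric algebra *)

Section SymAlg.
Variables (k : fieldType) (n : nat) (A : gcAlg k n) (P : gmod A).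
Local Notation S := (symalg P).

Lemma spi_rmorph : is_rmorph (@spi _ _ _ P).
Proof. by split=> [a b|a b|] //; [rewrite spiD|rewrite symalg_piM]. Qed.

Definition ssc (a : A) : S := spi (tsc P a).

Lemma ssc_rmorph : is_rmorph ssc.
Proof.
split=> [a b|a b|] //; first by rewrite /ssc tscD spiD.
by rewrite /ssc tscM symalg_piM.
Qed.

Lemma ssc0 : ssc 0 = 0. Proof. exact: rm0 ssc_rmorph. Qed.
Lemma ssc1 : ssc 1 = 1. Proof. exact: rm1 ssc_rmorph. Qed.
Lemma sscD a b : ssc (a + b) = ssc a + ssc b. Proof. exact: rmD ssc_rmorph _ _. Qed.
Lemma sscM a b : ssc (a * b) = ssc a * ssc b. Proof. exact: rmM ssc_rmorph _ _. Qed.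

Lemma sgenD x y : sgen (x + y) = sgen x + sgen y :> S.
Proof. by rewrite /sgen tgenD spiD. Qed.
Lemma sgen0 : sgen 0 = 0 :> S.
Proof. by rewrite /sgen tgen0 (rm0 spi_rmorph). Qed.
Lemma sgen_sum (I : Type) (s : seq I) Q (F : I -> P) :
  sgen (\sum_(i <- s | Q i) F i) = \sum_(i <- s | Q i) sgen (F i) :> S.
Proof. exact: (big_morph (@sgen _ _ _ P) sgenD sgen0). Qed.
Lemma sgenZ a x : sgen (a *: x) = ssc a * sgen x :> S.
Proof. by rewrite /sgen tgenZ symalg_piM. Qed.
Lemma sgen_ract a x : sgen (ract x a) = sgen x * ssc a :> S.
Proof. by rewrite /sgen tgenR symalg_piM. Qed.

Lemma sgenC g h x y : homog (gm_gr P) g x -> homog (gm_gr P) h y ->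
  sgen x * sgen y = gsgn S g h * (sgen y * sgen x) :> S.
Proof.
move=> hx hy; rewrite /sgen -!symalg_piM.
have -> : gsgn S g h = spi (gsgn (talg P) g h).
  exact/esym/(rm_sgn spi_rmorph).
by rewrite -symalg_piM; apply/spiP/si_gen.
Qed.

Section Universal.
Variables (R : pzRingType) (phi : A -> R) (f : P -> R).
Hypotheses (phiR : is_rmorph phi) (fD : {morph f : x y / x + y}).
Hypotheses (fZ : forall a x, f (a *: x) = phi a * f x).
Hypotheses (fr : forall a x, f (ract x a) = f x * phi a).
Hypotheses (fC : forall g h x y, homog (gm_gr P) g x -> homog (gm_gr P) h y ->
  f x * f y = gsgn R g h * (f y * f x)).

Fixpoint teval (s : texp P) : R :=
  match s with
  | Tsc a => phi a
  | Tgen x => f x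
  | Tadd t u => teval t + teval u
  | Tmul t u => teval t * teval u
  end.

Lemma teval_cong s t : tcong s t -> teval s = teval t.
Proof.
elim=> {s t} //=.
- by move=> s t u _ -> _ ->.
- by move=> s s' t t' _ -> _ ->.
- by move=> s s' t t' _ -> _ ->.
- by move=> s t u; rewrite addrA.
- by move=> s t; rewrite addrC.
- by move=> s; rewrite (rm0 phiR) add0r.
- by move=> s; rewrite (rmN phiR) (rm1 phiR) (rm0 phiR) mulN1r addNr.
- by move=> s t u; rewrite mulrA.
- by move=> s; rewrite (rm1 phiR) mul1r.
- by move=> s; rewrite (rm1 phiR) mulr1.
- by move=> s t u; rewrite mulrDl.
- by move=> s t u; rewrite mulrDr.
- by move=> a b; rewrite (rmD phiR).
- by move=> a b; rewrite (rmM phiR).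
Qed.

Definition talg_eval (x : talg P) : R := teval (trepr x).

Lemma talg_evalE s : talg_eval (tpi s) = teval s.
Proof. exact/teval_cong/trepr_pi. Qed.

Lemma talg_eval_rmorph : is_rmorph talg_eval.
Proof.
split; last by rewrite -tsc1 talg_evalE /= (rm1 phiR).
  by elim/tpiW=> s; elim/tpiW=> t; rewrite -tpiD !talg_evalE.
by elim/tpiW=> s; elim/tpiW=> t; rewrite -tpiM !talg_evalE.
Qed.

Lemma talg_eval_ideal x : sym_ideal x -> talg_eval x = 0.
Proof.
have tR := talg_eval_rmorph.
elim=> {x}.
- move=> g h x y hx hy; rewrite (rmD tR) (rmN tR) !(rmM tR) (rm_sgn tR).
  by rewrite !talg_evalE /= (fC hx hy) subrr.
- exact: rm0 tR.
- by move=> x y _ hx _ hy; rewrite (rmD tR) hx hy addr0.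
- by move=> x y _ hy; rewrite (rmM tR) hy mulr0.
by move=> x y _ hx; rewrite (rmM tR) hx mul0r.
Qed.

(** Evaluation of ring expressions respects [tcong] rule by rule, and [fC] makes it vanish on the
    generators of [sym_ideal]; it therefore descends through both quotients. *)
Lemma symalg_universal : exists F : S -> R,
  [/\ is_rmorph F, forall a, F (ssc a) = phi a & forall x, F (sgen x) = f x].
Proof.
have tR := talg_eval_rmorph.
pose F (x : S) := talg_eval (srepr x).
have FE x : F (spi x) = talg_eval x.
  apply/eqP; rewrite -subr_eq0 -(rmN tR) -(rmD tR); apply/eqP/talg_eval_ideal.
  exact: (@quot_reprP _ _ _ (talg_gmod P) (sym_gsub P)).
exists F; split; [split| |].
- by elim/spiW=> x; elim/spiW=> y; rewrite -spiD !FE (rmD tR).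
- by elim/spiW=> x; elim/spiW=> y; rewrite -symalg_piM !FE (rmM tR).
- by rewrite (FE 1) (rm1 tR).
- by move=> a; rewrite FE talg_evalE.
by move=> x; rewrite FE talg_evalE.
Qed.

End Universal.
End SymAlg.

(** * Parity of the standard degrees *)

Section StandardDegrees.
Variables (n : nat) (p : Gam n).
Hypotheses (n_gt0 : (0 < n)%N) (p_odd : godd p).

(** In the pairing of [x + p] with itself the cross terms cancel modulo 2, which leaves the pairing
    of [x] with itself plus 1. *)
Lemma godd_addp x : godd (x + p) = ~~ godd x.
Proof.
rewrite /godd gpairDl ![gpair _ (x + p)]gpairC !gpairDl (gpairC p x).
rewrite (eqP p_odd).
by case: (gpair x x) (gpair x p) => -[|[|m]] // hm -[[|[|m']] hm'].
Qed.

(** Translation by the odd element [p] exchanges even and odd elements, so each kind makes up half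
    of the 2^n elements. *)
Lemma card_even : #|[pred x : Gam n | ~~ godd x]| = (2 ^ n.-1)%N.
Proof.
have cC : #|[pred x : Gam n | godd x]| = #|[pred x : Gam n | ~~ godd x]|.
  rewrite -(card_image (addIr p)); apply: eq_card => x; rewrite !inE.
  apply/imageP/idP => [[y]|ox]; first by rewrite !inE => oy ->; rewrite godd_addp negbK.
  by exists (x + p); rewrite ?inE ?godd_addp ?ox // -addrA gamDD addr0.
apply/eqP; rewrite -(eqn_pmul2l (isT : 0 < 2)%N) -expnS prednK //.
rewrite mul2n -addnn -{1}cC; apply/eqP.
rewrite (cardC [pred x : Gam n | godd x]).
by rewrite card_mx card_Fp // mul1n.
Qed.

(** Both halves of [std_enum] have length 2^(n-1), and sorting preserves membership, so the half in
    which [u] falls decides the parity. *)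
Lemma godd_std_deg (u : 'I_(2 ^ n)) : godd (std_deg u) = (2 ^ n.-1 <= u)%N.
Proof.
have se : size [seq x <- enum {: Gam n} | ~~ godd x] = (2 ^ n.-1)%N.
  by rewrite -card_even cardE enumT /enum_mem !size_filter.
rewrite /std_deg /std_enum nth_cat size_sort se; case: ltnP => hu.
  have : nth 0 (sort (@lexle n) [seq x <- enum {: Gam n} | ~~ godd x]) u
      \in [seq x <- enum {: Gam n} | ~~ godd x].
    by rewrite -(mem_sort (@lexle n)) mem_nth // size_sort se.
  by rewrite mem_filter => /andP[/negPf].
have so : size [seq x <- enum {: Gam n} | godd x] = (2 ^ n.-1)%N.
  apply/eqP; rewrite -(eqn_add2r (2 ^ n.-1)) -{1}se !size_filter.
  rewrite count_predC -cardT card_mx card_Fp // mul1n.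
  by rewrite addnn -mul2n -expnS prednK.
set w := nth _ _ _; have : w \in [seq x <- enum {: Gam n} | godd x].
  rewrite -(mem_sort (@lexle n)) mem_nth // size_sort so ltn_subLR //.
  by rewrite addnn -mul2n -expnS prednK.
by rewrite mem_filter => /andP[].
Qed.

Variable r : 'I_(2 ^ n) -> nat.

(** Blocks are consecutive: [i] is the total size of the blocks before its own block [u], plus an
    offset below [r u]. The two cases compare this prefix sum with [even_rank]. *)
Lemma even_rankP (i : 'I_(total_rank r)) :
  (i < even_rank r)%N = (tagnat.sig1 i < 2 ^ n.-1)%N.
Proof.
rewrite {1}(tagnat.rect i) /even_rank; set u := tagnat.sig1 i.
case: (ltnP u) => hu.
  apply: (@leq_trans (\sum_(v : 'I_(2 ^ n) | (v < u)%N) r v + r u)%N).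
    by rewrite ltn_add2l ltn_ord.
  rewrite [leqRHS](bigID [pred v : 'I__ | (v < u)%N]) /=.
  rewrite [X in (_ <= X + _)%N](eq_bigl [pred v : 'I__ | (v < u)%N]) => [|v /=].
    by rewrite leq_add2l (bigD1 u) ?hu ?ltnn //= leq_addr.
  by apply: andb_idl => vu; apply: ltn_trans hu.
apply/negbTE; rewrite -leqNgt; apply: leq_trans (leq_addr _ _).
rewrite [leqRHS](bigID [pred v : 'I__ | (v < 2 ^ n.-1)%N]) /=.
apply: leq_trans (leq_addr _ _); rewrite leq_eqVlt; apply/orP; left; apply/eqP.
apply: eq_bigl => v /=; case: (ltnP v (2 ^ n.-1)) => hv; rewrite ?andbF ?andbT //.
by rewrite (leq_trans hv hu).
Qed.

Lemma godd_std_ideg (i : 'I_(total_rank r)) :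
  godd (std_ideg i) = ~~ (i < even_rank r)%N.
Proof. by rewrite even_rankP -leqNgt; apply: godd_std_deg. Qed.

End StandardDegrees.

(** * Symmetric algebras of free modules *)

(** Sign identities are settled by turning each sign into a power of -1 with a boolean exponent and
    splitting on every pairing. *)
Ltac sign_cases :=
  rewrite ?gsgn_signr; repeat case: (gpair _ _ == 1);
  rewrite ?(expr1, expr0, mulN1r, mul1r, mulrN, mulNr, opprK).

Section FreeSymAlg.
Variables (k : fieldType) (n : nat) (A : gcAlg k n).

(* A homogeneous basis, together with its right coordinates. *)
Record gbasis (P : gmod A) (I : finType) := GBasis {
  gb_elt :> I -> P;
  gb_deg : I -> Gam n;
  gb_co : I -> P -> A;
  gb_homog : forall c, homog (gm_gr P) (gb_deg c) (gb_elt c);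
  gb_coD : forall c, {morph gb_co c : x y / x + y};
  gb_coZ : forall c a x, gb_co c (a *: x) = twist (gb_deg c) a * gb_co c x;
  gb_coR : forall c x a, gb_co c (ract x a) = gb_co c x * a;
  gb_coh : forall c g x, homog (gm_gr P) g x ->
    homog (ga_gr A) (g + gb_deg c) (gb_co c x);
  gb_coE : forall x, x = \sum_c ract (gb_elt c) (gb_co c x);
  gb_co_delta : forall c d, gb_co c (gb_elt d) = (c == d)%:R
}.

Variables (P : gmod A) (I : finType) (b : gbasis P I).
Local Notation S := (symalg P).
Local Notation dg := (gb_deg b).

Definition letter (c : I) : S := sgen (b c).
Definition word (s : seq I) : S := \prod_(c <- s) letter c.
Definition wdeg (s : seq I) : Gam n := \sum_(c <- s) dg c.

Lemma word_nil : word [::] = 1. Proof. exact: big_nil. Qed.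
Lemma word_cons c s : word (c :: s) = letter c * word s.
Proof. exact: big_cons. Qed.
Lemma word_cat s t : word (s ++ t) = word s * word t.
Proof. exact: big_cat. Qed.

Lemma letterC c d :
  letter c * letter d = gsgn S (dg c) (dg d) * (letter d * letter c).
Proof. exact: sgenC (gb_homog b c) (gb_homog b d). Qed.

Lemma letter_ssc c a : letter c * ssc P a = ssc P (twist (dg c) a) * letter c.
Proof. by rewrite -sgen_ract (ract_homog a (gb_homog b c)) sgenZ. Qed.

Lemma ssc_letter a c : ssc P a * letter c = letter c * ssc P (twist (dg c) a).
Proof. by rewrite letter_ssc twistK. Qed.

Lemma ssc_word a s : ssc P a * word s = word s * ssc P (twist (wdeg s) a).
Proof.
elim: s a => [|c s IHs] a.
  by rewrite word_nil mulr1 mul1r /wdeg big_nil twist_0.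
rewrite word_cons mulrA ssc_letter -mulrA IHs mulrA.
by rewrite twist_twist addrC /wdeg big_cons.
Qed.

Lemma homog_word s : homog (s_gr P) (wdeg s) (word s).
Proof.
elim: s => [|c s IHs].
  by rewrite /wdeg big_nil word_nil -ssc1; apply/homog_spi/homog_tsc/ga_one.
rewrite word_cons /wdeg big_cons; apply: homog_smul IHs.
exact/homog_sgen/gb_homog.
Qed.

Section FreeUniversal.
Variables (R : pzRingType) (phi : A -> R) (w : I -> R).
Hypotheses (phiR : is_rmorph phi).
Hypothesis (wC : forall c d, w c * w d = gsgn R (dg c) (dg d) * (w d * w c)).
Hypothesis (phiw : forall c a, phi a * w c = w c * phi (twist (dg c) a)).

(** Values on the letters extend to all of [P] through right coordinates. Graded commutativity of
    the extension combines [wC], the passage of scalars across [w], and graded commutativity of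
    [A]. *)
Lemma free_universal : exists F : S -> R,
  [/\ is_rmorph F, forall a, F (ssc P a) = phi a & forall c, F (letter c) = w c].
Proof.
pose f x := \sum_c w c * phi (gb_co b c x).
have fD : {morph f : x y / x + y}.
  move=> x y; rewrite -big_split; apply: eq_bigr => c _.
  by rewrite gb_coD (rmD phiR) mulrDr.
have fZ a x : f (a *: x) = phi a * f x.
  rewrite mulr_sumr; apply: eq_bigr => c _.
  by rewrite gb_coZ (rmM phiR) !mulrA phiw.
have fr a x : f (ract x a) = f x * phi a.
  by rewrite mulr_suml; apply: eq_bigr => c _; rewrite gb_coR (rmM phiR) mulrA.
have fC g h x y : homog (gm_gr P) g x -> homog (gm_gr P) h y ->
    f x * f y = gsgn R g h * (f y * f x).
  move=> hx hy; rewrite mulr_suml [f y * f x]mulr_sumr mulr_sumr.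
  apply: eq_bigr => c _; rewrite mulr_sumr mulr_suml mulr_sumr.
  apply: eq_bigr => d _.
  set u := gb_co b c x; set v := gb_co b d y.
  have hu : homog (ga_gr A) (g + dg c) u by apply: gb_coh.
  have hv : homog (ga_gr A) (h + dg d) v by apply: gb_coh.
  (* Both sides become a sign times [w d * w c * phi v * phi u]; bilinearity of the pairing shows
     that the signs agree. *)
  rewrite -mulrA [phi u * _]mulrA phiw (twist_homog _ hu).
  rewrite -[w d * phi v * _]mulrA [phi v * _]mulrA phiw (twist_homog _ hv).
  rewrite -!mulrA -!(rmM phiR) mulrA wC -!mulrA (ga_comm hu hv) !(rmM phiR).
  rewrite !(rm_sgn phiR) !gsgnDl !gsgnDr ?gsgnDl (gsgnC R h) (gsgnC R (dg d)).
  by sign_cases.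
have [F [FR Fa Fx]] := symalg_universal phiR fD fZ fr fC.
exists F; split=> // c; rewrite Fx /f (bigD1 c) //= gb_co_delta eqxx (rm1 phiR) mulr1.
rewrite big1 ?addr0 // => d /negPf dc.
by rewrite gb_co_delta dc (rm0 phiR) mulr0.
Qed.
End FreeUniversal.


(** The right span of the words over [A]. Letters of a word come in any order and no independence is
    claimed; its purpose is the induction principle [word_ind]. *)
Inductive wspan : S -> Prop :=
| ws_0 : wspan 0
| ws_D x y : wspan x -> wspan y -> wspan (x + y)
| ws_word s a : wspan (word s * ssc P a).

Lemma wspan_sum (J : Type) (t : seq J) (pr : pred J) (F : J -> S) :
  (forall j, wspan (F j)) -> wspan (\sum_(j <- t | pr j) F j).
Proof. by move=> hF; apply: big_ind => // *; [exact: ws_0|exact: ws_D]. Qed.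

Lemma wspanM x y : wspan x -> wspan y -> wspan (x * y).
Proof.
move=> hx hy; elim: hx => [|u v _ IHu _ IHv|s a].
- by rewrite mul0r; apply: ws_0.
- by rewrite mulrDl; apply: ws_D.
elim: hy => [|u v _ IHu _ IHv|t c].
- by rewrite mulr0; apply: ws_0.
- by rewrite mulrDr; apply: ws_D.
rewrite -mulrA [ssc P a * _]mulrA ssc_word !mulrA -word_cat -mulrA -sscM.
exact: ws_word.
Qed.

Lemma wspan_all x : wspan x.
Proof.
have wssc a : wspan (ssc P a).
  by rewrite -[ssc P a]mul1r -word_nil; apply: ws_word.
elim/spiW: x; elim/tpiW; elim=> [a|x|s IHs t IHt|s IHs t IHt].
- exact: wssc.
- rewrite -/(sgen x) [x](gb_coE b) sgen_sum; apply: wspan_sum => c.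
  rewrite sgen_ract -/(letter c) -[letter c]mulr1 -word_nil -word_cons.
  exact: ws_word.
- by rewrite tpiD spiD; apply: ws_D.
by rewrite tpiM symalg_piM; apply: wspanM.
Qed.

Lemma word_ind (Q : S -> Prop) :
    Q 0 -> (forall x y, Q x -> Q y -> Q (x + y)) ->
    (forall s a, Q (word s * ssc P a)) ->
  forall x, Q x.
Proof.
move=> Q0 QD Qw x.
by elim: (wspan_all x) => [|u v _ Qu _ Qv|s a]; [|apply: QD|].
Qed.

(** Letters commute up to sign, so the head of [s] can be moved to its place in [t]. The sign is
    left unspecified, since it is later absorbed in a coefficient or multiplies 0. *)
Lemma word_perm s t : perm_eq s t -> exists m : bool, word s = (-1) ^+ m * word t.
Proof.
pose R s t := exists m : bool, word s = (-1) ^+ m * word t.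
have Rrefl u : R u u by exists false; rewrite mul1r.
have Rtrans u v x : R u v -> R v x -> R u x.
  by move=> [m E] [m' E']; exists (m (+) m'); rewrite E E' mulrA signr_addb.
have Rcons c u v : R u v -> R (c :: u) (c :: v).
  move=> [m E]; exists m; rewrite !word_cons E !mulrA; congr (_ * _).
  exact: commr_sign.
have Rhd c u v : R (c :: u ++ v) (u ++ c :: v).
  elim: u => [|d u IHu] //=; apply: Rtrans (Rcons d _ _ IHu).
  exists (gpair (dg c) (dg d) == 1); rewrite !word_cons !mulrA letterC.
  by rewrite gsgn_signr !mulrA.
elim: s t => [|c s IHs] t pst.
  by move: (perm_size pst) => /esym/size0nil ->; apply: Rrefl.
have ct : c \in t by rewrite -(perm_mem pst) mem_head.
have [u [v E]] : exists u v, t = u ++ c :: v.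
  by case/splitPr: ct => u v; exists u, v.
rewrite E in pst *; apply: Rtrans (Rhd c u v); apply: Rcons; apply: IHs.
by rewrite -(perm_cons c) (perm_trans pst) // -cat_cons perm_catC /= perm_cons perm_catC.
Qed.

End FreeSymAlg.

(** * Upper triangular 2 x 2 matrices and graded derivations *)

Section TriangularMatrices.
Variable R : pzRingType.

Definition tri (x y z : R) : 'M[R]_2 :=
  \matrix_(i, j) if i == 0 then if j == 0 then x else y else if j == 0 then 0 else z.

Lemma triM x y z x' y' z' :
  tri x y z * tri x' y' z' = tri (x * x') (x * y' + y * z') (z * z').
Proof.
apply/matrixP => i j; rewrite !mxE !big_ord_recl big_ord0 !mxE /= addr0.
by case: i j => [[|[|i]] hi] [[|[|j]] hj] //=; rewrite ?(mulr0, mul0r, addr0, add0r).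
Qed.

Lemma triD x y z x' y' z' :
  tri x y z + tri x' y' z' = tri (x + x') (y + y') (z + z').
Proof. by apply/matrixP => i j; rewrite !mxE; do 2!case: ifP => //; rewrite addr0. Qed.

Lemma tri1 : tri 1 0 1 = 1.
Proof.
by apply/matrixP => i j; rewrite !mxE; case: i j => [[|[|i]] hi] [[|[|j]] hj].
Qed.

Lemma tri_sgn (m : bool) x y z :
  (-1) ^+ m * tri x y z = tri ((-1) ^+ m * x) ((-1) ^+ m * y) ((-1) ^+ m * z).
Proof.
case: m; rewrite ?expr0 ?mul1r // !expr1 !mulN1r; apply/matrixP => i j.
by rewrite !mxE; do 2!case: ifP => //; rewrite oppr0.
Qed.

End TriangularMatrices.

Section Derivations.
Variables (k : fieldType) (n : nat) (A : gcAlg k n).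
Variables (P : gmod A) (I : finType) (b : gbasis P I).
Local Notation S := (symalg P).
Local Notation dg := (gb_deg b).
Local Notation z := (letter b).

(* The left derivation d/dz_c, of the same degree as z_c; it is the upper right
   entry of a ring homomorphism to triangular 2 x 2 matrices. *)
Definition is_partial (c : I) (D : S -> S) : Prop :=
  [/\ {morph D : x y / x + y}, D 1 = 0,
      forall x a, D (x * ssc P a) = D x * ssc P a
    & forall d x, D (z d * x) =
        (d == c)%:R * x + gsgn S (dg c) (dg d) * (z d * D x)].

Lemma partial_exists c : exists D, is_partial c D.
Proof.
(* The upper left entry is the automorphism multiplying degree g by the sign of g against [dg c]; it
   supplies the sign of the Leibniz rule. *)
pose phi a := tri (ssc P (twist (dg c) a)) 0 (ssc P a).
pose w d := tri (gsgn S (dg c) (dg d) * z d) (d == c)%:R (z d).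
have phiR : is_rmorph phi.
  split; last by rewrite /phi twist1 ssc1 tri1.
    by move=> x y; rewrite triD addr0 /phi twistD !sscD.
  by move=> x y; rewrite triM mulr0 mul0r addr0 /phi twistM !sscM.
have wC d e : w d * w e = gsgn _ (dg d) (dg e) * (w e * w d).
  rewrite /w !triM (gsgn_signr 'M[S]_2) tri_sgn -!(gsgn_signr S).
  congr tri.
  - rewrite -!mulrA [z d * (_ * _)]mulrA -[z d * gsgn _ _ _]gsgn_comm.
    rewrite [z e * (_ * _)]mulrA -[z e * gsgn _ _ _]gsgn_comm -!mulrA (letterC b d e).
    by sign_cases.
  (* The corner entry is the derivative of the relation [letterC], which is nontrivial only when [d]
     or [e] is [c]. *)
  - have [->|dc] := eqVneq d c; have [->|ec] := eqVneq e c.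
    + by rewrite !mulr1 !mul1r; sign_cases; rewrite ?addNr ?oppr0.
    + rewrite !mulr0 !mulr1 !mul1r !mul0r add0r addr0 mulrA gsgnK mul1r //.
    + by rewrite !mulr0 !mulr1 !mul1r !mul0r add0r addr0 gsgnC.
    + by rewrite !mulr0 !mul0r addr0 mulr0.
  by rewrite letterC.
have phiw d a : phi a * w d = w d * phi (twist (dg d) a).
  rewrite !triM !mulr0 !mul0r ?addr0 ?add0r ssc_letter; congr tri.
    rewrite mulrA -gsgn_comm -mulrA ssc_letter mulrA.
    by rewrite !twist_twist addrC.
  have [->|dc] := eqVneq d c; first by rewrite mulr1 mul1r.
  by rewrite mulr0 mul0r.
have [F [FR Fa Fz]] := free_universal phiR wC phiw.
(* The lower row of [F x] is (0, x), so multiplicativity of [F] gives the twisted Leibniz rule for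
   the corner entry. *)
have FE x : F x = tri (F x 0 0) (F x 0 1) x.
  elim/(word_ind (b := b)): x => [|x y Ex Ey|s a].
  - by rewrite (rm0 FR); apply/matrixP => i j; rewrite !mxE !if_same.
  - by rewrite (rmD FR) [in LHS]Ex [in LHS]Ey triD !mxE.
  rewrite (rmM FR) Fa; suff -> : F (word b s) = tri (F (word b s) 0 0) (F (word b s) 0 1) (word b s).
    by rewrite /phi triM !mxE.
  elim: s => [|d s IHs]; first by rewrite word_nil (rm1 FR) -tri1 !mxE.
  by rewrite word_cons (rmM FR) Fz IHs triM !mxE.
exists (fun x => F x 0 1); split.
- by move=> x y; rewrite (rmD FR) mxE.
- by rewrite (rm1 FR) -tri1 mxE.
- by move=> x a; rewrite (rmM FR) Fa FE triM !mxE /= mulr0 add0r.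
by move=> d x; rewrite (rmM FR) Fz FE triM !mxE /= addrC mulrA.
Qed.

End Derivations.

(** * Partial derivatives, Berezin integration and odd letters *)

Section FreeSymAlgTheory.
Variables (k : fieldType) (n : nat) (A : gcAlg k n).
Variables (P : gmod A) (I : finType) (b : gbasis P I).
Local Notation S := (symalg P).
Local Notation dg := (gb_deg b).
Local Notation z := (letter b).

Definition partial (c : I) : S -> S := projT1 (cid (partial_exists b c)).

Lemma partialP c : is_partial b c (partial c).
Proof. exact: projT2 (cid (partial_exists b c)). Qed.

Lemma partialD c : {morph partial c : x y / x + y}.
Proof. by case: (partialP c). Qed.
Lemma partial1 c : partial c 1 = 0. Proof. by case: (partialP c). Qed.
Lemma partial_ssc c x a : partial c (x * ssc P a) = partial c x * ssc P a.
Proof. by case: (partialP c). Qed.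
Lemma partialL c d x : partial c (z d * x) =
  (d == c)%:R * x + gsgn S (dg c) (dg d) * (z d * partial c x).
Proof. by case: (partialP c). Qed.
Lemma partial0 c : partial c 0 = 0.
Proof. by apply: (addrI (partial c 0)); rewrite -partialD !addr0. Qed.
Lemma partial_sgn c (m : bool) x : partial c ((-1) ^+ m * x) = (-1) ^+ m * partial c x.
Proof.
case: m; rewrite ?expr0 ?mul1r // expr1 !mulN1r.
by apply/eqP; rewrite -addr_eq0 -partialD addNr partial0.
Qed.

Lemma partial_notin c s a : c \notin s -> partial c (word b s * ssc P a) = 0.
Proof.
rewrite partial_ssc; elim: s => [|d s IHs]; first by rewrite word_nil partial1 mul0r.
rewrite inE negb_or eq_sym => /andP[/negPf dc /IHs hs].
by rewrite word_cons partialL dc mul0r add0r -!mulrA hs !mulr0.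
Qed.

(** This is the Euler operator of the letter [c]: commuting [z c] past another letter repeats the
    sign of the Leibniz rule, and the two signs cancel. *)
Lemma letter_partial c s a :
  z c * partial c (word b s * ssc P a) = (word b s * ssc P a) *+ count_mem c s.
Proof.
rewrite partial_ssc mulrA -mulrnAl; congr (_ * _).
elim: s => [|d s IHs]; first by rewrite word_nil partial1 mulr0.
rewrite word_cons partialL mulrDr /= mulrnDr; congr (_ + _).
  by case: eqP => [->|_]; rewrite ?mul1r // mul0r mulr0.
rewrite mulrA -gsgn_comm -mulrA [z c * (_ * _)]mulrA letterC -!mulrA IHs.
by rewrite !mulrA gsgnK mul1r mulrnAr.
Qed.

Lemma aug_exists : exists F : S -> A,
  [/\ is_rmorph F, forall a, F (ssc P a) = a & forall c, F (z c) = 0].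
Proof.
by apply: free_universal => // [c d|c a]; rewrite ?mulr0 ?mul0r ?mulr0.
Qed.

Definition aug : S -> A := projT1 (cid aug_exists).
Lemma aug_rmorph : is_rmorph aug.
Proof. by rewrite /aug; case: cid => F []. Qed.
Lemma aug_ssc a : aug (ssc P a) = a.
Proof. by rewrite /aug; case: cid => F []. Qed.

Lemma restrict_exists (Q : pred I) : exists F : S -> S,
  [/\ is_rmorph F, forall a, F (ssc P a) = ssc P a
    & forall c, F (z c) = if Q c then z c else 0].
Proof.
apply: free_universal; first exact: ssc_rmorph.
  by move=> c d; do 2!case: ifP => _; rewrite ?(mulr0, mul0r) // letterC.
by move=> c a; case: ifP => _; rewrite ?(mulr0, mul0r) // ssc_letter.
Qed.

Definition restrict (Q : pred I) : S -> S := projT1 (cid (restrict_exists Q)).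
Lemma restrict_rmorph Q : is_rmorph (restrict Q).
Proof. by rewrite /restrict; case: cid => F []. Qed.
Lemma restrict_ssc Q a : restrict Q (ssc P a) = ssc P a.
Proof. by rewrite /restrict; case: cid => F []. Qed.
Lemma restrict_letter Q c : restrict Q (z c) = if Q c then z c else 0.
Proof. by rewrite /restrict; case: cid => F []. Qed.

(* Berezin integration with respect to the letters of s. *)
Definition berint (s : seq I) (x : S) : A := aug (foldl (fun y c => partial c y) x s).

Lemma berintD s : {morph berint s : x y / x + y}.
Proof.
rewrite /berint; elim: s => [|c s IHs] x y /=; first exact: rmD aug_rmorph _ _.
by rewrite partialD IHs.
Qed.

(** Derivatives are taken in the order of the letters, so each one strips the leading letter without
    a sign; the Leibniz remainder vanishes because [s] has no repetition. *)
Lemma berint_word s a : uniq s -> berint s (word b s * ssc P a) = a.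
Proof.
rewrite /berint; elim: s => [|c s IHs] /=.
  by rewrite word_nil mul1r aug_ssc.
case/andP=> cs /IHs {2}<-; congr (aug (foldl _ _ _)).
by rewrite word_cons -mulrA partialL eqxx mul1r (partial_notin _ cs) !mulr0 addr0.
Qed.

Section CharacteristicZero.
Hypothesis k_char0 : [pchar k] =i pred0.

(** Characteristic 0 enters through this inverse, which allows division by 2 for squares of odd
    elements and by the eigenvalues of [laplace]. *)
Lemma nat_inv_exists m : (0 < m)%N ->
  exists2 c : A, homog (ga_gr A) 0 c & m%:R * c = 1.
Proof.
move=> m_gt0; exists ((m%:R^-1 : k)%:A).
  exact/ga_scale/ga_one.
rewrite -mulr_natl mulr1 -scaler_nat -scalerAl mul1r.
by rewrite scalerA mulfV ?scale1r // ((pcharf0P k).1 k_char0) -lt0n.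
Qed.

Lemma symalg_mulrn_eq0 m (x : S) : (0 < m)%N -> x *+ m = 0 -> x = 0.
Proof.
move=> /nat_inv_exists[c _ mc] xm0.
rewrite -[x]mulr1 -ssc1 -mc sscM mulrA.
have -> : ssc P m%:R = m%:R.
  by elim: (m) => [|j IHj]; rewrite ?ssc0 // -addn1 !natrD sscD IHj ssc1.
by rewrite mulr_natr xm0 mul0r.
Qed.

Lemma letter_odd c : godd (dg c) -> z c * z c = 0.
Proof.
move=> oc; apply: (@symalg_mulrn_eq0 2) => //.
by rewrite mulr2n {1}letterC gsgnxx oc expr1 mulN1r addNr.
Qed.

(** Two occurrences of [c] can be brought to the front, up to sign, where they form a vanishing
    square. *)
Lemma word_odd_rep s c : godd (dg c) -> (1 < count_mem c s)%N -> word b s = 0.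
Proof.
move=> oc c2.
have cs : c \in s by rewrite -has_pred1 has_count (ltn_trans _ c2).
have cs' : c \in rem c s.
  rewrite -has_pred1 has_count; move: c2.
  by rewrite (seq.permP (perm_to_rem cs)) /= eqxx add1n ltnS.
have [m ->] : exists m : bool, word b s = (-1) ^+ m * word b (c :: c :: rem c (rem c s)).
  apply: word_perm; rewrite (perm_trans (perm_to_rem cs)) // perm_cons.
  exact: perm_to_rem.
by rewrite !word_cons [z c * (_ * _)]mulrA letter_odd // mul0r mulr0.
Qed.

Lemma letter_word_odd c s : godd (dg c) -> c \in s -> z c * word b s = 0.
Proof.
move=> oc cs; rewrite -word_cons (word_odd_rep oc) //= eqxx add1n ltnS.
by rewrite -has_count has_pred1.
Qed.

Lemma word_letter_odd c s : godd (dg c) -> c \in s -> word b s * z c = 0.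
Proof.
move=> oc cs; rewrite -[z c]mulr1 -(word_nil b) -word_cons -word_cat.
rewrite (word_odd_rep oc) // count_cat /= eqxx addn1 ltnS.
by rewrite -has_count has_pred1.
Qed.

End CharacteristicZero.
End FreeSymAlgTheory.

(** * Homology of the Koszul complex *)

Section ModuleFacts.
Variables (k : fieldType) (n : nat) (A : gcAlg k n) (M : gmod A).

Lemma dualZ g (f : dual M) a x :
  homog (gm_gr (dual_gmod M)) g f -> f (a *: x) = twist g a * f x.
Proof.
move=> hf; rewrite -(dual_ract (f : dual_gmod M) a x) (ract_homog _ hf).
exact: dual_scaleE.
Qed.

Lemma parity_ract p (x : M) a :
  ract (parity_elt p x : parity_gmod p M) a = parity_elt p (ract x a).
Proof.
rewrite /ract (reindex_inj (addIr p)); apply: eq_bigr => h _ /=.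
rewrite /parity_gpr -addrA gamDD addr0.
by rewrite -[twist _ a *: _]/(twist p _ *: (_ : M)) twist_twist addrC -addrA gamDD addr0.
Qed.

Lemma dsum_ract (N N' : gmod A) (x : N) (y : N') a :
  ract ((x, y) : dsum_gmod N N') a = (ract x a, ract y a).
Proof.
rewrite /ract [LHS]surjective_pairing; congr (_, _).
  exact: (big_morph fst (fun _ _ => erefl) erefl).
exact: (big_morph snd (fun _ _ => erefl) erefl).
Qed.

End ModuleFacts.

Section KoszulBasis.
Variables (k : fieldType) (n : nat) (A : gcAlg k n).
Variables (r : 'I_(2 ^ n) -> nat) (M : gmod A) (p : Gam n) (e : std_basis r M).
Local Notation P := (dsum_gmod (parity_gmod p M) (dual_gmod M)).
Local Notation I := (bool * 'I_(total_rank r))%type.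
Implicit Types (c d : I) (x : P).

Definition kb_elt c : P :=
  if c.1 then (parity_elt p (e c.2), 0) else (0, dual_basis e c.2).
Definition kb_deg c : Gam n := if c.1 then std_ideg c.2 + p else std_ideg c.2.
(** A dual vector f is the sum of [f (e i)] times [dual_basis e i] with coefficients on the left;
    the twist turns them into right coordinates. *)
Definition kb_co c x : A :=
  if c.1 then Defs.coord e (x.1 : M) c.2 0 else twist (std_ideg c.2) ((x.2 : dual M) (e c.2)).

Fact kb_homog c : homog (gm_gr P) (kb_deg c) (kb_elt c).
Proof.
case: c => [[] i]; congr (_, _); try exact: gpr0.
  by rewrite /= /parity_gpr -addrA gamDD addr0; apply: sb_homog.
exact: homog_dual_basis.
Qed.
Fact kb_coD c : {morph kb_co c : x y / x + y}.
Proof.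
case: c => [[] i] x y; rewrite /kb_co /=; first exact: dual_basis_add.
by rewrite twistD.
Qed.
Fact kb_coZ c a x : kb_co c (a *: x) = twist (kb_deg c) a * kb_co c x.
Proof.
case: c => [[] i]; rewrite /kb_co /kb_deg /=.
  rewrite -[Defs.coord _ _ _ _]/(dual_basis e i (twist p a *: (x.1 : M))).
  by rewrite (dualZ _ _ (homog_dual_basis e i)) twist_twist.
by rewrite twistM.
Qed.
Fact kb_coR c x a : kb_co c (ract x a) = kb_co c x * a.
Proof.
case: x => x f; rewrite dsum_ract /kb_co /=; case: c => [[] i] /=.
  by rewrite (parity_ract p (x : M)) dual_basis_lin.
by rewrite dual_ract -{1}(twistK (std_ideg i) a) -(ract_homog _ (sb_homog e i))
           dual_lin twistM twistK.
Qed.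
Fact kb_coh c g x : homog (gm_gr P) g x -> homog (ga_gr A) (g + kb_deg c) (kb_co c x).
Proof.
case: x => x f [hx hf]; case: c => [[] i]; rewrite /kb_co /kb_deg /=.
  have := (dual_homogP _ (dual_basis e i)).1 (homog_dual_basis e i) _ _ hx.
  by rewrite -addrA [p + _]addrC.
by apply: homog_twist; rewrite addrC; apply: (dual_homogP _ f).1 hf _ _ (sb_homog e i).
Qed.
Fact kb_coE x : x = \sum_c ract (kb_elt c) (kb_co c x).
Proof.
rewrite -(pair_bigA _ (fun u i => ract (kb_elt (u, i)) (kb_co (u, i) x))) /=.
rewrite big_bool /= /kb_elt /kb_co /=; case: x => x f /=.
rewrite (eq_bigr (fun i => (parity_elt p (ract (e i) (Defs.coord e x i 0)), 0) : P));
  last by move=> i _; rewrite dsum_ract parity_ract ract0l.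
rewrite [X in _ + X](eq_bigr (fun i => (0, f (e i) *: dual_basis e i) : P));
  last first.
  move=> i _; rewrite dsum_ract ract0l (ract_homog _ (homog_dual_basis e i)).
  by rewrite twistK.
rewrite [RHS]surjective_pairing; congr (_, _).
  rewrite /= !(big_morph fst (fun _ _ => erefl) erefl) /= big1_eq addr0.
  exact: coordP.
rewrite /= !(big_morph snd (fun _ _ => erefl) erefl) /= big1_eq add0r.
apply: dualP => y; rewrite {1}(coordP e y) dual_sum dual_sumE.
by apply: eq_bigr => i _; rewrite dual_lin.
Qed.
Fact kb_co_delta c d : kb_co c (kb_elt d) = (c == d)%:R.
Proof.
case: c d => [[] i] [[] j]; rewrite /kb_co /kb_elt /= -?pair_eqE /=.
- exact: dual_basisE.
- by rewrite -[LHS]/(dual_basis e i 0) -(scale0r 0) (dualZ _ _ (homog_dual_basis e i)) twist0 mul0r.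
- by rewrite -[X in twist _ X]/(0 : A) twist0.
rewrite -[X in twist _ X]/(dual_basis e j (e i)) dual_basisE eq_sym; case: eqP => _; [exact: twist1|exact: twist0].
Qed.

Definition kbasis : gbasis P I :=
  GBasis kb_homog kb_coD kb_coZ kb_coR kb_coh kb_coE kb_co_delta.
End KoszulBasis.

Section KoszulHomology.
Variables (k : fieldType) (n : nat) (A : gcAlg k n).
Variables (r : 'I_(2 ^ n) -> nat) (M : gmod A) (p : Gam n) (e : std_basis r M).
Hypotheses (k_char0 : [pchar k] =i pred0) (n_gt0 : (0 < n)%N) (p_odd : godd p).
Local Notation P := (dsum_gmod (parity_gmod p M) (dual_gmod M)).
Local Notation I := (bool * 'I_(total_rank r))%type.
Local Notation S := (symalg P).
Local Notation b := (kbasis p e).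
Local Notation z := (letter b).
Local Notation dg := (gb_deg b).
Local Notation D := (partial b).
Local Notation K := (koszul_elt p e : S).

(** The index (true, i) stands for Pi e_i and (false, i) for eps^i. As [p] is odd, Pi e_i is odd
    exactly when e_i is even, that is for [i] below [even_rank]. *)
Definition odd_letter (i : 'I_(total_rank r)) : I := ((i < even_rank r)%N, i).
Definition even_letter (i : 'I_(total_rank r)) : I := (~~ (i < even_rank r)%N, i).
Definition is_odd_letter : pred I := fun c => c.1 == (c.2 < even_rank r)%N.
Definition odd_letters : seq I := map odd_letter (enum 'I_(total_rank r)).

Lemma godd_letter c : godd (dg c) = is_odd_letter c.
Proof.
case: c => [[] i]; rewrite /is_odd_letter /= /kb_deg /= ?godd_addp //;
  by rewrite (godd_std_ideg n_gt0 p_odd) //; case: (i < _)%N.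
Qed.

Lemma koszul_eltE : K = \sum_i z (true, i) * z (false, i).
Proof. by []. Qed.

Lemma letter_koszul c : z c * K = gsgn S (dg c) p * (K * z c).
Proof.
rewrite koszul_eltE mulr_sumr mulr_suml mulr_sumr; apply: eq_bigr => i _.
rewrite mulrA letterC -!mulrA letterC.
have -> : dg (true, i) = std_ideg i + p by [].
have -> : dg (false, i) = std_ideg i by [].
by rewrite gsgnDr; sign_cases.
Qed.

(** [K] has the odd degree [p] and so anticommutes with itself; twice its square is 0. *)
Lemma koszul_elt_sq : K * K = 0.
Proof.
apply: (symalg_mulrn_eq0 k_char0 (m := 2)) => //; rewrite mulr2n.
suff {1}-> : K * K = - (K * K) by rewrite addNr.
transitivity (\sum_i z (true, i) * z (false, i) * K); first by rewrite -mulr_suml.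
transitivity (\sum_i - (K * (z (true, i) * z (false, i))));
  last by rewrite sumrN -mulr_sumr.
apply: eq_bigr => i _.
  rewrite -mulrA letter_koszul [z (true, i) * _]mulrA -gsgn_comm.
  rewrite -[_ * z (true, i) * _]mulrA [z (true, i) * _]mulrA letter_koszul.
  have -> : dg (true, i) = std_ideg i + p by [].
  have -> : dg (false, i) = std_ideg i by [].
  by rewrite gsgnDl (gsgnxx S p) p_odd expr1 -!mulrA; sign_cases.
Qed.

(** Leibniz rule for [K], whose derivative in Pi e_i is eps^i, and in eps^i is Pi e_i up to the sign
    of passing the derivative across that letter. *)
Lemma partial_koszul c x : D c (K * x) =
  (if c.1 then z (false, c.2) * x else gsgn S (dg c) (std_ideg c.2 + p) * (z (true, c.2) * x))
   + gsgn S (dg c) p * (K * D c x).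
Proof.
have DS (F : 'I_(total_rank r) -> S) : D c (\sum_i F i) = \sum_i D c (F i).
  exact: (big_morph (D c) (partialD b c) (partial0 b c)).
pose sg (i : 'I_(total_rank r)) := gsgn S (dg c) (std_ideg i + p).
transitivity (\sum_i (((true, i) == c)%:R * (z (false, i) * x)
    + sg i * (z (true, i) * (((false, i) == c)%:R * x)))
    + gsgn S (dg c) p * (K * D c x)).
  rewrite koszul_eltE !mulr_suml mulr_sumr -big_split DS; apply: eq_bigr => i _ /=.
  rewrite -mulrA !partialL mulrDr mulrDr addrA; congr (_ + _).
  have -> : dg (true, i) = std_ideg i + p by [].
  have -> : dg (false, i) = std_ideg i by [].
  by rewrite gsgnDr -!mulrA; sign_cases.
congr (_ + _); rewrite (bigD1 c.2) //= big1 ?addr0 => [|i /negPf ic].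
  case: c @sg {DS} => [[] i] /=; rewrite ?eqxx -?pair_eqE /= ?eqxx ?mul1r ?mul0r ?mulr0 ?addr0 ?add0r //.
by case: c ic @sg {DS} => u j /= ij; rewrite -?pair_eqE /= ij !andbF !mul0r !mulr0 addr0.
Qed.

Definition homotopy x : S := \sum_i D (false, i) (D (true, i) x).
Definition laplace x : S := homotopy (K * x) + K * homotopy x.

Lemma homotopyD : {morph homotopy : x y / x + y}.
Proof.
by move=> x y; rewrite -big_split; apply: eq_bigr => i _; rewrite !partialD.
Qed.
Lemma homotopy_ssc x a : homotopy (x * ssc P a) = homotopy x * ssc P a.
Proof. by rewrite mulr_suml; apply: eq_bigr => i _; rewrite !partial_ssc. Qed.
Lemma laplaceD : {morph laplace : x y / x + y}.
Proof. by move=> x y; rewrite /laplace mulrDr !homotopyD mulrDr addrACA. Qed.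
Lemma laplace_ssc x a : laplace (x * ssc P a) = laplace x * ssc P a.
Proof. by rewrite /laplace mulrA !homotopy_ssc mulrDl !mulrA. Qed.
Lemma laplace0 : laplace 0 = 0.
Proof. by apply: (addrI (laplace 0)); rewrite -laplaceD !addr0. Qed.

(** Applying [partial_koszul] twice gives a term in [K] with the sign of [p] against itself, -1,
    which cancels [K * homotopy x]. The Euler operators of both letters remain, each with the sign
    of the letter's own parity. *)
Lemma laplaceE x :
  laplace x = \sum_i (x + z (even_letter i) * D (even_letter i) x
                        - z (odd_letter i) * D (odd_letter i) x).
Proof.
rewrite /laplace /homotopy mulr_sumr -big_split; apply: eq_bigr => i _ /=.
rewrite partial_koszul partialD /= partialL eqxx mul1r.
have sD m y : D (false, i) (gsgn S (dg (true, i)) m * y)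
   = gsgn S (dg (true, i)) m * D (false, i) y by rewrite gsgn_signr partial_sgn.
rewrite sD partial_koszul /= /kb_deg /= -!addrA; congr (_ + _).
have := godd_std_ideg n_gt0 p_odd i; rewrite /odd_letter /even_letter.
rewrite !gsgnDl !gsgnDr !gsgnxx p_odd => ->.
case: (i < even_rank r)%N => /=; rewrite gsgn_signr;
  move: (z (false, i) * _) (z (true, i) * _) (K * _) => u v w;
  case: (gpair _ _ == 1);
  rewrite !(expr0, expr1, mul1r, mulr1, mulN1r, mulrN1, mulNr, mulrN, opprK, opprD)
          -addrA ?addNr ?addrN addr0 //; exact: addrC.
Qed.

Lemma count_odd_le1 i s : word b s <> 0 -> (count_mem (odd_letter i) s <= 1)%N.
Proof.
move=> s0; rewrite leqNgt; apply/negP => h; apply/s0/(word_odd_rep k_char0 _ h).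
by rewrite godd_letter /is_odd_letter eqxx.
Qed.

Definition weight (s : seq I) : nat :=
  \sum_i (1 + count_mem (even_letter i) s - count_mem (odd_letter i) s)%N.

(* The truncated subtraction in [weight] is exact on nonzero words, where an odd
   letter occurs at most once. *)
Lemma laplace_word s a :
  laplace (word b s * ssc P a) = (word b s * ssc P a) *+ weight s.
Proof.
have [->|/eqP s0] := eqVneq (word b s) 0; first by rewrite mul0r laplace0 mul0rn.
rewrite laplaceE -sumrMnr; apply: eq_bigr => i _; rewrite !letter_partial.
rewrite mulrnBr ?mulrnDr //.
by apply: leq_trans (count_odd_le1 i s0) _; rewrite addSn.
Qed.

Definition top_form : S := word b odd_letters.

Lemma count_odd_letters c : count_mem c odd_letters = is_odd_letter c.
Proof.
rewrite count_uniq_mem; last first.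
  by rewrite map_inj_uniq ?enum_uniq // => i j [].
congr nat_of_bool; apply/mapP/idP => [[i _ ->]|/eqP oc].
  by rewrite /is_odd_letter eqxx.
by exists c.2; rewrite ?mem_enum // /odd_letter -oc; case: c {oc}.
Qed.

(** Weight 0 forces 1 plus the count of each even letter to be at most the count of its odd partner,
    hence at most 1. So [s] is a permutation of [odd_letters], and the sign goes into [a']. *)
Lemma weight0_top s a : word b s <> 0 -> weight s = 0%N ->
  exists a', word b s * ssc P a = top_form * ssc P a'.
Proof.
move=> s0 /eqP; rewrite sum_nat_eq0 => /forallP ws.
have cs c : count_mem c s = is_odd_letter c.
  have := count_odd_le1 c.2 s0; have := ws c.2; rewrite /= subn_eq0 addSn add0n.
  move=> lt1 le1; have oc := leq_trans lt1 le1; move: oc; rewrite ltnS leqn0 => ec.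
  rewrite (eqP ec) in lt1.
  have [->|] : c = odd_letter c.2 \/ c = even_letter c.2.
    by case: c {ws lt1 le1 ec} => u i; rewrite /odd_letter /even_letter /=;
       case: u (i < _)%N => [] []; auto.
    by apply/eqP; rewrite /is_odd_letter eqxx eqn_leq le1.
  by move=> ->; rewrite (eqP ec) /is_odd_letter /=; case: (_ < _)%N.
have [m ->] : exists m : bool, word b s = (-1) ^+ m * top_form.
  by apply: word_perm; apply/allP => c _ /=; rewrite count_odd_letters cs.
exists ((-1) ^+ m * a); case: m; rewrite ?expr0 ?mul1r // expr1 !mulN1r.
by rewrite (rmN (ssc_rmorph P)) mulNr mulrN.
Qed.

(** The summand [f j] has eigenvalue [j]. The sum is required to be [x] for every length from [N]
    on, so that two decompositions can be added after taking the larger bound. *)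
Lemma eigen_decomposition x : exists a N (f : nat -> S),
  [/\ f 0%N = top_form * ssc P a, forall j, laplace (f j) = f j *+ j
    & forall m, (N <= m)%N -> x = \sum_(j < m) f j].
Proof.
elim/(word_ind (b := b)): x => [|x y [a [N [f [f0 fL fE]]]] [c [N' [g [g0 gL gE]]]]|s a].
- exists 0, 0%N, (fun=> 0); split=> [|j|m _]; last by rewrite big1.
    by rewrite ssc0 mulr0.
  by rewrite laplace0 mul0rn.
- exists (a + c), (maxn N N'), (fun j => f j + g j); split=> [|j|m].
  + by rewrite f0 g0 sscD mulrDr.
  + by rewrite laplaceD fL gL mulrnDl.
  rewrite geq_max => /andP[mN mN'].
  by rewrite big_split /= -(fE m) // -(gE m).
have [->|/eqP s0] := eqVneq (word b s) 0.
  exists 0, 0%N, (fun=> 0); split=> [|j|m _]; last by rewrite big1 // mul0r.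
    by rewrite ssc0 mulr0.
  by rewrite laplace0 mul0rn.
(* A nonzero word sits in the single slot [weight s]; slot 0 is occupied only by multiples of
   [top_form]. *)
have [a' Ea] : exists a', (if 0%N == weight s then word b s * ssc P a else 0) = top_form * ssc P a'.
  case: eqP => [/esym ws|_]; first exact: weight0_top.
  by exists 0; rewrite ssc0 mulr0.
exists a', (weight s).+1, (fun j => if j == weight s then word b s * ssc P a else 0).
split=> // [j|m hm].
  by case: eqP => [->|_]; rewrite ?laplace_word // laplace0 mul0rn.
by rewrite -big_mkcond /= (big_pred1 (Ordinal hm)).
Qed.

(* A cycle x is homologous to x - L(x)/N, with L = [laplace]; if the eigenvalues of
   L on x are at most N, this removes the component of eigenvalue N. *)
Lemma cycle_reduction N (f : nat -> S) x : K * x = 0 ->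
  (forall j, laplace (f j) = f j *+ j) -> x = \sum_(j < N.+1) f j ->
  exists y, x = f 0%N + K * y.
Proof.
elim: N f x => [|N IHN] f x Kx fL xE.
  by exists 0; rewrite mulr0 addr0 xE big_ord1.
have [c _ Nc] := nat_inv_exists A k_char0 (ltn0Sn N).
have Lx : laplace x = K * homotopy x.
  rewrite /laplace Kx; have -> : homotopy 0 = 0; last by rewrite add0r.
  by apply: (addrI (homotopy 0)); rewrite -homotopyD !addr0.
pose T (u : S) := u - laplace u * ssc P c.
have TD : {morph T : u v / u + v}.
  by move=> u v; rewrite /T laplaceD mulrDl opprD addrACA.
have T0 : T 0 = 0 by rewrite /T laplace0 mul0r subrr.
have lN u : laplace (- u) = - laplace u.
  by apply/eqP; rewrite -addr_eq0 -laplaceD addNr laplace0.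
have lMn u m : laplace (u *+ m) = laplace u *+ m.
  by elim: m => [|m IHm]; rewrite ?laplace0 // !mulrS laplaceD IHm.
have [|||y Ty] := IHN (T \o f) (T x).
- by rewrite mulrBr Kx Lx !mulrA koszul_elt_sq !mul0r subrr.
(* [T] multiplies [f j] by 1 - j/(N+1), so the eigenvalues stay the same. *)
- move=> j /=; rewrite /T laplaceD lN laplace_ssc !fL lMn fL mulrnBl.
  by rewrite !mulrnAl.
- rewrite xE (big_morph T TD T0) big_ord_recr /=.
  suff -> : T (f N.+1) = 0 by rewrite addr0.
  rewrite /T fL -mulr_natr -mulrA.
  have -> : (N.+1)%:R = ssc P (N.+1)%:R.
    by elim: (N.+1) => [|j IHj]; rewrite ?ssc0 // -addn1 !natrD sscD IHj ssc1.
  by rewrite -sscM Nc ssc1 mulr1 subrr.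
exists (y + homotopy x * ssc P c).
(* The part removed by [T] is put back as a boundary; [f 0] was not changed, its eigenvalue being
   0. *)
rewrite -[x in LHS](subrK (laplace x * ssc P c)) -/(T x) Ty /= {1}/T fL mulr0n mul0r subr0.
by rewrite Lx mulrDr addrA mulrA.
Qed.

Lemma cycle_top x : K * x = 0 -> exists a y, x = top_form * ssc P a + K * y.
Proof.
move=> Kx; have [a [N [f [f0 fL fE]]]] := eigen_decomposition x.
(* The length [N.+1] guarantees that slot 0 is present even when [N] is 0. *)
have [y ->] := cycle_reduction Kx fL (fE N.+1 (leqnSn N)).
by exists a, y; rewrite f0.
Qed.

(** Each term of [K] contains an odd letter, which [top_form] contains already. *)
Lemma koszul_top : K * top_form = 0.
Proof.
rewrite koszul_eltE mulr_suml big1 // => i _.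
rewrite -mulrA -!word_cons (word_odd_rep k_char0 (c := odd_letter i)) //.
  by rewrite godd_letter /is_odd_letter eqxx.
rewrite /= count_odd_letters /is_odd_letter eqxx /odd_letter addnA addn1 ltnS.
by case: (i < even_rank r)%N; rewrite eqxx ?addn1.
Qed.

(* The coefficient of [top_form] once the even letters are set to 0. *)
Definition top_coef x : A := berint b odd_letters (restrict b is_odd_letter x).

Lemma top_coefD : {morph top_coef : x y / x + y}.
Proof. by move=> x y; rewrite /top_coef (rmD (restrict_rmorph _ _)) berintD. Qed.

(** Each term of [K] also contains an even letter, so restriction to the odd letters sends [K] to
    0. *)
Lemma top_coef_koszul y : top_coef (K * y) = 0.
Proof.
have rR := restrict_rmorph b is_odd_letter.
have b0 : berint b odd_letters 0 = 0.
  by apply: (addrI (berint b odd_letters 0)); rewrite -berintD !addr0.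
rewrite /top_coef (rmM rR) koszul_eltE (rm_sum rR) big1 ?mul0r // => i _.
rewrite (rmM rR) !restrict_letter /is_odd_letter /=.
by case: (i < _)%N; rewrite /= ?mulr0 ?mul0r.
Qed.

Lemma restrict_top : restrict b is_odd_letter top_form = top_form.
Proof.
rewrite /top_form /word (rm_prod (restrict_rmorph _ _)) !big_map.
by apply: eq_bigr => i _; rewrite restrict_letter /is_odd_letter eqxx.
Qed.

Lemma top_coef_restrict x a :
  restrict b is_odd_letter x = top_form * ssc P a -> top_coef x = a.
Proof.
rewrite /top_coef => ->; apply: berint_word.
by rewrite map_inj_uniq ?enum_uniq // => i j [].
Qed.

Lemma top_coef_top a : top_coef (top_form * ssc P a) = a.
Proof.
apply: top_coef_restrict.
by rewrite (rmM (restrict_rmorph _ _)) restrict_top restrict_ssc.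
Qed.

End KoszulHomology.

(** * Change of basis *)

Section BasisChange.
Variables (k : fieldType) (n : nat) (A : gcAlg k n).
Variables (r : 'I_(2 ^ n) -> nat) (M : gmod A).
Implicit Types (e : std_basis r M) (X Y : 'M[A]_(total_rank r)).

Definition basis_mx e e' : 'M[A]_(total_rank r) :=
  \matrix_(j, i) Defs.coord e (e' i) j 0.

Lemma basis_change_mx e e' : basis_change e e' (basis_mx e e').
Proof.
move=> i; rewrite {1}(coordP e (e' i)); apply: eq_bigr => j _.
by rewrite mxE.
Qed.

Lemma basis_changeP e e' X : basis_change e e' X -> basis_mx e e' = X.
Proof. by move=> eX; apply/matrixP => j i; rewrite mxE (coord_uniq (eX i)). Qed.

Lemma basis_mx_trans e e' e'' : basis_mx e e'' = basis_mx e e' *m basis_mx e' e''.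
Proof.
apply: basis_changeP => i; rewrite (basis_change_mx e' e'' i).
rewrite (eq_bigr (fun l => \sum_j ract (e j) (basis_mx e e' j l * basis_mx e' e'' l i))).
  rewrite exchange_big; apply: eq_bigr => j _; rewrite mxE.
  by rewrite (big_morph _ (ractDr (e j)) (ract0r (e j))).
by move=> l _; rewrite (basis_change_mx e e' l) ract_suml; apply: eq_bigr => j _; rewrite ractA.
Qed.

Lemma basis_mx1 e : basis_mx e e = 1%:M.
Proof. by apply/matrixP => j i; rewrite !mxE -(dual_basisE e). Qed.

Lemma basis_mxV e e' : basis_mx e e' *m basis_mx e' e = 1%:M.
Proof. by rewrite -basis_mx_trans basis_mx1. Qed.

Lemma basis_mx_deg0 e e' : deg0_mx (basis_mx e e').
Proof.
move=> i j; rewrite mxE addrC.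
exact: (dual_homogP _ (dual_basis e i)).1 (homog_dual_basis e i) _ _ (sb_homog e' j).
Qed.

Lemma basis_mx_GL0 e e' : inGL0 (basis_mx e e').
Proof.
split; first exact: basis_mx_deg0.
by exists (basis_mx e' e); rewrite !basis_mxV; split=> //; apply: basis_mx_deg0.
Qed.

Lemma basis_mx_inj e e1 e2 : basis_mx e e1 = basis_mx e e2 -> e1 = e2.
Proof.
move=> E; have {E} : sb_elt e1 = sb_elt e2.
  by apply/funext => i; rewrite (basis_change_mx e e1) (basis_change_mx e e2) E.
case: e1 e2 => [f fh fb] [g gh gb] /= fg; case: _ / fg in gh gb *.
by congr StdBasis; apply: Prop_irrelevance.
Qed.

Lemma basis_of_GL0 e X : inGL0 X -> exists e', basis_mx e e' = X.
Proof.
case=> dX [Y [dY XY YX]].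
pose f i := \sum_j ract (e j) (X j i).
have fh i : homog (gm_gr M) (std_ideg i) (f i).
  rewrite /homog gpr_bigsum; apply: eq_bigr => j _.
  have := homog_ract (sb_homog e j) (dX j i).
  by rewrite addrA gamDD add0r.
have fE (c : 'cV[A]_(total_rank r)) :
    \sum_i ract (f i) (c i 0) = \sum_j ract (e j) ((X *m c) j 0).
  rewrite (eq_bigr (fun i => \sum_j ract (e j) (X j i * c i 0))); last first.
    by move=> i _; rewrite ract_suml; apply: eq_bigr => j _; rewrite ractA.
  rewrite exchange_big; apply: eq_bigr => j _; rewrite mxE.
  by rewrite (big_morph _ (ractDr (e j)) (ract0r (e j))).
have fb x : exists! c : 'cV[A]_(total_rank r), x = \sum_i ract (f i) (c i 0).
  exists (Y *m Defs.coord e x); split=> [|c].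
    by rewrite fE mulmxA XY mul1mx -coordP.
  rewrite fE => /coord_uniq xc; rewrite -[c]mul1mx -YX -mulmxA; congr (Y *m _).
  by apply/colP => j; apply: xc.
by exists (StdBasis fh fb); apply: basis_changeP.
Qed.

Variable p : Gam n.
Local Notation P := (dsum_gmod (parity_gmod p M) (dual_gmod M)).
Local Notation S := (symalg P).
Local Notation kb e := (kbasis p e).

Lemma letter_true_change e e' i : letter (kb e') (true, i) =
  \sum_j letter (kb e) (true, j) * ssc P (basis_mx e e' j i).
Proof.
rewrite /letter /= /kb_elt /= {1}(basis_change_mx e e' i).
rewrite (eq_bigr (fun j => sgen ((parity_elt p (ract (e j) (basis_mx e e' j i)), 0) : P))).
  rewrite -sgen_sum; congr sgen; rewrite [RHS]surjective_pairing; congr (_, _).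
    by rewrite (big_morph fst (fun _ _ => erefl) erefl).
  by rewrite (big_morph snd (fun _ _ => erefl) erefl) /= big1_eq.
by move=> j _; rewrite -sgen_ract dsum_ract parity_ract ract0l.
Qed.

(** The dual basis transforms by the inverse matrix: evaluate eps'^i on a vector expanded in the
    basis [e]. *)
Lemma letter_false_change e e' i : letter (kb e') (false, i) =
  \sum_j ssc P (basis_mx e' e i j) * letter (kb e) (false, j).
Proof.
rewrite /letter /= /kb_elt /=.
have -> : dual_basis e' i = \sum_j basis_mx e' e i j *: dual_basis e j.
  apply: dualP => x; rewrite {1}(coordP e x) dual_sum dual_sumE.
  by apply: eq_bigr => j _; rewrite dual_lin mxE.
under eq_bigr do rewrite -sgenZ.
rewrite -sgen_sum; congr sgen; rewrite [RHS]surjective_pairing; congr (_, _).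
  by rewrite (big_morph fst (fun _ _ => erefl) erefl) /= big1 // => j _; rewrite scaler0.
by rewrite (big_morph snd (fun _ _ => erefl) erefl).
Qed.

(** The coefficients of Pi e'_i stand on its right, next to eps'^i; moved to that factor, they
    reassemble the dual basis of [e]. *)
Lemma koszul_elt_indep e e' : koszul_elt p e' = koszul_elt p e.
Proof.
rewrite !koszul_eltE.
under eq_bigr do rewrite (letter_true_change e) mulr_suml.
rewrite exchange_big; apply: eq_bigr => j _ /=.
rewrite (letter_false_change e' e j) mulr_sumr; apply: eq_bigr => i _.
by rewrite mulrA.
Qed.

(** Letters of the same index have the same degree for both bases, so the letters of [e'] satisfy
    all relations required of images. *)
Lemma transport_exists e e' : exists F : S -> S,
  [/\ is_rmorph F, forall a, F (ssc P a) = ssc P a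
    & forall c, F (letter (kb e) c) = letter (kb e') c].
Proof.
apply: free_universal; first exact: ssc_rmorph.
  exact: letterC (kb e').
by move=> c a; apply: ssc_letter (kb e') a c.
Qed.

Hypotheses (k_char0 : [pchar k] =i pred0) (n_gt0 : (0 < n)%N) (p_odd : godd p).

(** The function Phi of the overview, attached to a pair of bases; [ber_coef_mx] shows that it
    depends only on their transition matrix. *)
Definition ber_coef e e' : A := top_coef e (top_form p e').

(** As [K] is independent of the basis, [top_form p e'] is a cycle also for the differential written
    in [e]; [cycle_top] applies and [top_coef] identifies the coefficient. *)
Lemma top_change e e' :
  exists y, top_form p e' = top_form p e * ssc P (ber_coef e e') + koszul_elt p e * y.
Proof.
have [a [y E]] : exists a y, top_form p e' = top_form p e * ssc P a + koszul_elt p e * y.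
  by apply: cycle_top => //; rewrite -(koszul_elt_indep e e') koszul_top.
exists y; suff -> : ber_coef e e' = a by [].
by rewrite /ber_coef E top_coefD top_coef_top top_coef_koszul addr0.
Qed.

Lemma ber_coef_eq e e' a y :
  top_form p e' = top_form p e * ssc P a + koszul_elt p e * y -> ber_coef e e' = a.
Proof. by move=> E; rewrite /ber_coef E top_coefD top_coef_top top_coef_koszul addr0. Qed.

Lemma ber_coef1 e : ber_coef e e = 1.
Proof. by apply: (@ber_coef_eq _ _ _ 0); rewrite ssc1 mulr1 mulr0 addr0. Qed.

Lemma ber_coef_trans e e' e'' : ber_coef e e'' = ber_coef e e' * ber_coef e' e''.
Proof.
have [y1 E1] := top_change e e'; have [y2 E2] := top_change e' e''.
apply: (@ber_coef_eq _ _ _ (y1 * ssc P (ber_coef e' e'') + y2)).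
by rewrite E2 (koszul_elt_indep e e') {1}E1 mulrDl -!mulrA -sscM -addrA -mulrDr.
Qed.

(* The endomorphism of the complex carrying e1 to e1' carries e2 to e2'. *)
Lemma ber_coef_mx e1 e2 e1' e2' :
  basis_mx e1 e2 = basis_mx e1' e2' -> ber_coef e1 e2 = ber_coef e1' e2'.
Proof.
move=> E; have [F [FR Fa Fl]] := transport_exists e1 e1'.
have E' : basis_mx e2 e1 = basis_mx e2' e1'.
  rewrite -[LHS]mulmx1 -(basis_mxV e1' e2') -E mulmxA basis_mxV mul1mx //.
have Fl2 c : F (letter (kb e2) c) = letter (kb e2') c.
  case: c => [[] i].
    rewrite (letter_true_change e1) (letter_true_change e1') (rm_sum FR).
    by apply: eq_bigr => j _; rewrite (rmM FR) Fl Fa E.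
  rewrite (letter_false_change e1) (letter_false_change e1') (rm_sum FR).
  by apply: eq_bigr => j _; rewrite (rmM FR) Fl Fa E'.
have Ft e e' : (forall c, F (letter (kb e) c) = letter (kb e') c) ->
    F (top_form p e) = top_form p e'.
  by move=> Fe; rewrite /top_form /word (rm_prod FR); apply: eq_bigr => c _.
have [y Ey] := top_change e1 e2; apply/esym/(@ber_coef_eq _ _ _ (F y)).
rewrite -(Ft _ _ Fl2) Ey (rmD FR) !(rmM FR) Fa (Ft _ _ Fl); congr (_ + _ * _).
rewrite !koszul_eltE (rm_sum FR); apply: eq_bigr => i _.
by rewrite (rmM FR) !Fl.
Qed.

Lemma homog_top e : homog (s_gr P) (wdeg (kb e) (odd_letters r)) (top_form p e).
Proof. exact: homog_word. Qed.

(** Both top forms have the same degree. The component of [top_change] in that degree has the same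
    shape, with the degree 0 part of the coefficient, and the coefficient is unique. *)
Lemma homog_ber_coef e e' : homog (ga_gr A) 0 (ber_coef e e').
Proof.
have [y E] := top_change e e'.
pose g := wdeg (kb e) (odd_letters r); pose a := ber_coef e e'.
suff aE : a = ga_gr A 0 a by rewrite -/a aE; apply: homog_gpr.
apply: (@ber_coef_eq _ _ _ (s_gr P (g - p) y)).
have {1}<- : s_gr P g (top_form p e') = top_form p e' by apply: homog_top.
rewrite E gprD; congr (_ + _).
  rewrite -(symalg_ractE (P := P)) gpr_ract (bigD1 g) //= big1 ?addr0 => [|h hg].
    have {2}<- : s_gr P g (top_form p e) = top_form p e by apply: homog_top.
    by rewrite -(symalg_ractE (P := P)) subrr.
  rewrite [X in ract X _](homogE (G := s_gr P) h (homog_top e)).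
  by rewrite (negPf hg) ract0l.
have := glin_gpr (koszul_d p e) (g - p) y.
by rewrite subrK => <-.
Qed.
End BasisChange.

(** * Determinants and block matrices *)

Section DegreeZero.
Variables (k : fieldType) (n : nat) (A : gcAlg k n).

Definition deg0_pred : {pred A} := fun a => ga_gr A 0 a == a.

Fact deg0_subring : subring_closed deg0_pred.
Proof.
split; first by apply/eqP; apply: ga_one.
  by move=> x y /eqP hx /eqP hy; apply/eqP; rewrite gprB hx hy.
move=> x y /eqP hx /eqP hy; apply/eqP.
by rewrite -[X in ga_gr A X](addr0 0); apply: ga_mul.
Qed.
HB.instance Definition _ := GRing.isSubringClosed.Build A deg0_pred deg0_subring.

(* A is only graded commutative; its part of degree 0 is a commutative ring, to
   which the library theory of determinants applies. *)
Record deg0 := Deg0 { deg0_val :> A; deg0_valP : deg0_val \in deg0_pred }.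
HB.instance Definition _ := [isSub for deg0_val].
HB.instance Definition _ := [Choice of deg0 by <:].
HB.instance Definition _ := [SubChoice_isSubNzRing of deg0 by <:].

Fact deg0_mulC : commutative (@GRing.mul deg0).
Proof.
by move=> x y; apply: val_inj; apply: homog0_central; apply/eqP/deg0_valP.
Qed.
HB.instance Definition _ := GRing.PzSemiRing_hasCommutativeMul.Build deg0 deg0_mulC.

Definition deg0_entries m (X : 'M[A]_m) : Prop := forall i j, homog (ga_gr A) 0 (X i j).

Lemma deg0_lift m (X : 'M[A]_m) : deg0_entries X ->
  exists X' : 'M[deg0]_m, X = map_mx val X'.
Proof.
move=> hX; exists (\matrix_(i, j) Deg0 (introT eqP (hX i j) : X i j \in deg0_pred)).
by apply/matrixP => i j; rewrite !mxE.
Qed.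

Lemma det_mul_deg0 m (X Y : 'M[A]_m) : deg0_entries X -> deg0_entries Y ->
  \det (X *m Y) = \det X * \det Y.
Proof.
move=> /deg0_lift[X' ->] /deg0_lift[Y' ->].
by rewrite -map_mxM !det_map_mx det_mulmx rmorphM.
Qed.

Lemma det_tr_deg0 m (X : 'M[A]_m) : deg0_entries X -> \det X^T = \det X.
Proof.
by move=> /deg0_lift[X' ->]; rewrite matrix.map_trmx !det_map_mx det_tr.
Qed.

Lemma homog_det m (X : 'M[A]_m) : deg0_entries X -> homog (ga_gr A) 0 (\det X).
Proof.
by move=> /deg0_lift[X' ->]; rewrite det_map_mx; apply/eqP/deg0_valP.
Qed.

Lemma det1_deg0 m : \det (1%:M : 'M[A]_m) = 1.
Proof. by rewrite -(map_mx1 (val : {rmorphism deg0 -> A})) det_map_mx det1 rmorph1. Qed.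

End DegreeZero.

(** * Ordered products of anticommuting elements and determinants *)

Section Anticommuting.
Variables (R : pzRingType) (m : nat) (Z : 'I_m -> R).

Lemma mem_split2 (T : eqType) (s : seq T) x y : x != y -> x \in s -> y \in s ->
  exists u v w, s = u ++ x :: v ++ y :: w \/ s = u ++ y :: v ++ x :: w.
Proof.
move=> xy xs ys; case/splitPr: xs ys => u w.
rewrite mem_cat inE eq_sym (negPf xy) /= => /orP[] /splitPr[u' w'].
  by exists u', w', w; right; rewrite -catA.
by exists u, u', w'; left.
Qed.

Hypothesis ZC : forall i j, Z i * Z j = - (Z j * Z i).

Lemma anticomm_move i (s : seq 'I_m) :
  Z i * \prod_(j <- s) Z j = (-1) ^+ size s * (\prod_(j <- s) Z j * Z i).
Proof.
elim: s => [|j s IHs]; first by rewrite !big_nil mulr1 !mul1r.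
rewrite !big_cons mulrA ZC mulNr -mulrA IHs exprS mulN1r mulNr !mulrA.
by rewrite commr_sign.
Qed.

(** Moving either end across the middle costs the same sign, so only the -1 of the final exchange
    remains. *)
Lemma anticomm_swap i j (s : seq 'I_m) :
  Z i * (\prod_(l <- s) Z l * Z j) = - (Z j * (\prod_(l <- s) Z l * Z i)).
Proof. by rewrite !mulrA !anticomm_move -!mulrA ZC !mulrN. Qed.

End Anticommuting.

Section AnticommutingProducts.
Variables (R : pzRingType) (m : nat).

Lemma anticomm_tperm (Z : 'I_m -> R) x y : (forall i j, Z i * Z j = - (Z j * Z i)) ->
  x != y -> \prod_i Z (tperm x y i) = - \prod_i Z i.
Proof.
move=> ZC xy.
have key (u v w : seq 'I_m) a c : uniq (u ++ a :: v ++ c :: w) ->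
    \prod_(i <- u ++ a :: v ++ c :: w) Z (tperm a c i)
    = - \prod_(i <- u ++ a :: v ++ c :: w) Z i.
  have pE : perm_eq (u ++ a :: v ++ c :: w) (a :: c :: u ++ v ++ w).
    by apply/seq.permP => q; rewrite /= !count_cat /= count_cat /= addnCA; congr addn; rewrite [LHS]addnA [LHS]addnCA -addnA.
  rewrite (perm_uniq pE) /= !inE negb_or => /and3P[/andP[ac ai] ci _].
  have tE (s : seq 'I_m) : a \notin s -> c \notin s ->
      \prod_(i <- s) Z (tperm a c i) = \prod_(i <- s) Z i.
    move=> xs ys; apply: eq_big_seq => i si; rewrite tpermD //.
      by apply: contraNneq xs => ->.
    by apply: contraNneq ys => ->.
  move: ai ci; rewrite !mem_cat !negb_or => /and3P[au av aw] /and3P[cu cv cw].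
  rewrite !(big_cat, big_cons) /= tpermL tpermR !tE //.
  transitivity (\prod_(j <- u) Z j
      * ((Z c * (\prod_(j <- v) Z j * Z a)) * \prod_(j <- w) Z j)).
    by rewrite -!mulrA.
  by rewrite anticomm_swap // mulNr mulrN -!mulrA.
have := mem_split2 xy (mem_index_enum x) (mem_index_enum y).
have := index_enum_uniq 'I_m; move: (index_enum _) => s us [u [v [w [E|E]]]].
  by rewrite E key // -E.
by rewrite tpermC E key // -E.
Qed.

Lemma anticomm_perm (Z : 'I_m -> R) (s : 'S_m) : (forall i j, Z i * Z j = - (Z j * Z i)) ->
  \prod_i Z (s i) = (-1) ^+ s * \prod_i Z i.
Proof.
move=> ZC; have [ts -> {s}] := prod_tpermP s.
elim: ts Z ZC => [|[x y] ts IHts] Z ZC /=.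
  by rewrite big_nil odd_perm1 mul1r => _; apply: eq_bigr => i _; rewrite perm1.
case/andP=> xy dts; rewrite big_cons odd_permM odd_tperm xy signr_addb expr1.
under eq_bigr do rewrite permM.
set t := (\prod_(_ <- _) _)%g.
rewrite (anticomm_tperm (Z := fun i => Z (t i))) // IHts //.
by rewrite mulN1r mulNr.
Qed.

Lemma anticomm_rep (Z : 'I_m -> R) (f : 'I_m -> 'I_m) :
  (forall i j, Z i * Z j = - (Z j * Z i)) -> (forall i, Z i * Z i = 0) ->
  ~~ injectiveb f -> \prod_i Z (f i) = 0.
Proof.
move=> ZC Z0 /injectivePn[x [y xy fxy]].
have W u v w a c : f a = f c -> \prod_(i <- u ++ a :: v ++ c :: w) Z (f i) = 0.
  move=> fac; rewrite big_cat big_cons big_cat big_cons /=.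
  rewrite [Z (f a) * _]mulrA (anticomm_move (Z := fun i => Z (f i))) //.
  rewrite -!mulrA [Z (f a) * (Z _ * _)]mulrA fac Z0.
  by rewrite !(mul0r, mulr0).
have := mem_split2 xy (mem_index_enum x) (mem_index_enum y).
by move: (index_enum _) => s [u [v [w [->|->]]]]; apply: W.
Qed.

(** Expand over all functions choosing a summand in each factor: the non-injective ones vanish, and
    permutations give the Leibniz formula. *)
Lemma anticomm_det (Z : 'I_m -> R) (c : 'M[R]_m) :
    (forall i j, Z i * Z j = - (Z j * Z i)) -> (forall i, Z i * Z i = 0) ->
    (forall i j x, c i j * x = x * c i j) ->
  \prod_i \sum_j Z j * c i j = (\prod_i Z i) * \det c.
Proof.
move=> ZC Z0 cC; rewrite bigA_distr_bigA.
have cP (f : 'I_m -> 'I_m) (s : seq 'I_m) : \prod_(i <- s) (Z (f i) * c i (f i))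
    = (\prod_(i <- s) Z (f i)) * \prod_(i <- s) c i (f i).
  elim: s => [|i s IHs]; first by rewrite !big_nil mulr1.
  by rewrite !big_cons IHs -!mulrA; congr (_ * _); rewrite mulrA cC -mulrA.
rewrite (bigID (fun f : {ffun 'I_m -> 'I_m} => injectiveb f)) /= addrC big1 ?add0r => [|f nf].
  rewrite (reindex (@pval _)) /=; last first.
    pose in_Sn := insubd (1%g : 'S_m).
    by exists in_Sn => /= f Uf; first apply: val_inj; apply: insubdK.
  rewrite mulr_sumr; apply: eq_big => /= [s | s _]; rewrite ?(valP s) //.
  rewrite cP pvalE (anticomm_perm s ZC) mulrA; congr (_ * _).
  exact/esym/commr_sign.
by rewrite cP (anticomm_rep ZC Z0 nf) mul0r.
Qed.

End AnticommutingProducts.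

(** * Unitriangular substitutions in ordered products *)

Definition ltn_ord_rel N : rel 'I_N := fun i j => (i < j)%N.

Lemma enum_pairwise N : pairwise (@ltn_ord_rel N) (enum 'I_N).
Proof.
have tr : transitive (@ltn_ord_rel N) by move=> j i l; apply: ltn_trans.
rewrite -(sorted_pairwise tr).
by have := iota_ltn_sorted 0 N; rewrite -val_enum_ord sorted_map.
Qed.

(** A downward closed [q] cuts off an initial segment, so ordered noncommutative products split
    without reordering. *)
Lemma enum_split N (q : pred 'I_N) :
    (forall i j : 'I_N, (i < j)%N -> q j -> q i) ->
  enum 'I_N = filter q (enum 'I_N) ++ filter (predC q) (enum 'I_N).
Proof.
move=> qP; have := enum_pairwise N; elim: (enum 'I_N) => [|i s IHs] //=.
case/andP=> /allP is_ ps; case: ifP => qi /=; first by rewrite -IHs.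
have E j : j \in s -> q j = false.
  by move=> /is_ ij; apply/negbTE; apply: contraFN qi; apply: qP.
rewrite (eq_in_filter (a2 := pred0)) ?filter_pred0 //=; congr (_ :: _).
by rewrite (eq_in_filter (a2 := predT)) ?filter_predT // => j /E /= ->.
Qed.

Section Triangular.
Variables (k : fieldType) (n : nat) (A : gcAlg k n).
Variables (P : gmod A) (I : finType) (b : gbasis P I) (N : nat) (o : 'I_N -> I).
Hypothesis (k_char0 : [pchar k] =i pred0).
Hypothesis o_odd : forall i, godd (gb_deg b (o i)).
Local Notation S := (symalg P).
Local Notation Z i := (letter b (o i)).
Variables (F : 'I_N -> S) (c : 'I_N -> 'I_N -> A) (s : seq 'I_N).
Hypothesis s_pw : pairwise (@ltn_ord_rel N) s.

Lemma word_map (t : seq 'I_N) : word b (map o t) = \prod_(i <- t) Z i.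
Proof. exact: big_map. Qed.

(** Induct from the left. Corrections to the first factor are letters of the tail; the product of
    the tail already contains each of them, and odd letters square to 0. *)
Lemma prod_lower1 :
    (forall i, i \in s -> F i = Z i + \sum_(j <- s | (i < j)%N) Z j * ssc P (c i j)) ->
  \prod_(i <- s) F i = \prod_(i <- s) Z i.
Proof.
elim: s s_pw => [|i t IHt] /=; first by rewrite !big_nil.
case/andP=> /allP it pt hF; rewrite !big_cons IHt //; last first.
  move=> j jt; rewrite hF ?inE ?jt ?orbT // big_cons ifF //.
  by apply/negbTE; rewrite -leqNgt; apply/ltnW/it.
rewrite hF ?mem_head // big_cons ltnn mulrDl mulr_suml.
rewrite -[RHS]addr0; congr (_ + _); rewrite big_seq_cond; apply: big1 => j /andP[jt _].
rewrite -mulrA -word_map ssc_word mulrA (letter_word_odd k_char0) ?mul0r //.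
exact: map_f.
Qed.

Lemma prod_upper1 :
    (forall i, i \in s -> F i = Z i + \sum_(j <- s | (j < i)%N) Z j * ssc P (c i j)) ->
  \prod_(i <- s) F i = \prod_(i <- s) Z i.
Proof.
elim/last_ind: s s_pw => [|t i IHt] /=; first by rewrite !big_nil.
rewrite -cats1 pairwise_cat => /and3P[/allrelP ti pt _] hF.
have lti j : j \in t -> (j < i)%N by move=> jt; apply: ti jt (mem_head _ _).
rewrite !big_cat !big_seq1 /= IHt //; last first.
  move=> j jt; rewrite hF ?mem_cat ?jt // big_cat big_cons big_nil /= ifF ?addr0 //.
  by apply/negbTE; rewrite -leqNgt; apply/ltnW/lti.
rewrite hF ?mem_cat ?mem_head ?orbT // big_cat big_cons big_nil /= ltnn addr0.
rewrite mulrDr mulr_sumr -[RHS]addr0; congr (_ + _); rewrite big_seq_cond; apply: big1 => j /andP[jt _].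
by rewrite mulrA -word_map (word_letter_odd k_char0) ?mul0r ?map_f.
Qed.

End Triangular.

Section UnitriangularProducts.
Variables (k : fieldType) (n : nat) (A : gcAlg k n).
Variables (P : gmod A) (I : finType) (b : gbasis P I) (N : nat) (o : 'I_N -> I).
Hypothesis (k_char0 : [pchar k] =i pred0).
Hypothesis o_odd : forall i, godd (gb_deg b (o i)).
Local Notation Z i := (letter b (o i)).
Variables (c : 'I_N -> 'I_N -> A) (s : seq 'I_N).
Hypothesis (s_pw : pairwise (@ltn_ord_rel N) s) (c1 : forall i, c i i = 1).

Let s_uniq : uniq s.
Proof.
by apply: pairwise_uniq s_pw => i; apply: ltnn.
Qed.

(** Here [c i j] is the coefficient of letter [j] in factor [i], the transpose of a transition
    matrix; upper refers to the latter, and factor [i] involves only letters up to [i]. *)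
Lemma prod_upper_mx : (forall i j : 'I_N, (i < j)%N -> c i j = 0) ->
  \prod_(i <- s) \sum_(j <- s) Z j * ssc P (c i j) = \prod_(i <- s) Z i.
Proof.
move=> c0; apply: (prod_upper1 k_char0 o_odd (c := c)) => // i si.
rewrite (bigD1_seq i) //= c1 ssc1 mulr1; congr (_ + _).
rewrite [LHS]big_mkcond [RHS]big_mkcond /=; apply: eq_bigr => j _.
case: (ltngtP j i) => [ji|ij|/val_inj ->]; last by rewrite eqxx.
  by rewrite -val_eqE /= ltn_eqF.
by rewrite c0 // ssc0 mulr0 if_same.
Qed.

Lemma prod_lower_mx : (forall i j : 'I_N, (j < i)%N -> c i j = 0) ->
  \prod_(i <- s) \sum_(j <- s) Z j * ssc P (c i j) = \prod_(i <- s) Z i.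
Proof.
move=> c0; apply: (prod_lower1 k_char0 o_odd (c := c)) => // i si.
rewrite (bigD1_seq i) //= c1 ssc1 mulr1; congr (_ + _).
rewrite [LHS]big_mkcond [RHS]big_mkcond /=; apply: eq_bigr => j _.
case: (ltngtP i j) => [ij|ji|/val_inj ->]; last by rewrite eqxx.
  by rewrite -val_eqE /= gtn_eqF.
by rewrite c0 // ssc0 mulr0 if_same.
Qed.

End UnitriangularProducts.

Section InverseUnitriangular.
Variables (R : pzRingType) (N : nat) (X Y : 'M[R]_N).
Hypotheses (X1 : forall i, X i i = 1).

(** Column [j] of [Y *m X] expresses column [j] of [Y] through the earlier ones, whence induction on
    the column; no commutativity is involved. *)
Lemma inv_upper1 : Y *m X = 1%:M -> (forall i j : 'I_N, (j < i)%N -> X i j = 0) ->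
  (forall i, Y i i = 1) /\ (forall i j : 'I_N, (j < i)%N -> Y i j = 0).
Proof.
move=> YX X0.
have E i j : Y i j = (i == j)%:R - \sum_(l : 'I_N | (l < j)%N) Y i l * X l j.
  have := congr1 (fun T : 'M_N => T i j) YX; rewrite !mxE => <-.
  rewrite (bigD1 j) //= X1 mulr1 -addrA -[LHS]addr0; congr (_ + _); apply/esym/eqP.
  rewrite subr_eq0 [X in X == _]big_mkcond [X in _ == X]big_mkcond; apply/eqP.
  apply: eq_bigr => l _; rewrite -val_eqE /=.
  by case: ltngtP => // lj; rewrite X0 // mulr0.
have Y0 : forall j i : 'I_N, (j < i)%N -> Y i j = 0.
  move=> j; have [m] := ubnP (val j); elim: m j => // m IHm j /ltnSE jm i ji.
  rewrite E big1 ?subr0 => [|l lj]; last by rewrite (IHm l (leq_trans lj jm) i (ltn_trans lj ji)) mul0r.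
  by rewrite -val_eqE /= gtn_eqF.
split=> [i|i j]; last exact: Y0.
by rewrite E eqxx big1 ?subr0 // => l li; rewrite Y0 ?mul0r.
Qed.

Lemma inv_lower1 : X *m Y = 1%:M -> (forall i j : 'I_N, (i < j)%N -> X i j = 0) ->
  (forall i, Y i i = 1) /\ (forall i j : 'I_N, (i < j)%N -> Y i j = 0).
Proof.
move=> XY X0.
have E i j : Y i j = (i == j)%:R - \sum_(l : 'I_N | (l < i)%N) X i l * Y l j.
  have := congr1 (fun T : 'M_N => T i j) XY; rewrite !mxE => <-.
  rewrite (bigD1 i) //= X1 mul1r -addrA -[LHS]addr0; congr (_ + _); apply/esym/eqP.
  rewrite subr_eq0 [X in X == _]big_mkcond [X in _ == X]big_mkcond; apply/eqP.
  apply: eq_bigr => l _; rewrite -val_eqE /=.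
  by case: ltngtP => // lj; rewrite X0 // mul0r.
have Y0 : forall i j : 'I_N, (i < j)%N -> Y i j = 0.
  move=> i; have [m] := ubnP (val i); elim: m i => // m IHm i /ltnSE im j ij.
  rewrite E big1 ?subr0 => [|l li]; last by rewrite (IHm l (leq_trans li im) j (ltn_trans li ij)) mulr0.
  by rewrite -val_eqE /= ltn_eqF.
split=> [i|i j]; last exact: Y0.
by rewrite E eqxx big1 ?subr0 // => l li; rewrite Y0 ?mulr0.
Qed.

End InverseUnitriangular.

Lemma enum_index_enum (T : finType) : enum T = index_enum T.
Proof. by rewrite enumT /index_enum locked_withE. Qed.

(** * Block decompositions of indices and matrices *)

Section Blocks.
Variables (m : nat) (r : 'I_m -> nat).
Local Notation N := (\sum_u r u)%N.

Lemma rank_lt (u v : 'I_m) (a : 'I_(r u)) (d : 'I_(r v)) :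
  (u < v)%N -> (tagnat.Rank u a < tagnat.Rank v d)%N.
Proof.
move=> uv; rewrite ltnNge; apply: contraTN uv => h; rewrite -leqNgt.
have := tagnat.le_sig1 (h : (tagnat.Rank v d <= tagnat.Rank u a)%O).
by rewrite !tagnat.Rank1K.
Qed.

(** Both lists are strictly increasing and have the same members. *)
Lemma enum_blocks : enum 'I_N =
  flatten [seq [seq tagnat.Rank u a | a <- enum 'I_(r u)] | u <- enum 'I_m].
Proof.
have tr : transitive (@ltn_ord_rel N) by move=> j i l; apply: ltn_trans.
have ir : irreflexive (@ltn_ord_rel N) by move=> i; apply: ltnn.
apply: (irr_sorted_eq tr ir).
- by rewrite (sorted_pairwise tr) enum_pairwise.
- rewrite (sorted_pairwise tr); have := enum_pairwise m.
  elim: (enum 'I_m) => [|u s IHs] //= /andP[/allP us ps].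
  rewrite pairwise_cat IHs // andbT; apply/andP; split.
    apply/allrelP => _ j /mapP[a _ ->] /flattenP[_ /mapP[v vs ->] /mapP[d _ ->]].
    apply: rank_lt; first exact: us.
  have := enum_pairwise (r u); rewrite pairwise_map; apply: sub_pairwise => a d ad.
  have := @tagnat.lt_Rank _ r u a d; rewrite [(a < d)%O]ad => h; exact: h.
move=> i; rewrite mem_enum inE; apply/esym/flattenP.
exists [seq tagnat.Rank (tagnat.sig1 i) a | a <- enum 'I_(r (tagnat.sig1 i))].
  by apply: map_f; rewrite mem_enum.
by rewrite -{1}(tagnat.sig2K i); apply: map_f; rewrite mem_enum.
Qed.

Lemma big_blocks (R : Type) (idx : R) (op : Monoid.law idx) (F : 'I_N -> R) :
  \big[op/idx]_(i < N) F i = \big[op/idx]_(u < m) \big[op/idx]_(a < r u) F (tagnat.Rank u a).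
Proof.
transitivity (\big[op/idx]_(i <- enum 'I_N) F i); first by rewrite enum_index_enum.
rewrite enum_blocks big_flatten big_map enum_index_enum; apply: eq_bigr => u _.
by rewrite big_map enum_index_enum.
Qed.

End Blocks.

Lemma rm_det (R R' : pzRingType) (f : R -> R') m (X : 'M[R]_m) : is_rmorph f ->
  f (\det X) = \det (\matrix_(i, j) f (X i j)).
Proof.
move=> fR; rewrite /determinant (rm_sum fR); apply: eq_bigr => s _.
rewrite (rmM fR) (rm_prod fR); congr (_ * _).
  by case: (odd_perm s); rewrite ?expr1 ?(rmN fR) (rm1 fR).
by apply: eq_bigr => i _; rewrite mxE.
Qed.

Section BlockMatrices.
Variables (R : pzRingType) (m : nat) (r : 'I_m -> nat).
Implicit Types X Y : 'M[R]_(\sum_u r u).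

Definition diag_blocks X : Prop := forall u v, u != v -> submxblock X u v = 0.

Lemma submxblockE X u v a d :
  submxblock X u v a d = X (tagnat.Rank u a) (tagnat.Rank v d).
Proof. exact: mxE. Qed.

Lemma submxblock_mul_diagl X Y u v : diag_blocks X ->
  submxblock (X *m Y) u v = submxblock X u u *m submxblock Y u v.
Proof.
move=> dX; apply/matrixP => a d; rewrite !mxE big_blocks (bigD1 u) //=.
rewrite [X in _ + X]big1 ?addr0 => [|w wu]; first by apply: eq_bigr => c _; rewrite !mxE.
apply: big1 => c _; have := dX u w; rewrite eq_sym wu => /(_ isT) /matrixP /(_ a c).
by rewrite !mxE => ->; rewrite mul0r.
Qed.

Lemma submxblock_mul_diagr X Y u v : diag_blocks X ->
  submxblock (Y *m X) u v = submxblock Y u v *m submxblock X v v.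
Proof.
move=> dX; apply/matrixP => a d; rewrite !mxE big_blocks (bigD1 v) //=.
rewrite [X in _ + X]big1 ?addr0 => [|w wv]; first by apply: eq_bigr => c _; rewrite !mxE.
apply: big1 => c _; have := dX w v wv => /matrixP /(_ c d).
by rewrite !mxE => ->; rewrite mulr0.
Qed.

Lemma submxblock1_diag u : submxblock (1%:M : 'M[R]_(\sum_u r u)) u u = 1%:M.
Proof.
apply/matrixP => a d; rewrite !mxE; congr (nat_of_bool _)%:R.
by rewrite -val_eqE tagnat.eq_Rank eqxx.
Qed.

Lemma submxblock1_off u v : u != v -> submxblock (1%:M : 'M[R]_(\sum_u r u)) u v = 0.
Proof.
move=> uv; apply/matrixP => a d; rewrite !mxE.
by rewrite -val_eqE tagnat.eq_Rank (negPf uv).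
Qed.

(** Since X_vv Y_vv = 1, Y_uv equals Y_uv X_vv Y_vv, and Y_uv X_vv is the block (u, v) of the
    identity. *)
Lemma inv_diag_blocks X Y : X *m Y = 1%:M -> Y *m X = 1%:M -> diag_blocks X ->
  diag_blocks Y.
Proof.
move=> XY YX dX u v uv.
have X1 : submxblock X v v *m submxblock Y v v = 1%:M.
  by rewrite -submxblock_mul_diagl // XY submxblock1_diag.
rewrite -[LHS]mulmx1 -X1 mulmxA -submxblock_mul_diagr // YX submxblock1_off //.
by rewrite mul0mx.
Qed.

Lemma blocks_upper1 X :
    (forall u, submxblock X u u = 1%:M) ->
    (forall u v : 'I_m, (v < u)%N -> submxblock X u v = 0) ->
  (forall i, X i i = 1) /\ (forall i j : 'I_(\sum_u r u), (j < i)%N -> X i j = 0).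
Proof.
move=> X1 X0; have XE u v a d : X (tagnat.Rank u a) (tagnat.Rank v d) = submxblock X u v a d.
  by rewrite mxE.
split=> [i|i j]; first by rewrite -(tagnat.sig2K i) XE X1 mxE eqxx.
rewrite -(tagnat.sig2K i) -(tagnat.sig2K j) XE.
move: (tagnat.sig1 i) (tagnat.sig2 i) (tagnat.sig1 j) (tagnat.sig2 j) => u a v d.
case: (ltngtP v u) => [vu _|uv|/val_inj vu]; first by rewrite X0 // mxE.
  by rewrite ltnNge ltnW // rank_lt.
case: _ / vu in a *; rewrite X1 mxE => da; case: eqP => // ad.
by rewrite ad ltnn in da.
Qed.

Lemma blocks_lower1 X :
    (forall u, submxblock X u u = 1%:M) ->
    (forall u v : 'I_m, (u < v)%N -> submxblock X u v = 0) ->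
  (forall i, X i i = 1) /\ (forall i j : 'I_(\sum_u r u), (i < j)%N -> X i j = 0).
Proof.
move=> X1 X0; have XE u v a d : X (tagnat.Rank u a) (tagnat.Rank v d) = submxblock X u v a d.
  by rewrite mxE.
split=> [i|i j]; first by rewrite -(tagnat.sig2K i) XE X1 mxE eqxx.
rewrite -(tagnat.sig2K i) -(tagnat.sig2K j) XE.
move: (tagnat.sig1 i) (tagnat.sig2 i) (tagnat.sig1 j) (tagnat.sig2 j) => u a v d.
case: (ltngtP u v) => [uv _|vu|/val_inj uv]; first by rewrite X0 // mxE.
  by rewrite ltnNge ltnW // rank_lt.
case: _ / uv in d *; rewrite X1 mxE => da; case: eqP => // ad.
by rewrite ad ltnn in da.
Qed.

End BlockMatrices.

(** * The Berezinian read off from the Koszul complex *)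

Section BerezinianOfBasisChange.
Variables (k : fieldType) (n : nat) (A : gcAlg k n).
Variables (r : 'I_(2 ^ n) -> nat) (M : gmod A) (p : Gam n).
Hypotheses (k_char0 : [pchar k] =i pred0) (n_gt0 : (0 < n)%N) (p_odd : godd p).
Implicit Types e : std_basis r M.
Local Notation P := (dsum_gmod (parity_gmod p M) (dual_gmod M)).
Local Notation S := (symalg P).
Local Notation kb e := (kbasis p e).
Local Notation Z e j := (letter (kb e) (odd_letter j)).
Local Notation N := (total_rank r).
Local Notation ev i := (i < even_rank r)%N.

Section Coefficients.
Variables e e' : std_basis r M.
Local Notation X := (basis_mx e e').
Local Notation Y := (basis_mx e' e).

Lemma ssc_central a (x : S) : homog (ga_gr A) 0 a -> ssc P a * x = x * ssc P a.
Proof.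
move=> ha; elim/(word_ind (b := kb e)): x => [|x y Ex Ey|s c].
- by rewrite mulr0 mul0r.
- by rewrite mulrDl mulrDr Ex Ey.
rewrite mulrA ssc_word (twist_homog _ ha) gsgn0 mul1r -!mulrA -!sscM.
by rewrite (homog0_central _ ha).
Qed.

(* The transition matrix of the odd letters, the even ones being set to 0. *)
Definition odd_mx (i j : 'I_N) : A :=
  if ev i then X j i else twist (std_ideg j) (Y i j).

(** Pi e_j survives only for even e_j and eps^j only for odd e_j, so the two kinds do not mix. The
    twist moves the left coefficients of the eps^j to the right. *)
Lemma restrict_odd_letter i :
  restrict (kb e) (@is_odd_letter _ r) (Z e' i) =
  \sum_(j : 'I_N | ev j == ev i) Z e j * ssc P (odd_mx i j).
Proof.
rewrite [RHS]big_mkcond /odd_mx /odd_letter; have rR := restrict_rmorph (kb e) (@is_odd_letter _ r).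
case: (boolP (ev i)) => ei.
  rewrite (letter_true_change p e) (rm_sum rR); apply: eq_bigr => j _.
  rewrite (rmM rR) restrict_ssc restrict_letter /is_odd_letter /=.
  by case: (ev j) => //=; rewrite mul0r.
rewrite (letter_false_change p e) (rm_sum rR); apply: eq_bigr => j _.
rewrite (rmM rR) restrict_ssc restrict_letter /is_odd_letter /=.
by case: (ev j) => //=; rewrite ?mulr0 // ssc_letter.
Qed.

Lemma ber_coef_prod a :
  \prod_(i < N) \sum_(j : 'I_N | ev j == ev i) Z e j * ssc P (odd_mx i j)
    = (\prod_i Z e i) * ssc P a ->
  ber_coef p e e' = a.
Proof.
move=> E; apply: top_coef_restrict.
rewrite /top_form /word /odd_letters (rm_prod (restrict_rmorph _ _)).
rewrite [LHS]big_map [X in _ = X * _]big_map !enum_index_enum -E.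
by apply: eq_bigr => i _; rewrite restrict_odd_letter.
Qed.

Lemma odd_letter_odd j : godd (gb_deg (kb e) (odd_letter j)).
Proof. by rewrite godd_letter // /is_odd_letter eqxx. Qed.

Lemma prod_parity_split (F : 'I_N -> S) :
  \prod_i F i = (\prod_(i <- [seq i : 'I_N <- enum 'I_N | ev i]) F i) *
                (\prod_(i <- [seq i : 'I_N <- enum 'I_N | ~~ ev i]) F i).
Proof.
rewrite -big_cat /= -enum_split ?enum_index_enum // => i j ij.
exact: ltn_trans.
Qed.

Lemma prod_parity_sum :
  \prod_(i < N) \sum_(j : 'I_N | ev j == ev i) Z e j * ssc P (odd_mx i j) =
  (\prod_(i <- [seq i : 'I_N <- enum 'I_N | ev i])
     \sum_(j <- [seq i : 'I_N <- enum 'I_N | ev i]) Z e j * ssc P (X j i)) *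
  (\prod_(i <- [seq i : 'I_N <- enum 'I_N | ~~ ev i])
     \sum_(j <- [seq i : 'I_N <- enum 'I_N | ~~ ev i]) Z e j * ssc P (twist (std_ideg j) (Y i j))).
Proof.
rewrite prod_parity_split !big_filter !enum_index_enum; congr (_ * _).
  by apply: eq_bigr => i ei; rewrite big_filter;
     apply: eq_big => j; rewrite /odd_mx ei // eqb_id.
by apply: eq_bigr => i /negPf ei; rewrite big_filter;
     apply: eq_big => j; rewrite /odd_mx ei // eqbF_neg.
Qed.

(** The letters Pi e'_i expand along columns of [X] and the eps'^i along rows of its inverse; one
    half thus uses [prod_upper_mx], the other [prod_lower_mx]. *)
Lemma ber_coef_upper : block_upper1 X -> ber_coef p e e' = 1.
Proof.
case=> /blocks_upper1 /[apply] -[X1 X0].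
have [Y1 Y0] := inv_upper1 X1 (basis_mxV e' e) X0.
apply: ber_coef_prod; rewrite ssc1 mulr1 prod_parity_sum prod_parity_split.
have pw (q : pred 'I_N) := pairwise_filter q (enum_pairwise N).
congr (_ * _).
  by apply: (prod_upper_mx k_char0 odd_letter_odd) => // i j; apply: X0.
apply: (prod_lower_mx k_char0 odd_letter_odd (c := fun i j => twist (std_ideg j) (Y i j))) => //.
  by move=> i; rewrite Y1 twist1.
by move=> i j ji; rewrite Y0 // twist0.
Qed.

Lemma ber_coef_lower : block_lower1 X -> ber_coef p e e' = 1.
Proof.
case=> /blocks_lower1 /[apply] -[X1 X0].
have [Y1 Y0] := inv_lower1 X1 (basis_mxV e e') X0.
apply: ber_coef_prod; rewrite ssc1 mulr1 prod_parity_sum prod_parity_split.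
have pw (q : pred 'I_N) := pairwise_filter q (enum_pairwise N).
congr (_ * _).
  by apply: (prod_lower_mx k_char0 odd_letter_odd) => // i j; apply: X0.
apply: (prod_upper_mx k_char0 odd_letter_odd (c := fun i j => twist (std_ideg j) (Y i j))) => //.
  by move=> i; rewrite Y1 twist1.
by move=> i j ji; rewrite Y0 // twist0.
Qed.

Lemma ev_Rank u (a : 'I_(r u)) : ev (tagnat.Rank u a : 'I_N) = (u < 2 ^ n.-1)%N.
Proof. by rewrite (even_rankP (tagnat.Rank u a : 'I_N)) tagnat.Rank1K. Qed.

Lemma std_ideg_Rank u (a : 'I_(r u)) : std_ideg (tagnat.Rank u a : 'I_N) = std_deg u.
Proof. by rewrite /std_ideg tagnat.Rank1K. Qed.

Lemma deg0_block (T : 'M[A]_N) u : deg0_mx T -> deg0_entries (submxblock T u u).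
Proof.
move=> dT a d; rewrite submxblockE -(gamDD (std_deg u)).
by rewrite -{1}(std_ideg_Rank a) -(std_ideg_Rank d).
Qed.

Definition odd_block u : 'M[A]_(r u) :=
  \matrix_(a, d) odd_mx (tagnat.Rank u a : 'I_N) (tagnat.Rank u d : 'I_N).

Lemma odd_blockE u : odd_block u =
  if (u < 2 ^ n.-1)%N then (submxblock X u u)^T else submxblock Y u u.
Proof.
apply/matrixP => a d; rewrite mxE /odd_mx ev_Rank.
case: ifP => _; first by rewrite !mxE.
rewrite submxblockE std_ideg_Rank (twist_homog (g := 0) _) ?gsgn0 ?mul1r //.
by rewrite -submxblockE; apply: deg0_block (basis_mx_deg0 e' e) a d.
Qed.

Lemma deg0_odd_block u : deg0_entries (odd_block u).
Proof.
rewrite odd_blockE; case: ifP => _ a d; last exact: deg0_block (basis_mx_deg0 e' e) a d.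
by rewrite mxE; apply: deg0_block (basis_mx_deg0 e e') d a.
Qed.

(** Odd letters of one block share an odd degree, so they anticommute, and the coefficients within
    the block have degree 0, hence are central: [anticomm_det] applies. *)
Lemma prod_block u : block_diag X ->
  \prod_(a < r u) \sum_(j : 'I_N | ev j == ev (tagnat.Rank u a : 'I_N))
     Z e j * ssc P (odd_mx (tagnat.Rank u a : 'I_N) j) =
  (\prod_(a < r u) Z e (tagnat.Rank u a : 'I_N)) * ssc P (\det (odd_block u)).
Proof.
move=> dX; have dY := inv_diag_blocks (basis_mxV e e') (basis_mxV e' e) dX.
rewrite (rm_det _ (ssc_rmorph P)) -anticomm_det.
- apply: eq_bigr => a _.
  rewrite big_mkcond (big_blocks (r := r)) (bigD1 u) //= [X in _ + X]big1 ?addr0 => [|w wu].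
    by apply: eq_bigr => d _; rewrite !ev_Rank eqxx !mxE.
  apply: big1 => d _; case: ifP => // _; suff -> : odd_mx (tagnat.Rank u a : 'I_N) (tagnat.Rank w d : 'I_N) = 0.
    by rewrite ssc0 mulr0.
  rewrite /odd_mx; case: ifP => _.
    by have /matrixP/(_ d a) := dX w u wu; rewrite !mxE.
  have /matrixP/(_ a d) : submxblock Y u w = 0 by apply: dY; rewrite eq_sym.
  by rewrite !mxE => ->; rewrite twist0.
- move=> a d; rewrite letterC.
  have -> : gb_deg (kb e) (odd_letter (tagnat.Rank u a : 'I_N))
      = gb_deg (kb e) (odd_letter (tagnat.Rank u d : 'I_N)).
    by rewrite /odd_letter /= /kb_deg /= !ev_Rank !std_ideg_Rank.
  by rewrite gsgnxx odd_letter_odd expr1 mulN1r.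
- by move=> a; rewrite letter_odd // odd_letter_odd.
move=> a d x; rewrite mxE; apply: ssc_central.
exact: deg0_odd_block.
Qed.

Lemma ber_coef_diag (c : 'I_(2 ^ n) -> A) : block_diag X ->
    (forall u : 'I_(2 ^ n), (2 ^ n.-1 <= u)%N -> c u * \det (submxblock X u u) = 1) ->
  ber_coef p e e' = \prod_(u : 'I_(2 ^ n) | (u < 2 ^ n.-1)%N) \det (submxblock X u u)
             * \prod_(u : 'I_(2 ^ n) | (2 ^ n.-1 <= u)%N) c u.
Proof.
move=> dX cX; set d := RHS.
have dE : d = \prod_u \det (odd_block u).
  rewrite -[index_enum _]enum_index_enum.
  rewrite (enum_split (q := fun u : 'I_(2 ^ n) => (u < 2 ^ n.-1)%N)); last first.
    by move=> i j ij; apply: ltn_trans.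
  rewrite big_cat !big_filter !enum_index_enum; congr (_ * _).
    apply: eq_bigr => u hu; rewrite odd_blockE hu det_tr_deg0 //.
    exact: deg0_block (basis_mx_deg0 e e').
  apply: eq_big => u; first by rewrite /= leqNgt.
  move=> hu; rewrite odd_blockE ltnNge hu /=.
  (* Blocks of [X] and [Y] are mutually inverse, so the determinant of the block of [Y] is the
     inverse [c u]. *)
  rewrite -[RHS]mul1r -(cX u hu) -mulrA -det_mul_deg0; try exact/deg0_block/basis_mx_deg0.
  rewrite -submxblock_mul_diagl // basis_mxV submxblock1_diag.
  by rewrite det1_deg0 mulr1.
apply: ber_coef_prod; rewrite dE (big_blocks (r := r)) [X in _ = X * _](big_blocks (r := r)).
rewrite [LHS](eq_bigr _ (fun u _ => @prod_block u dX)).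
elim: (index_enum _) => [|u s IHs]; first by rewrite !big_nil ssc1 mulr1.
rewrite !big_cons IHs /= sscM -!mulrA; congr (_ * _).
rewrite !mulrA; congr (_ * _); apply: ssc_central.
exact/homog_det/deg0_odd_block.
Qed.

End Coefficients.
(* Outside GL^0 the value is irrelevant. *)
Definition change_basis e (X : 'M[A]_N) : std_basis r M :=
  if pselect (inGL0 X) is left hX then projT1 (cid (basis_of_GL0 e hX)) else e.

Lemma change_basisP e X : inGL0 X -> basis_mx e (change_basis e X) = X.
Proof.
by move=> hX; rewrite /change_basis; case: pselect => // h; case: cid.
Qed.

Lemma inGL0_mul X Y : inGL0 X -> inGL0 Y -> inGL0 (X *m Y : 'M[A]_N).
Proof.
have dM (T U : 'M[A]_N) : deg0_mx T -> deg0_mx U -> deg0_mx (T *m U).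
  move=> dT dU i j; rewrite mxE /homog gpr_bigsum; apply: eq_bigr => l _.
  have := ga_mul (dT i l) (dU l j).
  by rewrite addrA -[X in X + _]addrA gamDD addr0.
move=> [dX [X' [dX' XX' X'X]]] [dY [Y' [dY' YY' Y'Y]]]; split; first exact: dM.
exists (Y' *m X'); split; first exact: dM.
  by rewrite mulmxA -[X *m Y *m Y']mulmxA YY' mulmx1.
by rewrite mulmxA -[Y' *m X' *m X]mulmxA X'X mulmx1.
Qed.

Section BasisBerezinian.
Variable e : std_basis r M.
Let ber (X : 'M[A]_N) := ber_coef p e (change_basis e X).

Fact basis_ber_deg0 X : inGL0 X -> homog (ga_gr A) 0 (ber X).
Proof. by move=> _; apply: homog_ber_coef. Qed.
Fact basis_ber_mul X Y : inGL0 X -> inGL0 Y -> ber (X *m Y) = ber X * ber Y.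
Proof.
move=> hX hY; rewrite /ber (ber_coef_trans _ _ _ _ (change_basis e X)) //; congr (_ * _).
apply: ber_coef_mx => //; rewrite change_basisP //.
(* Cancelling [X] on the left shows that the second change of basis has matrix [Y]. *)
have := basis_mx_trans e (change_basis e X) (change_basis e (X *m Y)).
rewrite !change_basisP //; last exact: inGL0_mul.
case: hX => _ [X' [_ _ X'X]] /(congr1 (mulmx X')).
by rewrite !mulmxA X'X !mul1mx.
Qed.
Fact basis_ber_unit X : inGL0 X -> exists2 b, homog (ga_gr A) 0 b & ber X * b = 1.
Proof.
move=> hX; exists (ber_coef p (change_basis e X) e); first exact: homog_ber_coef.
by rewrite /ber -ber_coef_trans // ber_coef1.
Qed.
Fact basis_ber_diag X (c : 'I_(2 ^ n) -> A) : inGL0 X -> block_diag X ->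
    (forall u : 'I_(2 ^ n), (2 ^ n.-1 <= u)%N -> c u * \det (submxblock X u u) = 1) ->
    ber X = \prod_(u : 'I_(2 ^ n) | (u < 2 ^ n.-1)%N) \det (submxblock X u u)
             * \prod_(u : 'I_(2 ^ n) | (2 ^ n.-1 <= u)%N) c u.
Proof.
move=> hX; rewrite -{1 2 4}(change_basisP e hX); exact: ber_coef_diag.
Qed.
Fact basis_ber_upper X : inGL0 X -> block_upper1 X -> ber X = 1.
Proof. by move=> hX; rewrite -{1}(change_basisP e hX); apply: ber_coef_upper. Qed.
Fact basis_ber_lower X : inGL0 X -> block_lower1 X -> ber X = 1.
Proof. by move=> hX; rewrite -{1}(change_basisP e hX); apply: ber_coef_lower. Qed.

Definition gber_of_basis : gberezinian A r :=
  GBerezinian basis_ber_deg0 basis_ber_unit basis_ber_mul basis_ber_diag basis_ber_upper basis_ber_lower.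

Lemma gber_of_basisE e' : gber_of_basis (basis_mx e e') = ber_coef p e e'.
Proof.
rewrite /= /ber; congr ber_coef; apply: (@basis_mx_inj _ _ _ _ _ e).
by rewrite change_basisP //; apply: basis_mx_GL0.
Qed.

End BasisBerezinian.
End BerezinianOfBasisChange.

(** * The isomorphism *)

Lemma inj_surj_bij (T U : Type) (f : T -> U) :
  injective f -> (forall y, exists x, f x = y) -> bijective f.
Proof.
move=> fI /choice[g gK]; exists g => // x.
by apply: fI; rewrite gK.
Qed.

Lemma sub_val_ract k n (A : gcAlg k n) (N : gmod A) (T : gsub N) (x : sub_gmod T) a :
  sub_val (ract x a) = ract (sub_val x) a.
Proof.
by rewrite /ract (big_morph (fun y : sub_sort T => sub_val y) (fun _ _ => erefl) erefl).
Qed.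

Section PsiIsomorphism.
Variables (k : fieldType) (n : nat) (A : gcAlg k n).
Variables (r : 'I_(2 ^ n) -> nat) (M : gmod A) (e0 : std_basis r M) (p : Gam n).
Hypotheses (k_char0 : [pchar k] =i pred0) (n_gt0 : (0 < n)%N) (p_odd : godd p).
Variable gBer : gberezinian A r.
Hypothesis gBer_unique : forall (f : gberezinian A r) (X : 'M[A]_(total_rank r)),
  inGL0 X -> f X = gBer X.
Implicit Types e : std_basis r M.
Local Notation P := (dsum_gmod (parity_gmod p M) (dual_gmod M)).
Local Notation S := (symalg P).
Local Notation kb e := (kbasis p e).
Local Notation Z e j := (letter (kb e) (odd_letter j)).
Local Notation N := (total_rank r).
Local Notation ev i := (i < even_rank r)%N.
Local Notation d := (koszul_d p e0).
Local Notation K := (koszul_elt p e0 : S).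
Local Notation H := (cohomology d).

Lemma ber_coef_gBer e e' : ber_coef p e e' = gBer (basis_mx e e').
Proof.
rewrite -(gber_of_basisE k_char0 n_gt0 p_odd); apply: gBer_unique.
exact: basis_mx_GL0.
Qed.

(** Counts the indices at which [xi] is minus the odd letter. It depends on [r] and [p] but not on
    the basis, so it cancels between two bases. *)
Definition xi_sign : nat :=
  (\sum_(i < N) (~~ ev i && (gpair (std_ideg i) p != 1%R)))%N.

Lemma prod_xi e : \prod_i xi p e i = (-1) ^+ xi_sign * top_form p e.
Proof.
have xiE i : xi p e i = (-1) ^+ (~~ ev i && (gpair (std_ideg i) p != 1)) * Z e i.
  rewrite /xi /odd_letter; case: ifP => ei /=; first by rewrite mul1r.
  have -> : letter (kb e) (false, i) = kdual p (dual_basis e i) by [].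
  by rewrite gsgn_signr; case: (_ == 1); rewrite /= ?expr1 ?expr0 ?mulN1r ?mul1r ?opprK.
rewrite (eq_bigr _ (fun i _ => xiE i)) /xi_sign /top_form /word /odd_letters.
rewrite [X in _ = _ * X]big_map enum_index_enum.
elim: (index_enum _) => [|i s IHs]; first by rewrite !big_nil mulr1.
rewrite !big_cons IHs exprD -!mulrA; congr (_ * _); rewrite !mulrA; congr (_ * _).
exact: commr_sign.
Qed.

Lemma wdeg_odd_letters e : wdeg (kb e) (odd_letters r) = ber_deg r + p *+ even_rank r.
Proof.
rewrite /wdeg /odd_letters big_map enum_index_enum.
rewrite (eq_bigr (fun i : 'I_N => std_ideg i + (if ev i then p else 0))); last first.
  by move=> i _; rewrite /odd_letter /= /kb_deg /=; case: ifP => _; rewrite ?addr0.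
rewrite big_split /=; congr (_ + _); rewrite (big_blocks (r := r)) /=.
  apply: eq_bigr => u _; rewrite -[in RHS](card_ord (r u)) -sumr_const.
  by apply: eq_bigr => a _; rewrite std_ideg_Rank.
rewrite /even_rank -sumrMnr [RHS]big_mkcond; apply: eq_bigr => u _ /=.
case: ifP => hu; last by rewrite big1 // => a _; rewrite ev_Rank hu.
rewrite -[in RHS](card_ord (r u)) -sumr_const; apply: eq_bigr => a _.
by rewrite ev_Rank hu.
Qed.

Lemma koszul_prod_xi e : d (\prod_i xi p e i) = 0.
Proof.
rewrite prod_xi -[LHS]/(K * _); have -> : K * ((-1) ^+ xi_sign * top_form p e)
    = (-1) ^+ xi_sign * (K * top_form p e) by rewrite mulrA commr_sign mulrA.
by rewrite -(koszul_elt_indep p e0 e) koszul_top // mulr0.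
Qed.

Definition xi_cycle e : cycles d :=
  SubElt (asboolT (koszul_prod_xi e) : _ \in gs_pred (ker_gsub d)).
Definition xi_class e : H := coh_class (xi_cycle e).

Lemma xi_class_ract e a :
  ract (xi_class e) a = coh_class (ract (xi_cycle e) a).
Proof. exact: quot_ract. Qed.

Lemma sub_val_xi_ract e a : sub_val (ract (xi_cycle e) a) =
  (-1) ^+ xi_sign * (top_form p e * ssc P a) :> S.
Proof.
rewrite sub_val_ract /= prod_xi.
by rewrite (symalg_ractE (P := P)) mulrA.
Qed.

Lemma coh_classP (x y : cycles d) (z : S) :
  sub_val x = (sub_val y : S) + K * z -> coh_class x = coh_class y.
Proof.
move=> E; apply/quot_piP; exists z.
by rewrite /= E addrC addKr.
Qed.

Lemma xi_class_change e e' : xi_class e' = ract (xi_class e) (ber_coef p e e').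
Proof.
rewrite xi_class_ract; have [y E] := top_change k_char0 n_gt0 p_odd e e'.
apply: (@coh_classP _ _ ((-1) ^+ xi_sign * y)).
rewrite sub_val_xi_ract /= prod_xi E mulrDr (koszul_elt_indep p e0 e); congr (_ + _).
by rewrite !mulrA commr_sign.
Qed.

Lemma homog_xi_class e : homog (gm_gr H) (ber_deg r + p *+ even_rank r) (xi_class e).
Proof.
rewrite /homog /= quot_gpr_pi; congr quot_pi; apply: val_inj => /=.
rewrite prod_xi -(wdeg_odd_letters e) -signr_odd.
by case: odd; rewrite ?expr1 ?expr0 ?mulN1r ?mul1r;
  [exact: homogN (homog_top p e)|exact: homog_top].
Qed.

Fixpoint psi_exp (s : bexp r M) : H :=
  match s with
  | Bgen e a => ract (xi_class e) a
  | Bzero => 0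
  | Badd t u => psi_exp t + psi_exp u
  | Bopp t => - psi_exp t
  end.

(** The one rule with content is [bc_change], where [xi_class_change] and the identification of
    [ber_coef] with [gBer] meet. *)
Lemma psi_exp_cong s t : bcong gBer s t -> psi_exp s = psi_exp t.
Proof.
elim=> {s t} //=.
- by move=> s t u _ -> _ ->.
- by move=> s s' t t' _ -> _ ->.
- by move=> s s' _ ->.
- by move=> s t u; rewrite addrA.
- by move=> s t; rewrite addrC.
- by move=> s; rewrite add0r.
- by move=> s; rewrite addNr.
- by move=> e a b; rewrite ractDr.
move=> e e' T a hT eT.
by rewrite (xi_class_change e e') ractA ber_coef_gBer (basis_changeP eT).
Qed.

Definition psi (x : ber_gmod M gBer) : H := psi_exp (brepr x).

Lemma psi_pi s : psi (bpi gBer s) = psi_exp s.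
Proof. exact/psi_exp_cong/brepr_pi. Qed.

Lemma psi_bmul e a : psi (bmul gBer e a) = ract (xi_class e) a.
Proof. exact: psi_pi. Qed.

Lemma psiD : {morph psi : x y / x + y}.
Proof. by elim/bpiW=> s; elim/bpiW=> t; rewrite -bpiD !psi_pi. Qed.

Lemma ber_bmul (x : ber_gmod M gBer) : exists a, x = bmul gBer e0 a.
Proof.
elim/ber_ind: x => [e a||x y [a ->] [b ->]|x [a ->]].
- by exists (gBer (basis_mx e0 e) * a); apply: bmul_change (basis_change_mx e0 e); apply: basis_mx_GL0.
- by exists 0; rewrite bmul0.
- by exists (a + b); rewrite bmulD.
by exists (- a); apply/eqP; rewrite eq_sym -addr_eq0 -bmulD addNr bmul0.
Qed.

Lemma psi_glinear : is_glinear (p *+ even_rank r) psi.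
Proof.
split=> [|h x hx|x a]; first exact: psiD.
  have [a xE] := ber_bmul x; rewrite -hx xE /= b_gpr_mul psi_bmul.
  have := homog_ract (homog_xi_class e0) (homog_gpr (ga_gr A) (h - ber_deg r) a).
  by rewrite addrC addrA subrK.
have [c ->] := ber_bmul x; rewrite psi_bmul ractA -psi_bmul; congr psi.
by rewrite -!ber_ract ractA.
Qed.

(** If the images agree, [top_form] times the difference of the coefficients is a boundary, and
    [top_coef] reads off that this difference is 0. *)
Lemma psi_inj : injective psi.
Proof.
move=> x y; have [a ->] := ber_bmul x; have [c ->] := ber_bmul y.
rewrite !psi_bmul !xi_class_ract => /quot_piP[z /= zE].
congr bmul; apply/eqP; rewrite -subr_eq0; apply/eqP.
rewrite -[LHS](top_coef_top p e0).
have -> : top_form p e0 * ssc P (a - c) = K * ((-1) ^+ xi_sign * (z : S)); last exact: top_coef_koszul.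
rewrite mulrA commr_sign -mulrA zE.
rewrite -[X in _ = _ * X]/((sub_val (ract (xi_cycle e0) a) : S) - sub_val (ract (xi_cycle e0) c)).
rewrite !sub_val_xi_ract -mulrBr mulrA -exprD -mulrBr -(rmN (ssc_rmorph P)) -sscD.
by rewrite addnn -mul2n exprM sqrrN expr1n expr1n mul1r.
Qed.

Lemma psi_surj y : exists x, psi x = y.
Proof.
elim/quot_piW: y => z.
have Kz : K * sub_val z = 0 by have := asboolW (sub_valP z).
have [a [y zE]] := cycle_top k_char0 n_gt0 p_odd Kz.
(* The sign compensates for the one between the product of the [xi] and [top_form]. *)
exists (bmul gBer e0 ((-1) ^+ xi_sign * a)); rewrite psi_bmul xi_class_ract.
apply/esym/(@coh_classP _ _ y); rewrite sub_val_xi_ract zE; congr (_ + _).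
have -> : ssc P ((-1) ^+ xi_sign * a) = (-1) ^+ xi_sign * ssc P a.
  rewrite -signr_odd -[in RHS]signr_odd; case: odd; rewrite ?expr0 ?mul1r //.
  by rewrite !expr1 !mulN1r (rmN (ssc_rmorph P)).
rewrite [top_form p e0 * (_ * _)]mulrA commr_sign !mulrA -exprD addnn -mul2n exprM sqrrN.
by rewrite expr1n expr1n mul1r.
Qed.

End PsiIsomorphism.

(** The known existence and uniqueness of the graded Berezinian appear as [gBer] and [gBer_unique].
    The basis [e0] serves to write down the differential, which by [koszul_elt_indep] is the same
    for every basis. *)
Theorem theorem1 (k : fieldType) (k_char0 : [pchar k] =i pred0)
    (n : nat) (n_gt0 : (0 < n)%N) (A : gcAlg k n)
    (r : 'I_(2 ^ n) -> nat) (M : gmod A) (e0 : std_basis r M)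
    (p : Gam n) (p_odd : godd p)
    (gBer : gberezinian A r)
    (gBer_unique : forall (f : gberezinian A r) (X : 'M[A]_(total_rank r)),
       inGL0 X -> f X = gBer X) :
  exists psi : ber_gmod M gBer -> cohomology (koszul_d p e0),
    [/\ is_glinear (p *+ even_rank r) psi,
        bijective psi
      & forall e : std_basis r M,
          exists z : cycles (koszul_d p e0),
            sub_val z = \prod_i xi p e i /\ psi (ber_gen gBer e) = coh_class z].
Proof.
exists (psi e0 k_char0 n_gt0 p_odd (gBer := gBer)); split.
- exact: psi_glinear.
- by apply: inj_surj_bij; [apply: psi_inj|apply: psi_surj].
move=> e; exists (xi_cycle e0 k_char0 n_gt0 p_odd e); split=> //.
by rewrite /ber_gen psi_bmul // ract1.
Qed.
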